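(* There is an absolute constant $c>0$ such that the following holds. Let $A\in\mathbb{R}^{d\times n}$ be a matrix with singular values $1\ge\sigma_1\ge\cdots\ge\sigma_d\ge0$. For fixed $\varepsilon,p>0$, consider the output $$(v_1,\dots,v_k)=V_k\leftarrow\mathrm{LazySVD}\Big(\mathcal A,\;AA^\top,\;k,\;\frac{\varepsilon}{3},\;c\cdot\frac{\varepsilon^6}{k^4d^4(\sigma_1/\sigma_{k+1})^{12}},\;p\Big).$$ Then, defining $A_k=V_kV_k^\top A$, which is a rank-$k$ matrix, with probability at least $1-p$: 1. $\|A-A_k\|_2\le(1+\varepsilon)\|A-A_k^*\|_2$; 2. $\|A-A_k\|_F\le(1+\varepsilon)\|A-A_k^*\|_F$; and 3. for all $i\in\{1,\dots,k\}$, $|v_i^\top AA^\top v_i-\sigma_i^2|\le\varepsilon\sigma_i^2$. The running time is $\widetilde O\Big(\frac{k\,\mathsf{nnz}(A)+k^2d}{\sqrt\varepsilon}\Big)$ (with $\mathcal A$ being accelerated gradient descent), or $\widetilde O\Big(knd+\frac{kn^{3/4}d}{\sigma_k^{1/2}\sqrt\varepsilon}\Big)$ in the stochastic setting (with $\mathcal A$ being accelerated SVRG).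
   Context: The parameters passed to LazySVD are assumed to be in its admissible ranges. If $A$ has fewer than $d$ singular values, zeros are appended. $A_k^*$ is the best rank-$k$ approximation of $A$ (truncated SVD). $\|\cdot\|_2$, $\|\cdot\|_F$ are the spectral and Frobenius norms; $\mathsf{nnz}(A)$ is the number of nonzero entries of $A$. $\widetilde O$ hides logarithmic factors in $1/\varepsilon,1/p,n,d,k,1/\sigma_1,\sigma_1/\sigma_k,\sigma_1/\sigma_{k+1}$. Stochastic setting: $A$ is given in the form $AA^\top=\frac1n\sum_{i=1}^na_ia_i^\top$ with each $a_i\in\mathbb{R}^d$ of Euclidean norm at most $1$. $\mathcal A$ is an approximate matrix inversion method: given $\lambda I-M\succ0$, a vector $b$ and an accuracy $\eta>0$, it returns $x$ with $\|x-(\lambda I-M)^{-1}b\|\le\eta$. Its cost, when $M\succeq0$ and $\lambda I-M\succeq\delta I$ with $\lambda,\delta>0$: accelerated gradient descent (AGD) uses $O\big(\frac{\lambda^{1/2}}{\delta^{1/2}}\log\frac{\lambda}{\eta\delta}\big)$ iterations, each costing $O(d)$ plus the time to multiply $M$ with a vector; accelerated SVRG (for $M=\frac1n\sum_i a_ia_i^\top$, $\|a_i\|_2\le1$) takes time $O\big(\max\{nd,\frac{n^{3/4}d\lambda^{1/4}}{\delta^{1/2}}\}\log\frac{\lambda}{\eta\delta}\big)$. Algorithm $\mathrm{AppxPCA}(\mathcal A,M,\delta_\times,\varepsilon,p)$, for symmetric $M\in\mathbb{R}^{d\times d}$ with $0\preceq M\preceq I$, $\delta_\times\in(0,0.5]$,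 $\varepsilon,p\in(0,1)$: 1. $m_1\leftarrow\lceil4\log(288d/p^2)\rceil$, $m_2\leftarrow\lceil\log(36d/(p^2\varepsilon))\rceil$; $\widetilde\varepsilon_1\leftarrow\frac{1}{64m_1}(\delta_\times/6)^{m_1}$, $\widetilde\varepsilon_2\leftarrow\frac{\varepsilon}{8m_2}(\delta_\times/6)^{m_2}$. 2. $\widehat w_0\leftarrow$ a uniformly random unit vector; $s\leftarrow0$; $\lambda^{(0)}\leftarrow1+\delta_\times$. 3. Repeat: $s\leftarrow s+1$; for $t=1,\dots,m_1$ apply $\mathcal A$ to find $\widehat w_t$ with $\|\widehat w_t-(\lambda^{(s-1)}I-M)^{-1}\widehat w_{t-1}\|\le\widetilde\varepsilon_1$; set $w\leftarrow\widehat w_{m_1}/\|\widehat w_{m_1}\|$; apply $\mathcal A$ to find $v$ with $\|v-(\lambda^{(s-1)}I-M)^{-1}w\|\le\widetilde\varepsilon_1$; set $\Delta^{(s)}\leftarrow\frac12\cdot\frac{1}{w^\top v-\widetilde\varepsilon_1}$ and $\lambda^{(s)}\leftarrow\lambda^{(s-1)}-\Delta^{(s)}/2$; until $\Delta^{(s)}\le\delta_\times\lambda^{(s)}/3$. 4. $f\leftarrow s$; for $t=1,\dots,m_2$ apply $\mathcal A$ to find $\widehat w_t$ with $\|\widehat w_t-(\lambda^{(f)}I-M)^{-1}\widehat w_{t-1}\|\le\widetilde\varepsilon_2$ (starting again from $\widehat w_0$). Return $w=\widehat w_{m_2}/\|\widehat w_{m_2}\|$. Algorithm $\mathrm{LazySVD}(\mathcal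 A,M,k,\delta_\times,\varepsilon_{\mathsf{pca}},p)$, for $0\preceq M\preceq I$, $k\in\{1,\dots,d\}$, $\delta_\times,\varepsilon_{\mathsf{pca}},p\in(0,1)$: set $M_0=M$ and $V_0=[\,]$ (empty). For $s=1,\dots,k$: $v_s'\leftarrow\mathrm{AppxPCA}(\mathcal A,M_{s-1},\delta_\times/2,\varepsilon_{\mathsf{pca}},p/k)$; $v_s\leftarrow(I-V_{s-1}V_{s-1}^\top)v_s'/\|(I-V_{s-1}V_{s-1}^\top)v_s'\|$; $V_s\leftarrow[V_{s-1},v_s]$; $M_s\leftarrow(I-v_sv_s^\top)M_{s-1}(I-v_sv_s^\top)$. Return $V_k$. *)

(* Defs.v *)
From HB Require Import structures.
From mathcomp Require Import all_boot all_order all_algebra.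
From mathcomp Require Import all_classical all_reals all_analysis.
Set Implicit Arguments.
Unset Strict Implicit.
Unset Printing Implicit Defensive.
Import Order.TTheory GRing.Theory Num.Theory.
Import numFieldNormedType.Exports.
Local Open Scope classical_set_scope.
Local Open Scope ring_scope.

Section LinearAlgebra.
Variable R : realType.

Definition norm2 d (x : 'cV[R]_d) : R := Num.sqrt (\sum_i x i 0 ^+ 2).

Definition frobenius m n (B : 'M[R]_(m, n)) : R :=
  Num.sqrt (\sum_i \sum_j B i j ^+ 2).

Definition spectral_norm m n (B : 'M[R]_(m, n)) : R :=
  sup [set norm2 (B *m x) | x in [set x : 'cV[R]_n | norm2 x <= 1]].

Definition normalize d (x : 'cV[R]_d) : 'cV[R]_d := (norm2 x)^-1 *: x.

Definition quad d (M : 'M[R]_d) (x : 'cV[R]_d) : R := (x^T *m M *m x) 0 0.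

Definition psd d (M : 'M[R]_d) := M^T = M /\ forall x, 0 <= quad M x.

Definition pd d (M : 'M[R]_d) := M^T = M /\ forall x, x != 0 -> 0 < quad M x.

Definition orthogonal_mx d (Q : 'M[R]_d) := Q *m Q^T = 1%:M.

Definition nnz m n (B : 'M[R]_(m, n)) : nat :=
  #|[set ij : 'I_m * 'I_n | B ij.1 ij.2 != 0]|.

Definition rect_diag m n (s : nat -> R) : 'M[R]_(m, n) :=
  \matrix_(i, j) (if i == j :> nat then s i else 0).

(* Indices start at 0, so sigma i is the (i+1)-st singular value; the
   min(d, n) singular values of A are extended by zeros. *)
Definition is_svd d n (A : 'M[R]_(d, n)) (U : 'M[R]_d) (sigma : nat -> R)
    (W : 'M[R]_n) :=
  [/\ orthogonal_mx U, orthogonal_mx W,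
      forall i j, (i <= j)%N -> 0 <= sigma j <= sigma i,
      forall i, (minn d n <= i)%N -> sigma i = 0 &
      A = U *m rect_diag d n sigma *m W^T].

Definition truncated_svd d n (U : 'M[R]_d) (sigma : nat -> R) (W : 'M[R]_n)
    (k : nat) : 'M[R]_(d, n) :=
  U *m rect_diag d n (fun i => if (i < k)%N then sigma i else 0) *m W^T.

Definition cols_mx d (m : nat) (V : seq 'cV[R]_d) : 'M[R]_(d, m) :=
  \matrix_(i, j) (V`_j i 0).

Definition average_of_rank_one d n (M : 'M[R]_d) :=
  exists a : 'I_n -> 'cV[R]_d,
    (forall i, norm2 (a i) <= 1) /\ M = n%:R^-1 *: \sum_i (a i *m (a i)^T).

End LinearAlgebra.

Section RandomVectors.
Variable R : realType.

Definition borel_mx m n := g_sigma_algebraType (@open 'M[R]_(m, n)).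

(* The uniform distribution on the unit sphere, as the rotation invariant
   probability law on it. *)
Definition uniform_unit_vector (dO : measure_display)
    (Omega : measurableType dO) (P : probability Omega R) d
    (X : Omega -> 'cV[R]_d) :=
  [/\ measurable_fun setT (X : Omega -> borel_mx d 1),
      forall omega, norm2 (X omega) = 1 &
      forall (Q : 'M[R]_d) (B : set (borel_mx d 1)),
        orthogonal_mx Q -> measurable B ->
        P [set omega | B (Q *m X omega)] = P [set omega | B (X omega)]].

(* Mutual independence of Z, X 0, ..., X (k - 1); subfamilies are covered by
   taking some of the sets to be full. *)
Definition mutually_independent (dO : measure_display)
    (Omega : measurableType dO) (P : probability Omega R)
    (dT : measure_display) (T : measurableType dT) (Z : Omega -> T) d
    (k : nat) (X : nat -> Omega -> 'cV[R]_d) :=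
  forall (C : set T) (B : nat -> set (borel_mx d 1)),
    measurable C -> (forall s, (s < k)%N -> measurable (B s)) ->
    fine (P [set omega |
      C (Z omega) /\ forall s, (s < k)%N -> B s (X s omega)]) =
    fine (P [set omega | C (Z omega)]) *
    \prod_(s < k) fine (P [set omega | B s (X s omega)]).

End RandomVectors.

Section Inverter.
Variable R : realType.

(* The method may be randomized: it reads a random tape in T, and receives the
   position (round, stage, step) of the call, so that equal queries issued at
   different moments may be answered differently.  The remaining arguments are
   lambda, M, b and the accuracy eta. *)
Record inverter (d : nat) (T : Type) := Inverter {
  solve : T -> nat -> nat -> nat ->
          R -> 'M[R]_d -> 'cV[R]_d -> R -> 'cV[R]_d;
  work : T -> nat -> nat -> nat ->
         R -> 'M[R]_d -> 'cV[R]_d -> R -> nat }.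

(* Measurability makes the answers random variables, so that each round of
   LazySVD is independent of the start vectors drawn later. *)
Definition approximate_inverter d (dT : measure_display)
    (T : measurableType dT) (Alg : inverter d T) :=
  (forall r i j t,
     forall (lam : R) (M : 'M[R]_d) (b : 'cV[R]_d) (eta : R),
       pd (lam%:M - M) -> 0 < eta ->
       norm2 (solve Alg r i j t lam M b eta - invmx (lam%:M - M) *m b) <= eta)
  /\
  (forall i j t, measurable_fun setT
     (fun x : (T * (R * borel_mx R d d * borel_mx R d 1 * R))%type =>
        solve Alg x.1 i j t x.2.1.1.1 x.2.1.1.2 x.2.1.2 x.2.2
        : borel_mx R d 1)).

(* work counts iterations. The maximum with 1 is the usual reading of a
   logarithm inside O(.) when its argument is close to or below 1. *)
Definition agd_work (C : R) d T (Alg : inverter d T) :=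
  forall r i j t (lam : R) (M : 'M[R]_d) (b : 'cV[R]_d) (eta delta : R),
    psd M -> 0 < lam -> 0 < delta -> 0 < eta ->
    psd (lam%:M - M - delta%:M) ->
    (work Alg r i j t lam M b eta)%:R <=
      C * (Num.sqrt lam / Num.sqrt delta
           * Num.max 1 (ln (lam / (eta * delta)))).

(* work is the running time. *)
Definition svrg_work (C : R) (n : nat) d T (Alg : inverter d T) :=
  forall r i j t (lam : R) (M : 'M[R]_d) (b : 'cV[R]_d) (eta delta : R),
    average_of_rank_one n M -> 0 < lam -> 0 < delta -> 0 < eta ->
    psd (lam%:M - M - delta%:M) ->
    (work Alg r i j t lam M b eta)%:R <=
      C * (Num.max (n%:R * d%:R)
             (n%:R `^ (3 / 4) * d%:R * lam `^ (1 / 4) / Num.sqrt delta)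
           * Num.max 1 (ln (lam / (eta * delta)))).

End Inverter.

Section AppxPCA.
Variables (R : realType) (d : nat).
Variable inv : nat -> nat -> R -> 'M[R]_d -> 'cV[R]_d -> R -> 'cV[R]_d.
Variables (M : 'M[R]_d) (delta eps p : R) (w0 : 'cV[R]_d).

Definition pca_m1 : nat :=
  `|Num.ceil (4 * ln (288 * d%:R / p ^+ 2))|%N.
Definition pca_m2 : nat :=
  `|Num.ceil (ln (36 * d%:R / (p ^+ 2 * eps)))|%N.
Definition pca_eps1 : R := (64 * pca_m1%:R)^-1 * (delta / 6) ^+ pca_m1.
Definition pca_eps2 : R := eps / (8 * pca_m2%:R) * (delta / 6) ^+ pca_m2.

Fixpoint pca_power (s : nat) (lam eta : R) (t : nat) : 'cV[R]_d :=
  if t is t'.+1 then inv s t'.+1 lam M (pca_power s lam eta t') eta else w0.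

Definition pca_w (s : nat) (lam : R) : 'cV[R]_d :=
  normalize (pca_power s lam pca_eps1 pca_m1).
Definition pca_v (s : nat) (lam : R) : 'cV[R]_d :=
  inv s pca_m1.+1 lam M (pca_w s lam) pca_eps1.
Definition pca_Delta_at (s : nat) (lam : R) : R :=
  2^-1 * (((pca_w s lam)^T *m pca_v s lam) 0 0 - pca_eps1)^-1.

Fixpoint pca_lambda (s : nat) : R :=
  if s is s'.+1 then pca_lambda s' - pca_Delta_at s'.+1 (pca_lambda s') / 2
  else 1 + delta.

Definition pca_Delta (s : nat) : R := pca_Delta_at s (pca_lambda s.-1).

Definition pca_stop (s : nat) : bool :=
  pca_Delta s <= delta * pca_lambda s / 3.

Definition pca_final (f : nat) :=
  [/\ (0 < f)%N, pca_stop f & forall s, (0 < s < f)%N -> ~~ pca_stop s].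

Definition pca_halts := exists f, pca_final f.

(* Meaningful only when pca_halts holds. *)
Definition pca_f : nat := xget 0%N [set f | pca_final f].

Definition appx_pca : 'cV[R]_d :=
  normalize (pca_power pca_f.+1 (pca_lambda pca_f) pca_eps2 pca_m2).

(* All calls issued to inv, as (stage, step, lambda, right-hand side,
   accuracy). *)
Definition pca_calls : seq (nat * nat * R * 'cV[R]_d * R) :=
  flatten [seq
    rcons [seq (s, t.+1, pca_lambda s.-1,
                pca_power s (pca_lambda s.-1) pca_eps1 t, pca_eps1)
          | t <- iota 0 pca_m1]
      (s, pca_m1.+1, pca_lambda s.-1, pca_w s (pca_lambda s.-1), pca_eps1)
  | s <- iota 1 pca_f] ++
  [seq (pca_f.+1, t.+1, pca_lambda pca_f,
        pca_power pca_f.+1 (pca_lambda pca_f) pca_eps2 t, pca_eps2)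
  | t <- iota 0 pca_m2].

End AppxPCA.

Section LazySVD.
Variables (R : realType) (d : nat).
Variable inv : nat -> nat -> nat -> R -> 'M[R]_d -> 'cV[R]_d -> R -> 'cV[R]_d.
Variable cost : nat -> nat -> nat -> R -> 'M[R]_d -> 'cV[R]_d -> R -> nat.
Variables (M : 'M[R]_d) (k : nat) (delta eps p : R).
(* w0 s is the random start vector drawn by the call to AppxPCA in round s;
   rounds are numbered from 0. *)
Variable w0 : nat -> 'cV[R]_d.

(* The list [:: v_1; ...; v_s] and the matrix M_s. *)
Fixpoint lazy_state (s : nat) : seq 'cV[R]_d * 'M[R]_d :=
  if s is s'.+1 then
    let: (V, M') := lazy_state s' in
    let v' := appx_pca (inv s') M' (delta / 2) eps (p / k%:R) (w0 s') in
    let Vmx := cols_mx s' V in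
    let v := normalize ((1%:M - Vmx *m Vmx^T) *m v') in
    (rcons V v, (1%:M - v *m v^T) *m M' *m (1%:M - v *m v^T))
  else ([::], M).

Definition lazy_svd : 'M[R]_(d, k) := cols_mx k (lazy_state k).1.

Definition lazy_halts :=
  forall s, (s < k)%N ->
    pca_halts (inv s) (lazy_state s).2 (delta / 2) (p / k%:R) (w0 s).

(* Number of elementary operations, up to constant factors.  A call to the
   inversion method in round s costs cost(...) units at price s operations
   each, plus d operations for the surrounding vector arithmetic
   (normalizations, inner products); orthogonalizing against V_s costs
   d * s.+1, and update s is spent on passing from M_s to M_(s+1). *)
Definition lazy_time (price update : nat -> nat) : nat :=
  (\sum_(s < k)
     (\sum_(q <- pca_calls (inv s) (lazy_state s).2 (delta / 2) eps
                   (p / k%:R) (w0 s))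
        (price s * cost s q.1.1.1.1 q.1.1.1.2 q.1.1.2 (lazy_state s).2
                        q.1.2 q.2 + d)
      + d * s.+1 + update s))%N.

End LazySVD.

(* In round s, M_s = (I - V_s V_s^T) A A^T (I - V_s V_s^T) is kept implicit and
   applied to a vector in time nnz(A) + s d + d; each AGD iteration adds d. *)
Definition agd_price (R : realType) d n (A : 'M[R]_(d, n)) (s : nat) : nat :=
  (d + (nnz A + s * d + d))%N.
Definition agd_update (s : nat) : nat := 0%N.

(* SVRG works on explicit vectors a_i, which are projected after each round. *)
Definition svrg_price (s : nat) : nat := 1%N.
Definition svrg_update (n d : nat) (s : nat) : nat := (n * d)%N.

(* The logarithmic quantity whose powers are hidden by the soft-O. *)
Definition log_factor (R : realType) (d n k : nat) (sigma : nat -> R)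
    (eps p : R) : R :=
  1 + \sum_(x <- [:: eps^-1; p^-1; n%:R; d%:R; k%:R; (sigma 0%N)^-1;
                     sigma 0%N / sigma k.-1; sigma 0%N / sigma k]) ln (1 + x).

(* Main.v *)
Require Import Defs.
From mathcomp Require Import all_boot all_order all_algebra.
From mathcomp Require Import all_classical all_reals all_analysis.
From mathcomp Require Import measurable_realfun.
From mathcomp Require Import ring lra zify.
Set Implicit Arguments.
Unset Strict Implicit.
Unset Printing Implicit Defensive.
Import Order.TTheory GRing.Theory Num.Theory.
Import numFieldNormedType.Exports.
Local Open Scope classical_set_scope.
Local Open Scope ring_scope.

(* Suppose first that in every round the start vector has squared overlap at
   least tau = (p / (3 k sqrt d))^2 with the top eigenspace of M_s.  Then the
   shift-and-invert power method stays close to its exact counterpart, every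
   Delta^(s) lies between half the gap lambda - lambda_max and the gap, so that
   the gap shrinks geometrically until AppxPCA stops, and the returned vector has
   weight at most epca on the eigenvectors whose eigenvalue is below
   (1 - eps / 6) lambda_max.  Deflating by such a vector moves the spectrum by
   one position, up to the factor 1 - eps / 6 and the additive error
   2 epca sigma_1^2; the latter is negligible against sigma_(k+1)^2 even after k
   rounds.  This gives the norm bounds and the Rayleigh quotients, and the
   logarithms of all parameters passed to the inverter are O(L^2).

   The overlap fails with probability at most p / k in each round: M_s is
   measurable with respect to the tape and the earlier start vectors, which are
   independent of the new one, so by Fubini M_s may be frozen; and for a
   uniform unit vector X and a unit vector q the strip |q . X| <= t has measure
   O(t sqrt d), because the test functions x_j clamp(x_1) have the same mean
   before and after a small rotation in the (x_1, x_j)-plane. *)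

(** The factor 1 - eps / 6 is lost once, not once per round. The claim about a single deflation
    concerns a level x below both an eigenvalue of the new matrix and (1 - eps / 6) times the top
    eigenvalue of the old one; the second condition persists when going back to earlier rounds,
    whose top eigenvalues are larger. Only the additive error accumulates. No gap between singular
    values is available, so the deflation argument does not follow single eigenvectors: it works
    with spectral weights above and below a threshold and with dimension counts.

    Rank exactly k needs an argument of its own: orthonormality of V_k does not prevent A A^T from
    killing a vector of its span. The spectral shift, applied repeatedly, excludes this.

    A measurable choice of eigenvectors of the random M_s is avoided by expressing the overlap
    through all powers of M_s. The uniform law is given by its invariance alone, so there is no
    density to integrate over a strip: exchanging coordinates yields the second moment 1 / d, and a
    small rotation does the rest. *)

Section Euclidean.
Variable R : realType.
Implicit Types (d : nat) (c : R).

Definition dotv d (x y : 'cV[R]_d) : R := (x^T *m y) 0 0.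

Lemma dotvE d (x y : 'cV[R]_d) : dotv x y = \sum_i x i 0 * y i 0.
Proof. by rewrite /dotv mxE; apply: eq_bigr => i _; rewrite mxE. Qed.

Lemma dotvC d (x y : 'cV[R]_d) : dotv x y = dotv y x.
Proof. by rewrite !dotvE; apply: eq_bigr => i _; rewrite mulrC. Qed.

Lemma dotvDl d (x y z : 'cV[R]_d) : dotv (x + y) z = dotv x z + dotv y z.
Proof. by rewrite /dotv linearD/= mulmxDl mxE. Qed.

Lemma dotvDr d (x y z : 'cV[R]_d) : dotv z (x + y) = dotv z x + dotv z y.
Proof. by rewrite /dotv mulmxDr mxE. Qed.

Lemma dotvZl d c (x y : 'cV[R]_d) : dotv (c *: x) y = c * dotv x y.
Proof. by rewrite /dotv linearZ/= -scalemxAl mxE. Qed.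

Lemma dotvZr d c (x y : 'cV[R]_d) : dotv x (c *: y) = c * dotv x y.
Proof. by rewrite dotvC dotvZl dotvC. Qed.

Lemma dotvNl d (x y : 'cV[R]_d) : dotv (- x) y = - dotv x y.
Proof. by rewrite -scaleN1r dotvZl mulN1r. Qed.

Lemma dotvNr d (x y : 'cV[R]_d) : dotv x (- y) = - dotv x y.
Proof. by rewrite dotvC dotvNl dotvC. Qed.

Lemma dotvBl d (x y z : 'cV[R]_d) : dotv (x - y) z = dotv x z - dotv y z.
Proof. by rewrite dotvDl dotvNl. Qed.

Lemma dotvBr d (x y z : 'cV[R]_d) : dotv z (x - y) = dotv z x - dotv z y.
Proof. by rewrite dotvDr dotvNr. Qed.

Lemma dotv0l d (x : 'cV[R]_d) : dotv 0 x = 0.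
Proof. by rewrite /dotv trmx0 mul0mx mxE. Qed.

Lemma dotv0r d (x : 'cV[R]_d) : dotv x 0 = 0.
Proof. by rewrite dotvC dotv0l. Qed.

Lemma dotvMl d e (B : 'M[R]_(d, e)) x y : dotv (B *m x) y = dotv x (B^T *m y).
Proof. by rewrite /dotv trmx_mul mulmxA. Qed.

Lemma dotvMr d e (B : 'M[R]_(e, d)) x y : dotv x (B *m y) = dotv (B^T *m x) y.
Proof. by rewrite dotvC dotvMl dotvC. Qed.

Lemma dotvvE d (x : 'cV[R]_d) : dotv x x = \sum_i x i 0 ^+ 2.
Proof. by rewrite dotvE. Qed.

Lemma dotvv_ge0 d (x : 'cV[R]_d) : 0 <= dotv x x.
Proof. by rewrite dotvvE sumr_ge0// => i _; rewrite sqr_ge0. Qed.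

Lemma dotvv_eq0 d (x : 'cV[R]_d) : (dotv x x == 0) = (x == 0).
Proof.
apply/idP/eqP => [|->]; last by rewrite dotv0l.
rewrite dotvvE psumr_eq0 => [/allP h|i _]; last by rewrite sqr_ge0.
apply/matrixP => i j; rewrite ord1 mxE; apply/eqP.
by have := h i (mem_index_enum i); rewrite sqrf_eq0.
Qed.

Lemma dotvv_gt0 d (x : 'cV[R]_d) : (0 < dotv x x) = (x != 0).
Proof. by rewrite lt_neqAle dotvv_ge0 andbT eq_sym dotvv_eq0. Qed.

Lemma norm2E d (x : 'cV[R]_d) : norm2 x = Num.sqrt (dotv x x).
Proof. by rewrite dotvvE. Qed.

Lemma norm2_ge0 d (x : 'cV[R]_d) : 0 <= norm2 x.
Proof. exact: sqrtr_ge0. Qed.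

Lemma sqr_norm2 d (x : 'cV[R]_d) : norm2 x ^+ 2 = dotv x x.
Proof. by rewrite norm2E sqr_sqrtr// dotvv_ge0. Qed.

Lemma norm2_eq0 d (x : 'cV[R]_d) : (norm2 x == 0) = (x == 0).
Proof. by rewrite -(sqrf_eq0 (norm2 x)) sqr_norm2 dotvv_eq0. Qed.

Lemma norm2_gt0 d (x : 'cV[R]_d) : (0 < norm2 x) = (x != 0).
Proof. by rewrite lt_neqAle norm2_ge0 andbT eq_sym norm2_eq0. Qed.

Lemma norm2Z d c (x : 'cV[R]_d) : norm2 (c *: x) = `|c| * norm2 x.
Proof.
by rewrite !norm2E dotvZl dotvZr mulrA -expr2 sqrtrM ?sqr_ge0// sqrtr_sqr.
Qed.

Lemma norm2N d (x : 'cV[R]_d) : norm2 (- x) = norm2 x.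
Proof. by rewrite -scaleN1r norm2Z normrN1 mul1r. Qed.

Lemma norm2_eq1 d (x : 'cV[R]_d) : dotv x x = 1 -> norm2 x = 1.
Proof. by rewrite norm2E => ->; rewrite sqrtr1. Qed.

Lemma dotv_eq1 d (x : 'cV[R]_d) : norm2 x = 1 -> dotv x x = 1.
Proof. by rewrite -sqr_norm2 => ->; rewrite expr1n. Qed.

Lemma norm2_le d e (x : 'cV[R]_d) (y : 'cV[R]_e) :
  (norm2 x <= norm2 y) = (dotv x x <= dotv y y).
Proof. by rewrite !norm2E ler_sqrt// dotvv_ge0. Qed.

Lemma Cauchy_Schwarz d (x y : 'cV[R]_d) :
  dotv x y ^+ 2 <= dotv x x * dotv y y.
Proof.
have [->|y0] := eqVneq y 0; first by rewrite !dotv0r expr0n mulr0.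
have yy : 0 < dotv y y by rewrite dotvv_gt0.
have := dotvv_ge0 (dotv y y *: x - dotv x y *: y).
rewrite !(dotvBl, dotvBr, dotvZl, dotvZr) (dotvC y x).
rewrite (_ : _ - _ = dotv y y * (dotv x x * dotv y y - dotv x y ^+ 2)); last by ring.
by rewrite pmulr_rge0// subr_ge0.
Qed.

Lemma dotv_le d (x y : 'cV[R]_d) : `|dotv x y| <= norm2 x * norm2 y.
Proof.
rewrite -(ler_pXn2r (n := 2))//= ?nnegrE ?mulr_ge0 ?norm2_ge0//.
by rewrite real_normK ?num_real// exprMn !sqr_norm2 Cauchy_Schwarz.
Qed.

Lemma norm2D d (x y : 'cV[R]_d) : norm2 (x + y) <= norm2 x + norm2 y.
Proof.
rewrite -(ler_pXn2r (n := 2))//= ?nnegrE ?addr_ge0 ?norm2_ge0//.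
rewrite sqr_norm2 dotvDl !dotvDr (dotvC y x) sqrrD !sqr_norm2.
have := le_trans (ler_norm _) (dotv_le x y); lra.
Qed.

Lemma norm2B d (x y : 'cV[R]_d) : norm2 x - norm2 y <= norm2 (x - y).
Proof. by rewrite lerBlDr; apply: le_trans (norm2D _ _); rewrite subrK. Qed.

Lemma normalize_norm2 d (x : 'cV[R]_d) : x != 0 -> norm2 (normalize x) = 1.
Proof.
rewrite -norm2_gt0 => x0; rewrite norm2Z ger0_norm ?invr_ge0 ?ltW//.
by rewrite mulVf// gt_eqF.
Qed.

Lemma orthogonal_mxC d (Q : 'M[R]_d) : orthogonal_mx Q -> Q^T *m Q = 1%:M.
Proof. exact: mulmx1C. Qed.

Lemma quadE d (M : 'M[R]_d) x : quad M x = dotv x (M *m x).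
Proof. by rewrite /quad /dotv mulmxA. Qed.

Lemma quad_gram m n (B : 'M[R]_(m, n)) x :
  quad (B *m B^T) x = dotv (B^T *m x) (B^T *m x).
Proof. by rewrite quadE -mulmxA dotvMr. Qed.

Lemma psd_gram m n (B : 'M[R]_(m, n)) : psd (B *m B^T).
Proof.
split=> [|x]; first by rewrite trmx_mul trmxK.
by rewrite quad_gram dotvv_ge0.
Qed.

(** The dimension count behind orthogonal complements and min-max arguments: rows are unknowns,
    columns are linear conditions. *)
Lemma wide_kernel m n (B : 'M[R]_(m, n)) : (n < m)%N ->
  exists2 y : 'rV[R]_m, y != 0 & y *m B = 0.
Proof.
move=> nm; have : kermx B != 0.
  rewrite -mxrank_eq0 mxrank_ker -lt0n subn_gt0.
  exact: leq_ltn_trans (rank_leq_col _) nm.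
case/rowV0Pn => y /sub_kermxP yB y0; by exists y.
Qed.

Lemma orthogonal_unit_vector d m (q : nat -> 'cV[R]_d) : (m < d)%N ->
  exists x : 'cV[R]_d, dotv x x = 1 /\ forall i, (i < m)%N -> dotv (q i) x = 0.
Proof.
move=> md; have [y y0 yq] := wide_kernel (\matrix_(i < d, j < m) q j i 0) md.
have yT : y^T != 0 by rewrite -(inj_eq trmx_inj) trmxK trmx0.
exists (normalize y^T); split=> [|i im].
  by rewrite dotv_eq1// normalize_norm2.
rewrite dotvZr dotvC /dotv trmxK.
move/matrixP/(_ 0 (Ordinal im)): yq; rewrite !mxE => /= yq.
rewrite (_ : \sum_j _ = 0) ?mulr0// -[RHS]yq.
by apply: eq_bigr => j _; rewrite !mxE.
Qed.

End Euclidean.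

(** * Spectral decomposition *)

Section SpectralTheorem.
Variable R : realType.
Implicit Types d : nat.

Lemma continuous_sumr (T : topologicalType) (I : finType) (f : I -> T -> R) :
  (forall i, continuous (f i)) -> continuous (fun x => \sum_i f i x).
Proof. by move=> fc; apply: continuous_big => [|i _]; [exact: add_continuous|]. Qed.

Lemma continuous_mulr (T : topologicalType) (f g : T -> R) :
  continuous f -> continuous g -> continuous (fun x => f x * g x).
Proof. by move=> fc gc x; apply: cvgM; [exact: fc|exact: gc]. Qed.

Lemma continuous_quad d (M : 'M[R]_d) :
  continuous (fun x : 'rV[R]_d => quad M x^T).
Proof.
have -> : (fun x : 'rV[R]_d => quad M x^T) =
    (fun x => \sum_i \sum_j x 0 i * M i j * x 0 j).
  apply/funext => x; rewrite quadE dotvE; apply: eq_bigr => i _.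
  rewrite !mxE big_distrr; apply: eq_bigr => j _ /=.
  by rewrite !mxE mulrA.
apply: continuous_sumr => i; apply: continuous_sumr => j.
apply: continuous_mulr; last exact: coord_continuous.
by apply: continuous_mulr; [exact: coord_continuous|exact: cst_continuous].
Qed.

Lemma quad1 d (x : 'cV[R]_d) : quad 1%:M x = dotv x x.
Proof. by rewrite quadE mul1mx. Qed.

Lemma quadD d (M N : 'M[R]_d) x : quad (M + N) x = quad M x + quad N x.
Proof. by rewrite !quadE mulmxDl dotvDr. Qed.

Lemma quadZm d (M : 'M[R]_d) c x : quad (c *: M) x = c * quad M x.
Proof. by rewrite !quadE -scalemxAl dotvZr. Qed.

Lemma quadN d (M : 'M[R]_d) x : quad (- M) x = - quad M x.
Proof. by rewrite !quadE mulNmx dotvNr. Qed.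

Lemma quad_scalar d c (x : 'cV[R]_d) : quad c%:M x = c * dotv x x.
Proof. by rewrite quadE mul_scalar_mx dotvZr. Qed.

Lemma quadZ d (M : 'M[R]_d) c x : quad M (c *: x) = c ^+ 2 * quad M x.
Proof. by rewrite !quadE -scalemxAr dotvZl dotvZr mulrA. Qed.

Lemma quadDv d (M : 'M[R]_d) x y : M^T = M ->
  quad M (x + y) = quad M x + 2 * dotv y (M *m x) + quad M y.
Proof.
move=> MT; rewrite !quadE mulmxDr !dotvDl !dotvDr.
by rewrite (dotvMr M x y) MT (dotvC (M *m x)); ring.
Qed.

Lemma sphere_compact d m (q : nat -> 'cV[R]_d) :
  compact [set x : 'rV[R]_d | dotv x^T x^T = 1 /\
             forall i, (i < m)%N -> dotv (q i) x^T = 0].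
Proof.
apply: bounded_closed_compact.
  exists 1; split=> // M M1 x [x1 _].
  apply: le_trans (ltW M1); rewrite [leLHS]/Num.norm/= mx_normrE.
  apply/bigmax_leP; split=> // -[i j] _ /=; rewrite ord1 => {i}.
  rewrite -(ler_pXn2r (n := 2))//= ?nnegrE// real_normK ?num_real// expr1n.
  rewrite -x1 dotvvE (bigD1 j)//= mxE lerDl.
  by rewrite sumr_ge0// => k _; rewrite sqr_ge0.
rewrite (_ : mkset _ = (fun x : 'rV[R]_d => quad 1%:M x^T) @^-1` [set 1] `&`
  \bigcap_(i in [set i | (i < m)%N])
     (fun x : 'rV[R]_d => dotv (q i) x^T) @^-1` [set 0]); last first.
  by apply/seteqP; split=> x /=; rewrite quad1.
apply: closedI.
  by apply: preimage_closed => [x _|]; [exact: continuous_quad|exact: closed_eq].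
apply: closed_bigI => i _; apply: preimage_closed; last exact: closed_eq.
move=> x0 _; move: x0; rewrite (_ : (fun x => _) = fun x : 'rV[R]_d => \sum_j q i j 0 * x 0 j).
  apply: continuous_sumr => j.
  by apply: continuous_mulr; [exact: cst_continuous|exact: coord_continuous].
by apply/funext => x; rewrite dotvE; apply: eq_bigr => j _; rewrite mxE.
Qed.

(** Along the line the form is a quadratic in [t] without constant term, which stays nonnegative
    only if its linear coefficient vanishes. Nonnegativity is asked on this line alone, because in
    the application it is known only on a subspace. *)
Lemma psd_radical d (N : 'M[R]_d) (x g : 'cV[R]_d) : N^T = N ->
  quad N x = 0 -> (forall t, 0 <= quad N (x + t *: g)) -> dotv g (N *m x) = 0.
Proof.
move=> NT Nx h; set b := dotv g (N *m x); set a := quad N g.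
have {}h t : 0 <= 2 * t * b + t ^+ 2 * a.
  by have := h t; rewrite quadDv// Nx add0r dotvZl quadZ mulrA.
apply/eqP; rewrite -sqrf_eq0 eq_le sqr_ge0 andbT.
clear NT Nx.
(* With A = |a| + 1 >= a the value at this point is b^2 (a - 2 A) / A^2, negative unless b = 0. *)
have := h (- b / (`|a| + 1)).
have a1 : 0 < `|a| + 1 by rewrite ltr_pwDr.
have : a <= `|a| + 1 by have := ler_norm a; lra.
set A := `|a| + 1 in a1 *; move=> aA.
rewrite (_ : _ + _ = b ^+ 2 * ((a - 2 * A) / A ^+ 2)); last by field; lra.
rewrite nmulr_lge0// pmulr_llt0 ?invr_gt0 ?exprn_gt0//; lra.
Qed.

(** The vector maximizes the Rayleigh quotient on the unit sphere of the complement of the [q i]. By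
    symmetry of [M] the defect mu x - M x lies in that complement again, so it can serve as
    direction in [psd_radical], which makes it orthogonal to itself. *)
Lemma next_eigenvector d (M : 'M[R]_d) m (q : nat -> 'cV[R]_d)
    (nu : nat -> R) : M^T = M -> (m < d)%N ->
  (forall i, (i < m)%N -> M *m q i = nu i *: q i) ->
  exists (x : 'cV[R]_d) (mu : R),
    [/\ dotv x x = 1, forall i, (i < m)%N -> dotv (q i) x = 0,
        M *m x = mu *: x &
        forall y, (forall i, (i < m)%N -> dotv (q i) y = 0) ->
          quad M y <= mu * dotv y y].
Proof.
move=> MT md Mq.
have [x0 [x01 x0q]] := orthogonal_unit_vector q md.
have [|x] := EVT_max_rV _ (@sphere_compact _ m q)
  (continuous_subspaceT (continuous_quad (M := M))).
  by exists x0^T; rewrite /= trmxK.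
rewrite inE => -[x1 xq] xmax.
have {}xmax y : (forall i, (i < m)%N -> dotv (q i) y = 0) ->
    quad M y <= quad M x^T * dotv y y.
  move=> yq; have [->|y0] := eqVneq y 0.
    by rewrite quadE !dotv0l mulr0.
  have := xmax (normalize y)^T; rewrite inE/= trmxK => /(_ _)/wrap[].
    split; first by rewrite dotv_eq1// normalize_norm2.
    by move=> i im; rewrite dotvZr yq// mulr0.
  by rewrite quadZ exprVn sqr_norm2 mulrC ler_pdivrMr// dotvv_gt0.
exists x^T, (quad M x^T); split=> //.
set mu := quad M x^T in xmax *; pose N := mu%:M - M.
have NT : N^T = N by rewrite /N linearB/= tr_scalar_mx MT.
have Nx : N *m x^T = mu *: x^T - M *m x^T by rewrite mulmxBl mul_scalar_mx.
set g := N *m x^T in Nx.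
have gq i : (i < m)%N -> dotv (q i) g = 0.
  move=> im; rewrite Nx dotvBr dotvZr xq// mulr0 dotvMr MT Mq// dotvZl xq//.
  by rewrite mulr0 subrr.
have : dotv g g = 0.
  apply: psd_radical => // [|t].
    by rewrite quadD quadN quad_scalar x1 mulr1 subrr.
  rewrite quadD quadN quad_scalar subr_ge0 xmax// => i im.
  by rewrite dotvDr dotvZr xq// gq// mulr0 addr0.
move/eqP; rewrite dotvv_eq0 Nx => /eqP/(congr1 (fun z => M *m x^T + z)).
by rewrite addr0 addrC subrK => ->.
Qed.

(** Eigenvalues are indexed by all naturals and vanish from [d] on: index shifts between rounds then
    need no bound, and sortedness already contains nonnegativity. *)
Definition eigenbasis d (M Q : 'M[R]_d) (nu : nat -> R) :=
  [/\ Q^T *m Q = 1%:M, M *m Q = Q *m diag_mx (\row_i nu i),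
      forall i j, (i <= j)%N -> nu j <= nu i & forall i, (d <= i)%N -> nu i = 0].

(** The last clause is the invariant that keeps the eigenvalues sorted: the next eigenvector is
    orthogonal to all earlier ones, so the clause bounds its eigenvalue by theirs. *)
Lemma partial_eigenbasis d (M : 'M[R]_d) m : M^T = M -> (m <= d)%N ->
  exists (q : nat -> 'cV[R]_d) (nu : nat -> R),
  [/\ forall i j, (i < m)%N -> (j < m)%N -> dotv (q i) (q j) = (i == j)%:R,
      forall i, (i < m)%N -> M *m q i = nu i *: q i,
      forall i j, (i <= j < m)%N -> nu j <= nu i &
      forall j y, (j < m)%N -> (forall i, (i < m)%N -> dotv (q i) y = 0) ->
          quad M y <= nu j * dotv y y].
Proof.
move=> MT; elim: m => [_|m IH md]; first by exists (fun=> 0), (fun=> 0).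
have [q [nu [qq Mq nus qmax]]] := IH (ltnW md).
have [x [mu [x1 xq Mx xmax]]] := next_eigenvector MT md Mq.
exists (fun i => if (i < m)%N then q i else x).
exists (fun i => if (i < m)%N then nu i else mu); split.
- move=> i j; rewrite !ltnS (leq_eqVlt i) (leq_eqVlt j).
  move=> /predU1P[->|im] /predU1P[->|jm].
  + by rewrite ltnn eqxx.
  + by rewrite ltnn jm dotvC xq// gtn_eqF.
  + by rewrite ltnn im xq// ltn_eqF.
  + by rewrite im jm qq.
- by move=> i _; case: ifPn => // im; exact: Mq.
- move=> i j /andP[ij _]; case: ifPn => jm.
    by rewrite (leq_ltn_trans ij jm) nus ?ij.
  case: ifPn => // im.
  have := qmax i x im xq; rewrite quadE Mx dotvZr x1 !mulr1.
  exact.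
- move=> j y _ h.
  have yq i : (i < m)%N -> dotv (q i) y = 0.
    by move=> im; have := h i (ltnW im); rewrite im.
  case: ifPn => jm; first exact: qmax.
  exact: xmax.
Qed.

Theorem spectral_theorem d (M : 'M[R]_d) : psd M ->
  exists (Q : 'M[R]_d) (nu : nat -> R), eigenbasis M Q nu.
Proof.
move=> [MT M0]; have [q [nu [qq Mq nus _]]] := partial_eigenbasis MT (leqnn d).
have nu0 i : (i < d)%N -> 0 <= nu i.
  move=> id; have := M0 (q i); rewrite quadE Mq// dotvZr qq// eqxx mulr1.
  exact.
exists (\matrix_(i, j) q j i 0), (fun i => if (i < d)%N then nu i else 0).
split.
- apply/matrixP => i j; rewrite !mxE.
  transitivity (dotv (q i) (q j)); last by rewrite qq.
  by rewrite dotvE; apply: eq_bigr => l _; rewrite !mxE.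
- apply/matrixP => i j; rewrite mul_mx_diag !mxE.
  have /matrixP/(_ i 0) := Mq j (ltn_ord j); rewrite !mxE ltn_ord mulrC => <-.
  by apply: eq_bigr => l _; rewrite !mxE.
- move=> i j ij; case: ifPn => jd; last by case: ifPn => // id; exact: nu0.
  by rewrite (leq_ltn_trans ij jd) nus// ij.
- by move=> i; rewrite leqNgt => /negbTE ->.
Qed.

End SpectralTheorem.

(** * Coordinates in an eigenbasis, resolvents and the inexact power method *)

Section Eigenbasis.
Variables (R : realType) (d : nat).
Implicit Types (M Q : 'M[R]_d) (x y : 'cV[R]_d) (P : pred 'I_d).

Definition crd Q x (i : 'I_d) : R := (Q^T *m x) i 0.

(* A vector of coordinates in the basis Q, not Q times it. *)
Definition cut Q P x : 'cV[R]_d := \col_i (if P i then crd Q x i else 0).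

Lemma crdD Q x y i : crd Q (x + y) i = crd Q x i + crd Q y i.
Proof. by rewrite /crd mulmxDr mxE. Qed.

Lemma crdZ Q c x i : crd Q (c *: x) i = c * crd Q x i.
Proof. by rewrite /crd -scalemxAr mxE. Qed.

Lemma crdB Q x y i : crd Q (x - y) i = crd Q x i - crd Q y i.
Proof. by rewrite crdD -scaleN1r crdZ mulN1r. Qed.

Lemma cutD Q P x y : cut Q P (x + y) = cut Q P x + cut Q P y.
Proof.
by apply/matrixP => i j; rewrite !mxE; case: ifP; rewrite ?addr0// crdD.
Qed.

Lemma cutZ Q P c x : cut Q P (c *: x) = c *: cut Q P x.
Proof.
by apply/matrixP => i j; rewrite !mxE; case: ifP; rewrite ?mulr0// crdZ.
Qed.

Lemma sqr_norm2_cut Q P x :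
  norm2 (cut Q P x) ^+ 2 = \sum_(i | P i) crd Q x i ^+ 2.
Proof.
rewrite sqr_norm2 dotvvE [RHS]big_mkcond; apply: eq_bigr => i _.
by rewrite mxE; case: ifP; rewrite ?expr0n.
Qed.

Variables (M Q : 'M[R]_d) (nu : nat -> R).
Hypothesis MQ : eigenbasis M Q nu.

Let QTQ : Q^T *m Q = 1%:M. Proof. by case: MQ. Qed.
Let QQT : Q *m Q^T = 1%:M. Proof. exact: mulmx1C. Qed.

Lemma eigenvalue_sorted i j : (i <= j)%N -> nu j <= nu i.
Proof. by case: MQ => _ _ + _; apply. Qed.

Lemma eigenvalue_big i : (d <= i)%N -> nu i = 0.
Proof. by case: MQ => _ _ _; apply. Qed.

Lemma eigenvalue_ge0 i : 0 <= nu i.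
Proof.
have [id|/ltnW di] := leqP d i; first by rewrite eigenvalue_big.
by rewrite -(eigenvalue_big (leqnn d)) eigenvalue_sorted.
Qed.

Lemma eigenvalue_le0 i : nu i <= nu 0%N.
Proof. exact: eigenvalue_sorted. Qed.

Lemma eigenbasisE : M = Q *m diag_mx (\row_i nu i) *m Q^T.
Proof. by case: MQ => _ <- _ _; rewrite -mulmxA QQT mulmx1. Qed.

Lemma eigenbasis_sym : M^T = M.
Proof.
by rewrite eigenbasisE !trmx_mul trmxK tr_diag_mx mulmxA.
Qed.

Lemma dotv_crd x y : dotv x y = \sum_i crd Q x i * crd Q y i.
Proof.
by rewrite -[y]mul1mx -QQT -mulmxA dotvMr dotvE mulmxA QQT mul1mx.
Qed.

Lemma dotvv_crd x : dotv x x = \sum_i crd Q x i ^+ 2.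
Proof. exact: dotv_crd. Qed.

Lemma crdM x i : crd Q (M *m x) i = nu i * crd Q x i.
Proof.
rewrite /crd {1}eigenbasisE !mulmxA QTQ mul1mx -mulmxA mul_diag_mx.
by rewrite !mxE.
Qed.

Lemma quad_crd x : quad M x = \sum_(i < d) nu i * crd Q x i ^+ 2.
Proof.
by rewrite quadE dotv_crd; apply: eq_bigr => i _; rewrite crdM; ring.
Qed.

Lemma mxtrace_eigenbasis : \tr M = \sum_(i < d) nu i.
Proof.
rewrite eigenbasisE mxtrace_mulC mulmxA QTQ mul1mx mxtrace_diag.
by apply: eq_bigr => i _; rewrite mxE.
Qed.

Lemma quad_le_top x : quad M x <= nu 0%N * dotv x x.
Proof.
rewrite quad_crd dotvv_crd mulr_sumr ler_sum// => i _.
by rewrite ler_wpM2r ?sqr_ge0 ?eigenvalue_le0.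
Qed.

Lemma norm2_cut_le P x : norm2 (cut Q P x) <= norm2 x.
Proof.
rewrite -(ler_pXn2r (n := 2))//= ?nnegrE ?norm2_ge0// sqr_norm2_cut.
rewrite sqr_norm2 dotvv_crd [leLHS]big_mkcond ler_sum// => i _.
by case: ifP; rewrite // sqr_ge0.
Qed.

Lemma cut_split P x :
  dotv x x = norm2 (cut Q P x) ^+ 2 + norm2 (cut Q (predC P) x) ^+ 2.
Proof. by rewrite !sqr_norm2_cut dotvv_crd (bigID P). Qed.

Section Resolvent.
Variable lam : R.
Hypothesis lam_top : nu 0%N < lam.

Lemma resolvent_gap i : 0 < lam - nu i.
Proof. by rewrite subr_gt0 (le_lt_trans (eigenvalue_le0 i)). Qed.

Lemma quad_resolvent x :
  quad (lam%:M - M) x = \sum_(i < d) (lam - nu i) * crd Q x i ^+ 2.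
Proof.
rewrite quadD quadN quad_scalar quad_crd dotvv_crd mulr_sumr -sumrB.
by apply: eq_bigr => i _; rewrite mulrBl.
Qed.

Lemma resolvent_pd : pd (lam%:M - M).
Proof.
split; first by rewrite linearB/= tr_scalar_mx eigenbasis_sym.
move=> x; rewrite -dotvv_gt0 => x0; rewrite quad_resolvent.
apply: (@lt_le_trans _ _ ((lam - nu 0%N) * dotv x x)).
  by rewrite mulr_gt0// resolvent_gap.
rewrite dotvv_crd mulr_sumr ler_sum// => i _.
by rewrite ler_wpM2r ?sqr_ge0// lerB ?eigenvalue_le0.
Qed.

Lemma resolvent_unit : lam%:M - M \in unitmx.
Proof.
rewrite unitmxE unitfE; apply/det0P => -[v v0 vM].
have [_ /(_ v^T)] := resolvent_pd.
rewrite /quad trmxK vM mul0mx mxE ltxx -(inj_eq trmx_inj) trmxK trmx0 v0.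
by move/(_ isT).
Qed.

Lemma crd_resolvent x i :
  crd Q (invmx (lam%:M - M) *m x) i = crd Q x i / (lam - nu i).
Proof.
set y := invmx _ *m x; have xE : x = (lam%:M - M) *m y.
  by rewrite /y mulmxA mulmxV ?mul1mx// resolvent_unit.
rewrite [in RHS]xE.
rewrite mulmxBl mul_scalar_mx crdB crdZ crdM -mulrBl mulrC mulKf//.
by rewrite gt_eqF// resolvent_gap.
Qed.

Lemma quad_invmx x :
  dotv x (invmx (lam%:M - M) *m x) = \sum_(i < d) crd Q x i ^+ 2 / (lam - nu i).
Proof.
by rewrite dotv_crd; apply: eq_bigr => i _; rewrite crd_resolvent; ring.
Qed.

Lemma shifted_psd del : del <= lam - nu 0%N -> psd (lam%:M - M - del%:M).
Proof.
move=> dl; split.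
  by rewrite !linearB/= !tr_scalar_mx eigenbasis_sym.
move=> x; rewrite quadD quadN quad_scalar quad_resolvent dotvv_crd mulr_sumr.
rewrite -sumrB sumr_ge0// => i _; rewrite -mulrBl mulr_ge0 ?sqr_ge0//.
by have := eigenvalue_le0 i; lra.
Qed.

End Resolvent.

Section PowerMethod.
Variables (lam eta : R) (x : nat -> 'cV[R]_d).
Hypotheses (lam_top : nu 0%N < lam) (gap_le : lam - nu 0%N <= 3 / 2).
Hypothesis x_step : forall t,
  norm2 (x t.+1 - invmx (lam%:M - M) *m x t) <= eta.

Let g := lam - nu 0%N.
Let ratio i := g / (lam - nu i).

Let g_gt0 : 0 < g. Proof. exact: resolvent_gap. Qed.

Let ratio_ge0 i : 0 <= ratio i.
Proof. by rewrite divr_ge0// ltW// resolvent_gap. Qed.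

Let ratio_le1 i : ratio i <= 1.
Proof.
by rewrite ler_pdivrMr ?resolvent_gap// mul1r lerB ?eigenvalue_le0.
Qed.

(* Scaling the t-th iterate by g^t turns the exact iteration into a
   contraction that fixes the top eigenspace. *)
Lemma power_method_error m : exists2 z : 'cV[R]_d,
  forall i, crd Q z i = ratio i ^+ m * crd Q (x 0%N) i &
  norm2 (g ^+ m *: x m - z) <= eta * m%:R * (3 / 2) ^+ m.
Proof.
have eta0 : 0 <= eta by exact: le_trans (norm2_ge0 _) (x_step 0%N).
elim: m => [|m [z zi zx]].
  exists (x 0%N) => [i|]; first by rewrite mul1r.
  by rewrite scale1r subrr norm2E dotv0l sqrtr0 mulr0 mul0r.
pose B := invmx (lam%:M - M); pose u := g ^+ m *: x m - z.
exists (g *: (B *m z)) => [i|].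
  by rewrite crdZ crd_resolvent// zi exprS /ratio; ring.
(* The new error enters with the factor g^(m+1) <= (3/2)^(m+1); the accumulated one passes through g
   B, whose eigenvalues are the ratios, at most 1. *)
have -> : g ^+ m.+1 *: x m.+1 - g *: (B *m z) =
    g ^+ m.+1 *: (x m.+1 - B *m x m) + g *: (B *m u).
  rewrite /u scalerBr mulmxBr -scalemxAr scalerBr scalerA -exprS.
  by rewrite addrA subrK.
apply: le_trans (norm2D _ _) _.
have Bu : norm2 (g *: (B *m u)) <= norm2 u.
  rewrite norm2_le !dotvv_crd ler_sum// => i _; rewrite crdZ crd_resolvent//.
  rewrite mulrCA exprMn -[leRHS]mulr1 ler_wpM2l ?sqr_ge0//.
  by apply: exprn_ile1; [exact: ratio_ge0|exact: ratio_le1].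
rewrite norm2Z ger0_norm ?exprn_ge0 ?(ltW g_gt0)//.
have g32 : g ^+ m.+1 <= (3 / 2) ^+ m.+1.
  by apply: lerXn2r; rewrite ?nnegrE ?(ltW g_gt0)//; lra.
have e32 : (3 / 2 : R) ^+ m <= (3 / 2) ^+ m.+1.
  by rewrite exprS; have := exprn_ge0 m (_ : 0 <= 3 / 2 :> R); lra.
apply: (@le_trans _ _ ((3 / 2) ^+ m.+1 * eta + eta * m%:R * (3 / 2) ^+ m.+1)).
  apply: lerD.
    by apply: ler_pM; rewrite ?norm2_ge0 ?exprn_ge0 ?(ltW g_gt0).
  apply: le_trans Bu (le_trans zx _).
  by rewrite ler_wpM2l// mulr_ge0.
by rewrite -natr1; lra.
Qed.

Variables (P : pred 'I_d) (rho r : R) (m : nat).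
Hypothesis x0_unit : norm2 (x 0%N) = 1.
Hypothesis bad_ratio : forall i, P i -> g / (lam - nu i) <= rho.
Hypothesis overlap : r <= norm2 (cut Q (fun i => nu i == nu 0%N) (x 0%N)).

Let zeta := eta * m%:R * (3 / 2) ^+ m.

Lemma power_method_cut : zeta < r -> 0 <= rho ->
  norm2 (normalize (x m)) = 1 /\
  (r - zeta) * norm2 (cut Q P (normalize (x m))) <= rho ^+ m + zeta.
Proof.
move=> zr rho0; have [z zi zx] := power_method_error m.
rewrite -/zeta in zx; set y := g ^+ m *: x m in zx.
have zr' : r <= norm2 z.
  apply: le_trans overlap _.
  rewrite -(ler_pXn2r (n := 2))//= ?nnegrE ?norm2_ge0// sqr_norm2_cut.
  rewrite sqr_norm2 dotvv_crd [leLHS]big_mkcond ler_sum// => i _.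
  case: eqP => [ni|_]; last by rewrite sqr_ge0.
  by rewrite zi /ratio ni divff ?gt_eqF// expr1n mul1r.
have yr : r - zeta <= norm2 y.
  have := norm2B z (z - y); rewrite subKr.
  by rewrite -norm2N opprB in zx; lra.
have y0 : y != 0 by rewrite -norm2_gt0; lra.
have x0 : x m != 0 by apply: contraNneq y0; rewrite /y => ->; rewrite scaler0.
split; first exact: normalize_norm2.
have -> : normalize (x m) = normalize y.
  rewrite /normalize /y norm2Z scalerA ger0_norm ?exprn_ge0 ?(ltW g_gt0)//.
  by rewrite invfM mulrAC mulVf ?mul1r// expf_neq0// gt_eqF.
rewrite cutZ norm2Z ger0_norm ?invr_ge0 ?norm2_ge0//.
have Py : norm2 (cut Q P y) <= rho ^+ m + zeta.
  have -> : y = z + (y - z) by rewrite addrC subrK.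
  rewrite cutD; apply: le_trans (norm2D _ _) _; apply: lerD; last first.
    exact: le_trans (norm2_cut_le _ _) zx.
  rewrite -(ler_pXn2r (n := 2))//= ?nnegrE ?norm2_ge0 ?exprn_ge0//.
  rewrite sqr_norm2_cut; apply: (@le_trans _ _ ((rho ^+ m) ^+ 2 * dotv (x 0%N) (x 0%N))).
    rewrite dotvv_crd mulr_sumr [leLHS]big_mkcond ler_sum// => i _.
    case: ifP => Pi; last by rewrite mulr_ge0 ?sqr_ge0.
    rewrite zi exprMn ler_wpM2r ?sqr_ge0// lerXn2r ?nnegrE ?exprn_ge0//.
    by rewrite lerXn2r ?nnegrE// bad_ratio.
  by rewrite dotv_eq1// mulr1.
apply: le_trans Py; rewrite mulrA -[leRHS]mul1r ler_wpM2r ?norm2_ge0//.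
by rewrite ler_pdivrMr ?norm2_gt0// mul1r.
Qed.

End PowerMethod.
End Eigenbasis.

Lemma rect_diag_gram (R : realType) d n (s : nat -> R) :
  (forall i, (n <= i)%N -> s i = 0) ->
  rect_diag d n s *m (rect_diag d n s)^T = diag_mx (\row_i s i ^+ 2).
Proof.
move=> big; apply/matrixP => i j; rewrite !mxE.
have [ni|ni] := ltnP i n; last first.
  rewrite big// expr0n mul0rn big1// => l _; rewrite !mxE.
  by rewrite gtn_eqF ?mul0r// (leq_trans (ltn_ord l)).
rewrite (bigD1 (Ordinal ni))//= big1 => [|l li]; last first.
  rewrite !mxE; case: eqP => il; last by rewrite mul0r.
  by rewrite -val_eqE/= il eqxx in li.
rewrite !mxE /= eqxx addr0; have [->|ij] := eqVneq i j; first by rewrite eqxx.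
by rewrite eq_sym -val_eqE/= in ij; rewrite (negbTE ij) mulr0.
Qed.

Lemma svd_gram (R : realType) d n (U : 'M[R]_d) (W : 'M[R]_n) (s : nat -> R) :
  orthogonal_mx W -> (forall i, (n <= i)%N -> s i = 0) ->
  let A := U *m rect_diag d n s *m W^T in
  A *m A^T = U *m diag_mx (\row_i s i ^+ 2) *m U^T.
Proof.
move=> WW big A; rewrite -(rect_diag_gram _ big) /A !trmx_mul trmxK !mulmxA.
by congr (_ *m _ *m _); rewrite -mulmxA (orthogonal_mxC WW) mulmx1.
Qed.

Lemma svd_eigenbasis (R : realType) d n (A : 'M[R]_(d, n)) U sigma W :
  is_svd A U sigma W ->
  eigenbasis (A *m A^T) U (fun i => sigma i ^+ 2).
Proof.
move=> [UU WW sorted big AE]; have UTU := orthogonal_mxC UU.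
split=> //; last 2 first.
- move=> i j ij; have /andP[s0 sij] := sorted _ _ ij.
  by rewrite lerXn2r// nnegrE ?(le_trans s0).
- by move=> i di; rewrite big ?expr0n// geq_min di.
rewrite AE svd_gram// => [|i ni]; last by rewrite big// geq_min ni orbT.
by rewrite -mulmxA UTU mulmx1.
Qed.

Lemma le_absz_ceil (R : realType) (x : R) : x <= `|Num.ceil x|%N%:R.
Proof. by rewrite natr_absz; apply: le_trans (ceil_ge x) _; rewrite ler_int ler_norm. Qed.

Lemma absz_ceil_le (R : realType) (x : R) : 0 <= x -> `|Num.ceil x|%N%:R <= x + 1.
Proof.
move=> x0; rewrite natr_absz ger0_norm; last first.
  by rewrite -(ceil0 R) le_ceil.
by have := ceilB1_lt x; rewrite intrB; lra.
Qed.

Lemma expr_1B_le (R : realType) (x a : R) m :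
  0 <= x <= 1 -> a <= x * m%:R -> (1 - x) ^+ m <= expR (- a).
Proof.
move=> /andP[x0 x1] am; apply: (@le_trans _ _ (expR (- x) ^+ m)).
  by rewrite lerXn2r ?nnegrE ?subr_ge0 ?expR_ge0// expR_ge1Dx.
by rewrite -expRM_natr ler_expR mulNr lerN2.
Qed.

(** * Numerical constants of the prescribed accuracies *)

Section RoundingErrors.
Variables (R : realType) (delta : R) (m : nat).
Hypotheses (delta01 : 0 < delta <= 1 / 2) (m_gt0 : (0 < m)%N).

(** The power of delta / 6 in the accuracies pays for the growth (3/2)^m of propagated errors:
    (delta / 6) (3 / 2) = delta / 4 <= 1 / 8. *)
Let delta_expr : 0 <= (delta / 6) ^+ m * (3 / 2) ^+ m <= (1 / 8) ^+ m.
Proof.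
have dl := delta01; rewrite -exprMn; apply/andP; split.
  by rewrite exprn_ge0//; lra.
by apply: lerXn2r; rewrite ?nnegrE; lra.
Qed.

Lemma rounding_error1 (t : R) : (3 / 4) ^+ m <= t ->
  (64 * m%:R)^-1 * (delta / 6) ^+ m * m%:R * (3 / 2) ^+ m <= t / 64.
Proof.
move=> mt; have m0 : m%:R != 0 :> R by rewrite pnatr_eq0 -lt0n.
rewrite [leLHS](_ : _ = (delta / 6) ^+ m * (3 / 2) ^+ m / 64); last first.
  by move: (_ ^+ m) (_ ^+ m) (m%:R) m0 => x y z z0; field.
have := delta_expr.
have : (1 / 8 : R) ^+ m <= (3 / 4) ^+ m by apply: lerXn2r; rewrite ?nnegrE; lra.
by lra.
Qed.

Lemma rounding_error1_small : (64 * m%:R)^-1 * (delta / 6) ^+ m <= 1 / 768.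
Proof.
have dl := delta01.
rewrite invfM; apply: (@le_trans _ _ (64^-1 * 1 * (1 / 12))); last lra.
apply: ler_pM; rewrite ?mulr_ge0 ?invr_ge0 ?exprn_ge0//; [lra| |].
  by apply: ler_pM; rewrite ?invr_ge0// invf_le1 ?ler1n ?ltr0n.
case: m m_gt0 => // n _; rewrite exprS.
apply: (@le_trans _ _ (delta / 6 * 1)); last lra.
by rewrite ler_wpM2l ?exprn_ile1//; lra.
Qed.

Lemma rounding_error2 (e : R) : 0 < e < 1 ->
  e / (8 * m%:R) * (delta / 6) ^+ m * m%:R * (3 / 2) ^+ m <= (1 / 2) ^+ m / 8.
Proof.
move=> e01; have m0 : m%:R != 0 :> R by rewrite pnatr_eq0 -lt0n.
rewrite [leLHS](_ : _ = (delta / 6) ^+ m * (3 / 2) ^+ m * e / 8); last first.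
  by move: (_ ^+ m) (_ ^+ m) (m%:R) m0 => x y z z0; field.
have /andP[q0 q1] := delta_expr.
have : (1 / 8 : R) ^+ m <= (1 / 2) ^+ m by apply: lerXn2r; rewrite ?nnegrE; lra.
set q := _ * (3 / 2) ^+ m in q0 q1 *.
have : q * e <= q * 1 by rewrite ler_wpM2l//; lra.
by lra.
Qed.

End RoundingErrors.

(** Here [y] bounds the contracted part and [z] the rounding error. A numerator of order r^2 keeps a
    factor r <= 1/3 after division by r - z >= r / 2. *)
Lemma bad_part_small1 (R : realType) (r y z c : R) : 0 < r <= 1 / 3 ->
  y <= r ^+ 2 / 32 -> z <= r ^+ 2 / 32 / 64 -> 0 <= c ->
  (r - z) * c <= y + z -> c <= 1 / 24.
Proof.
move=> r01 yr zr c0 h.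
have r2 : r ^+ 2 <= r * (1 / 3) by rewrite expr2 ler_wpM2l//; lra.
have : r * (1 / 2) * c <= (r - z) * c by rewrite ler_wpM2r//; lra.
have -> : r * (1 / 2) * c = r * (c / 2) by lra.
move=> /le_trans/(_ h) h'.
have : r * (c / 2) <= r * (1 / 48) by lra.
by rewrite ler_pM2l; lra.
Qed.

(** Used with s = sqrt(eps). The numerator is at most (9/16) r s and r - z is at least (15/16) r,
    hence 6/10, whose square is below 1/2. *)
Lemma bad_part_small2 (R : realType) (r y z c s : R) : 0 < r -> 0 <= s <= 1 ->
  y <= r * s / 2 -> z <= y / 8 -> 0 <= c ->
  (r - z) * c <= y + z -> c <= 6 / 10 * s.
Proof.
move=> r0 s01 yr zr c0 h.
have rs : r * s <= r * 1 by rewrite ler_wpM2l//; lra.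
have : r * (15 / 16) * c <= (r - z) * c by rewrite ler_wpM2r//; lra.
have -> : r * (15 / 16) * c = r * (15 / 16 * c) by lra.
move=> /le_trans/(_ h) h'.
have : r * (15 / 16 * c) <= r * (9 / 16 * s) by lra.
by rewrite ler_pM2l; lra.
Qed.

(** * AppxPCA *)

Section AppxPCA.
Variables (R : realType) (d : nat) (M Q : 'M[R]_d) (nu : nat -> R).
Variable inv : nat -> nat -> R -> 'M[R]_d -> 'cV[R]_d -> R -> 'cV[R]_d.
Variables (delta eps p : R) (w0 : 'cV[R]_d).
Hypothesis MQ : eigenbasis M Q nu.
Hypotheses (nu_gt0 : 0 < nu 0%N) (nu_le1 : nu 0%N <= 1).
Hypothesis inv_acc : forall i t lam b eta, pd (lam%:M - M) -> 0 < eta ->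
  norm2 (inv i t lam M b eta - invmx (lam%:M - M) *m b) <= eta.
Hypotheses (delta01 : 0 < delta <= 1 / 2) (eps01 : 0 < eps < 1)
  (p01 : 0 < p < 1) (w01 : norm2 w0 = 1).

(** The overlap with a fixed direction that a random start vector misses with probability at most
    [p]. Its square is p^2 / (9 d), which explains 288 = 32 * 9 and 36 = 4 * 9 in the iteration
    counts. *)
Definition pca_overlap : R := p / (3 * Num.sqrt d%:R).
Local Notation r := pca_overlap.
Hypothesis w0_top : r <= norm2 (cut Q (fun i => nu i == nu 0%N) w0).

Local Notation m1 := (pca_m1 d p).
Local Notation m2 := (pca_m2 d eps p).
Local Notation eps1 := (pca_eps1 d delta p).
Local Notation eps2 := (pca_eps2 d delta eps p).
Local Notation lambda := (pca_lambda inv M delta p w0).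
Local Notation gap s := (lambda s - nu 0%N).
Local Notation Delta := (pca_Delta inv M delta p w0).

Ltac slra := have := nu_gt0; have := nu_le1; have := delta01; have := eps01;
  have := p01; lra.

Let d_gt0 : (0 < d)%N.
Proof.
case: (posnP d) => // d0; move: nu_gt0.
by rewrite (eigenvalue_big MQ) ?ltxx// d0.
Qed.

Let dR : 1 <= d%:R :> R. Proof. by rewrite ler1n. Qed.

Let sd : 1 <= Num.sqrt d%:R :> R.
Proof. by rewrite -{1}sqrtr1 ler_sqrt// ltr0n. Qed.

Let r_gt0 : 0 < r.
Proof. by rewrite divr_gt0 ?mulr_gt0//; have := sd; slra. Qed.

Let r_le : r <= 1 / 3.
Proof.
have s1 := sd; rewrite ler_pdivrMr; last by rewrite mulr_gt0//; slra.
slra.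
Qed.

Let r2E : r ^+ 2 = p ^+ 2 / (9 * d%:R).
Proof.
by rewrite expr_div_n exprMn sqr_sqrtr ?ler0n// -natrX.
Qed.

Lemma pca_m1_ge : 4 * ln (288 * d%:R / p ^+ 2) <= m1%:R.
Proof. exact: le_absz_ceil. Qed.

Lemma pca_m2_ge : ln (36 * d%:R / (p ^+ 2 * eps)) <= m2%:R.
Proof. exact: le_absz_ceil. Qed.

Let X_gt1 : 1 < 288 * d%:R / p ^+ 2.
Proof.
rewrite ltr_pdivlMr ?exprn_gt0//; last slra.
rewrite mul1r; apply: (@lt_le_trans _ _ 1); last by have := dR; slra.
by rewrite expr_lt1//; slra.
Qed.

Let Y_gt1 : 1 < 36 * d%:R / (p ^+ 2 * eps).
Proof.
have p2 : 0 < p ^+ 2 by rewrite exprn_gt0//; slra.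
rewrite ltr_pdivlMr; last by rewrite pmulr_rgt0//; slra.
rewrite mul1r; apply: (@lt_le_trans _ _ 1); last by have := dR; slra.
have : p ^+ 2 <= 1 by rewrite exprn_ile1//; slra.
move=> p21; apply: (@le_lt_trans _ _ (1 * eps)); last slra.
by rewrite ler_wpM2r//; slra.
Qed.

Lemma pca_m1_gt0 : (0 < m1)%N.
Proof.
rewrite -(ltr0n R); apply: lt_le_trans pca_m1_ge.
by rewrite mulr_gt0// ln_gt0// X_gt1.
Qed.

Lemma pca_m2_gt0 : (0 < m2)%N.
Proof. by rewrite -(ltr0n R); apply: lt_le_trans pca_m2_ge; rewrite ln_gt0// Y_gt1. Qed.

Lemma pca_eps1_gt0 : 0 < eps1.
Proof.
rewrite mulr_gt0 ?invr_gt0 ?mulr_gt0 ?ltr0n ?pca_m1_gt0 ?exprn_gt0//; slra.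
Qed.

Lemma pca_eps2_gt0 : 0 < eps2.
Proof.
by rewrite mulr_gt0 ?divr_gt0 ?mulr_gt0 ?ltr0n ?pca_m2_gt0 ?exprn_gt0//; slra.
Qed.

Let rho1 : (3 / 4) ^+ m1 <= r ^+ 2 / 32.
Proof.
have -> : (3 / 4 : R) = 1 - 1 / 4 by slra.
apply: le_trans (_ : expR (- ln (288 * d%:R / p ^+ 2)) <= _).
  by apply: expr_1B_le; have := pca_m1_ge; slra.
rewrite -lnV ?posrE ?lnK ?posrE ?invr_gt0;
  [|by have := X_gt1; have := Y_gt1; slra..].
by rewrite r2E invf_div le_eqVlt; apply/orP; left; apply/eqP; field; rewrite lt0r_neq0// ltr0n.
Qed.

Let rho2 : (1 / 4) ^+ m2 <= r ^+ 2 * eps / 4.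
Proof.
(* For base 1 - 1/2 and 2 m2 factors the exponential bound has exponent exactly m2. *)
have -> : (1 / 4 : R) ^+ m2 = (1 - 1 / 2) ^+ (m2 + m2).
  by rewrite exprD -exprMn; congr (_ ^+ _); slra.
apply: le_trans (_ : expR (- ln (36 * d%:R / (p ^+ 2 * eps))) <= _).
  by apply: expr_1B_le; rewrite ?natrD; have := pca_m2_ge; slra.
rewrite -lnV ?posrE ?lnK ?posrE ?invr_gt0;
  [|by have := X_gt1; have := Y_gt1; slra..].
by rewrite r2E invf_div le_eqVlt; apply/orP; left; apply/eqP; field; rewrite lt0r_neq0// ltr0n.
Qed.

Let zeta1 : eps1 * m1%:R * (3 / 2) ^+ m1 <= r ^+ 2 / 32 / 64.
Proof. exact: rounding_error1 delta01 pca_m1_gt0 _ rho1. Qed.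

Let eps1_le : eps1 <= 1 / 768.
Proof. exact: rounding_error1_small delta01 pca_m1_gt0. Qed.

Let r2 : 0 < r ^+ 2 <= r / 3.
Proof.
have r0 := r_gt0; have r1 := r_le; rewrite exprn_gt0//= expr2.
by have := ler_wpM2l (ltW r0) r1; lra.
Qed.

Lemma pca_power_step s lam eta t : nu 0%N < lam -> 0 < eta ->
  norm2 (pca_power inv M w0 s lam eta t.+1 -
         invmx (lam%:M - M) *m pca_power inv M w0 s lam eta t) <= eta.
Proof. by move=> nl eta0; apply: inv_acc => //; exact: (resolvent_pd MQ). Qed.

(** [P] collects the eigenvalues whose ratio is at most 3/4. The others carry weight at least 1 -
    1/24^2 of [w] and contribute at least (3/4) / gap per unit of weight; the product exceeds
    74/100. *)
Lemma pca_w_top s lam : nu 0%N < lam -> lam - nu 0%N <= 3 / 2 ->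
  let w := pca_w inv M delta p w0 s lam in
  norm2 w = 1 /\
  74 / 100 / (lam - nu 0%N) <= dotv w (invmx (lam%:M - M) *m w)
    <= (lam - nu 0%N)^-1.
Proof.
move=> nl g32 w; set g := lam - nu 0%N in g32 *.
have g0 : 0 < g by rewrite subr_gt0.
pose P := [pred i : 'I_d | g / (lam - nu i) <= 3 / 4].
have step t := pca_power_step s t nl pca_eps1_gt0.
have r20 := r2; have r1 := r_le; have rho0 : 0 <= 3 / 4 :> R by [].
have zr : eps1 * m1%:R * (3 / 2) ^+ m1 < r.
  by apply: le_lt_trans zeta1 _; lra.
have [w1 wP] := power_method_cut (P := P) MQ nl g32 step w01
  (fun i (Pi : P i) => Pi) w0_top zr rho0.
rewrite -/w in w1 wP; split=> //; rewrite (quad_invmx MQ nl).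
have gap_gt0 i := resolvent_gap MQ nl i.
have w2 : \sum_i crd Q w i ^+ 2 = 1 by rewrite -(dotvv_crd MQ) dotv_eq1.
apply/andP; split; last first.
  rewrite -[leRHS]mul1r -w2 mulr_suml ler_sum// => i _.
  by rewrite ler_wpM2l ?sqr_ge0// lef_pV2 ?posrE// lerB// (eigenvalue_le0 MQ).
have c_le : norm2 (cut Q P w) <= 1 / 24.
  apply: (bad_part_small1 _ rho1 zeta1 (norm2_ge0 _) wP).
  by rewrite r_gt0 r_le.
clear wP zr step.
have := cut_split MQ P w; rewrite dotv_eq1// => split1.
have c2 : norm2 (cut Q P w) ^+ 2 <= (1 / 24) ^+ 2.
  by apply: lerXn2r; rewrite ?nnegrE ?norm2_ge0//; slra.
apply: (@le_trans _ _ (\sum_(i | predC P i) (3 / 4 / g) * crd Q w i ^+ 2)).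
  rewrite -mulr_sumr -sqr_norm2_cut.
  have -> : norm2 (cut Q (predC P) w) ^+ 2 = 1 - norm2 (cut Q P w) ^+ 2 by slra.
  rewrite [leRHS]mulrAC ler_wpM2r ?invr_ge0 ?(ltW g0)//.
  slra.
rewrite [leLHS]big_mkcond ler_sum// => i _.
case: ifPn => [|_]; last by rewrite divr_ge0 ?sqr_ge0 ?(ltW (gap_gt0 i)).
rewrite /= -ltNge => /ltW h; rewrite mulrC ler_wpM2l ?sqr_ge0//.
by rewrite ler_pdivrMr// [leRHS]mulrC.
Qed.

(** Subtracting the accuracy makes the estimate one-sided: q = w^T v - eps1 never exceeds 1 / gap,
    so Delta >= gap / 2. As the gap is at most 3/2, the error 2 eps1 is small against 1 / gap, so q
    stays above (7/10) / gap and Delta below (5/7) gap. *)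
Lemma pca_Delta_bounds s lam : nu 0%N < lam -> lam - nu 0%N <= 3 / 2 ->
  (lam - nu 0%N) / 2 <= pca_Delta_at inv M delta p w0 s lam <= lam - nu 0%N.
Proof.
move=> nl g32; have [w1] := pca_w_top s nl g32.
rewrite /pca_Delta_at -/(dotv _ _); set w := pca_w _ _ _ _ _ _ _ in w1 *.
set v := pca_v _ _ _ _ _ _ _; set B := invmx _; set g := lam - nu 0%N in g32 *.
have g0 : 0 < g by rewrite subr_gt0.
have gV : 2 / 3 <= g^-1 by rewrite -[2 / 3]invf_div lef_pV2 ?posrE.
move=> /andP[lo hi].
have vw : norm2 (v - B *m w) <= eps1.
  by apply: inv_acc pca_eps1_gt0; exact: (resolvent_pd MQ).
have := le_trans (dotv_le w (v - B *m w)) (_ : _ <= eps1).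
rewrite w1 mul1r => /(_ vw); rewrite dotvBr ler_norml => /andP[l1 l2].
set q := dotv w v - eps1; have e1 := eps1_le.
have q_lo : 7 / 10 * g^-1 <= q by rewrite /q; slra.
have q_hi : q <= g^-1 by rewrite /q; slra.
have q0 : 0 < q by slra.
have qV_lo : g <= q^-1 by rewrite -[g]invrK lef_pV2 ?posrE// invr_gt0.
have qV_hi : q^-1 <= 10 / 7 * g.
  rewrite -[10 / 7]invf_div -[g in leRHS]invrK -invfM lef_pV2 ?posrE//.
  by rewrite mulr_gt0 ?invr_gt0//; slra.
slra.
Qed.

(** The update subtracts Delta / 2, between a quarter and a half of the gap, so lambda never crosses
    the top eigenvalue. *)
Lemma pca_gap s : 0 < gap s <= 3 / 2.
Proof.
elim: s => [|s /andP[g0 g1]] /=; first slra.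
have := @pca_Delta_bounds s.+1 (lambda s) _ g1; rewrite -subr_gt0 => /(_ g0); slra.
Qed.

Lemma pca_lambda_gt s : nu 0%N < lambda s.
Proof. by have /andP[+ _] := pca_gap s; rewrite subr_gt0. Qed.

Lemma pca_Delta_gap s : gap s / 2 <= Delta s.+1 <= gap s.
Proof.
by apply: pca_Delta_bounds; [exact: pca_lambda_gt|case/andP: (pca_gap s)].
Qed.

Lemma pca_lambdaS s : lambda s.+1 = lambda s - Delta s.+1 / 2.
Proof. by []. Qed.

Lemma pca_lambda_le s : lambda s <= 3 / 2.
Proof.
elim: s => [|s IH]; first by rewrite /=; slra.
by rewrite pca_lambdaS; have := pca_Delta_gap s; have := pca_gap s; slra.
Qed.

Lemma pca_gap_expr s : gap s <= (3 / 4) ^+ s * (3 / 2).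
Proof.
elim: s => [|s IH]; first by case/andP: (pca_gap 0); rewrite mul1r.
by rewrite pca_lambdaS exprS; have := pca_Delta_gap s; have := pca_gap s; slra.
Qed.

Let tau : R := 6 / (delta * nu 0%N).

Let tau_ge1 : 1 <= tau.
Proof.
rewrite ler_pdivlMr ?mulr_gt0//; last slra.
rewrite mul1r; apply: (@le_trans _ _ (1 / 2 * 1)); last slra.
by apply: ler_pM; slra.
Qed.

(** A failed test gives delta nu_0 < delta lambda < 3 Delta <= 3 (3/2) (3/4)^(s-1) = 6 (3/4)^s, the
    origin of the 6 in [tau]; the factor 4 is the inverse of the rate 1/4. *)
Lemma pca_nonstop_le s : (0 < s)%N -> ~~ pca_stop inv M delta p w0 s ->
  s%:R <= 4 * ln tau.
Proof.
case: s => // s _; rewrite /pca_stop -ltNge => ns; rewrite leNgt; apply/negP => hs.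
have : (1 - 1 / 4) ^+ s.+1 <= expR (- ln tau).
  by apply: expr_1B_le; slra.
have t0 : 0 < tau by apply: lt_le_trans tau_ge1.
rewrite -lnV ?posrE ?lnK ?posrE ?invr_gt0//; rewrite /tau invf_div.
have -> : 1 - 1 / 4 = 3 / 4 :> R by slra.
have := pca_gap_expr s; have := pca_Delta_gap s; have := pca_lambda_gt s.+1.
have : delta * nu 0%N <= delta * lambda s.+1.
  by rewrite ler_wpM2l ?(ltW (pca_lambda_gt _))//; slra.
by rewrite exprS; slra.
Qed.

Lemma pca_halting : pca_halts inv M delta p w0.
Proof.
pose stop s := (0 < s)%N && pca_stop inv M delta p w0 s.
have exs : exists s, stop s.
  have := le_absz_ceil (4 * ln tau); set N := `|_|%N => hN.
  exists N.+1; rewrite /stop /=; apply/negPn/negP => ns.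
  by have := pca_nonstop_le (ltn0Sn N) ns; rewrite -natr1; slra.
exists (ex_minn exs); case: ex_minnP => m /andP[m0 ms] mmin; split=> // s /andP[s0 sm].
by apply/negP => ss; have := mmin s; rewrite /stop s0 ss leqNgt sm => /(_ isT).
Qed.

Local Notation f := (pca_f inv M delta p w0).

Lemma pca_f_final : pca_final inv M delta p w0 f.
Proof. exact: (xgetPex 0%N pca_halting). Qed.

Lemma pca_f_le : f%:R <= 4 * ln tau + 1.
Proof.
have [f0 _ ns] := pca_f_final; have lt := ln_ge0 tau_ge1.
have [f1|f1] := leqP f 1.
  by apply: (@le_trans _ _ 1); [rewrite lern1|slra].
have f1' : (0 < f.-1)%N by rewrite -ltnS prednK.
have fE : f%:R = f.-1%:R + 1 :> R by rewrite natr1 prednK.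
have := pca_nonstop_le f1' (ns _ _); rewrite f1' prednK// leqnn => /(_ isT).
by rewrite fE; lra.
Qed.

(** The quotient of lambda by the gap governs the cost of an inversion. A failed test gives delta
    lambda_u < 3 Delta_u <= 3 gap_(u-1), and one step at most halves the gap: 6 before the last
    stage, 12 at the last. *)
Lemma pca_lambda_ratio s : (s <= f)%N -> delta * lambda s <= 12 * gap s.
Proof.
have early u : (u < f)%N -> delta * lambda u <= 6 * gap u.
  case: u => [_|u uf].
    have := pca_gap 0; have := pca_lambda_le 0; rewrite /= => l0 g0.
    have : delta * (1 + delta) <= delta * (3 / 2) by rewrite ler_wpM2l//; slra.
    by slra.
  have [_ _ /(_ u.+1)] := pca_f_final; rewrite uf => /(_ isT).
  rewrite /pca_stop -ltNge pca_lambdaS; have := pca_Delta_gap u; slra.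
rewrite leq_eqVlt => /predU1P[->|/early]; last by have := pca_gap s; slra.
have [f0 _ _] := pca_f_final.
have := early f.-1; rewrite prednK// leqnn => /(_ isT).
rewrite -[in X in _ -> X](prednK f0) pca_lambdaS.
have := pca_Delta_gap f.-1; have := pca_gap f.-1.
set D := Delta _; set l := lambda _ => gp dg h.
have : 0 <= delta * D by rewrite mulr_ge0//; slra.
by move: gp dg h; clearbody D l; lra.
Qed.

(** The new gap is the old one minus Delta / 2, and the old one is at most 2 Delta; so the new one
    is at most (3/2) Delta, which the stopping test bounds. *)
Lemma pca_final_gap : 2 * gap f <= delta * lambda f.
Proof.
have [f0] := pca_f_final; rewrite /pca_stop => + _.
rewrite -{1 2 3}(prednK f0) -[in X in _ -> X](prednK f0) pca_lambdaS.
have := pca_Delta_gap f.-1; slra.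
Qed.

(** The bound eps / 2 leaves room for the orthogonalization in LazySVD, which may double the bad
    weight. *)
Lemma appx_pca_spec :
  let w := appx_pca inv M delta eps p w0 in
  norm2 w = 1 /\
  norm2 (cut Q (fun i => nu i <= (1 - delta) * nu 0%N) w) ^+ 2 <= eps / 2.
Proof.
move=> w; have nl := pca_lambda_gt f; have /andP[g0 g32] := pca_gap f.
pose P := [pred i : 'I_d | nu i <= (1 - delta) * nu 0%N].
have step t := pca_power_step f.+1 t nl pca_eps2_gt0.
(* A bad eigenvalue lies at least delta nu_0 below the top, and delta nu_0 = delta lambda - delta
   gap >= 2 gap - gap / 2; so its distance from lambda is at least twice the gap. *)
have bad i : P i -> gap f / (lambda f - nu i) <= 1 / 2.
  rewrite ler_pdivrMr ?(resolvent_gap MQ nl)// => /= Pi.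
  have := pca_final_gap => fg.
  have : delta * lambda f <= 1 / 2 * lambda f.
    by rewrite ler_wpM2r//; slra.
  have : delta * gap f <= 1 / 2 * gap f by rewrite ler_wpM2r//; slra.
  by slra.
set h : R := (1 / 2) ^+ m2.
have h0 : 0 < h by rewrite exprn_gt0.
have h2 : h <= r * Num.sqrt eps / 2.
  rewrite -(ler_pXn2r (n := 2))//= ?nnegrE ?(ltW h0)//; last first.
    by rewrite divr_ge0// mulr_ge0 ?sqrtr_ge0// ltW// r_gt0.
  rewrite !expr_div_n exprMn sqr_sqrtr; last slra.
  rewrite -exprM mulnC exprM (_ : (1 / 2) ^+ 2 = 1 / 4 :> R); last by lra.
  by apply: le_trans rho2 _; rewrite -natrX; lra.
have e1 : Num.sqrt eps <= 1 by rewrite -sqrtr1 ler_sqrt//; slra.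
have zeta2 := rounding_error2 delta01 pca_m2_gt0 eps01.
rewrite -/(pca_eps2 _ _ _ _) -/h in zeta2.
have rs : r * Num.sqrt eps <= r * 1 by rewrite ler_wpM2l ?(ltW r_gt0).
have r0 := r_gt0.
have zr : eps2 * m2%:R * (3 / 2) ^+ m2 < r by apply: le_lt_trans zeta2 _; lra.
have rho0 : 0 <= 1 / 2 :> R by [].
have [w1 wP] := power_method_cut (P := P) MQ nl g32 step w01 bad w0_top zr rho0.
rewrite -/w -/h in w1 wP; split=> //.
have c_le : norm2 (cut Q P w) <= 6 / 10 * Num.sqrt eps.
  by apply: (bad_part_small2 r0 _ h2 zeta2 (norm2_ge0 _) wP); rewrite sqrtr_ge0.
set c := norm2 _ in c_le *; have c0 : 0 <= c by exact: norm2_ge0.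
have := sqr_sqrtr (ltW (andP eps01).1); move: c c0 c_le => c c0 c_le se.
have : c ^+ 2 <= (6 / 10 * Num.sqrt eps) ^+ 2.
  by apply: lerXn2r; rewrite ?nnegrE ?mulr_ge0 ?sqrtr_ge0//; slra.
clear wP zr zeta2 step h2 h0 h rs nl g0 g32 bad.
by rewrite exprMn se; have := eps01; lra.
Qed.

End AppxPCA.

(** * Deflation *)

Section LeadingEigenvectors.
Variables (R : realType) (d : nat) (M Q : 'M[R]_d) (nu : nat -> R).
Hypothesis MQ : eigenbasis M Q nu.

Definition lead_cols j (jd : (j <= d)%N) (B : 'M[R]_d) : 'M[R]_(d, j) :=
  colsub (widen_ord jd) B.

Lemma crd_lead j (jd : (j <= d)%N) x i :
  ((lead_cols jd Q)^T *m x) i 0 = crd Q x (widen_ord jd i).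
Proof. by rewrite /crd !mxE; apply: eq_bigr => l _; rewrite !mxE. Qed.

Lemma lead_colsTK j (jd : (j <= d)%N) : (lead_cols jd Q)^T *m lead_cols jd Q = 1%:M.
Proof.
case: MQ => /matrixP QQ _ _ _; apply/matrixP => a b.
have := QQ (widen_ord jd a) (widen_ord jd b); rewrite !mxE -val_eqE/= => <-.
by apply: eq_bigr => l _; rewrite !mxE.
Qed.

Lemma crd_lead_cols j (jd : (j <= d)%N) (y : 'cV[R]_j) (i : 'I_d) : (j <= i)%N ->
  crd Q (lead_cols jd Q *m y) i = 0.
Proof.
case: MQ => /matrixP QQ _ _ _ ji; rewrite /crd mulmxA mxE big1// => l _.
rewrite (_ : (Q^T *m _) i l = 0) ?mul0r//.
transitivity ((1%:M : 'M[R]_d) i (widen_ord jd l)).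
  by rewrite -QQ !mxE; apply: eq_bigr => a _; rewrite !mxE.
rewrite mxE; case: eqP => // il; move: ji.
by rewrite il /= leqNgt ltn_ord.
Qed.

Lemma lead_cols_eq0 j (jd : (j <= d)%N) (y : 'cV[R]_j) :
  lead_cols jd Q *m y = 0 -> y = 0.
Proof. by move=> y0; rewrite -[y]mul1mx -(lead_colsTK jd) -mulmxA y0 mulmx0. Qed.

Lemma quad_lead_ge j (jd : (j.+1 <= d)%N) (y : 'cV[R]_j.+1) :
  nu j * dotv (lead_cols jd Q *m y) (lead_cols jd Q *m y) <=
  quad M (lead_cols jd Q *m y).
Proof.
set x := _ *m _; rewrite (quad_crd MQ) (dotvv_crd MQ) mulr_sumr ler_sum// => i _.
have [ij|ji] := leqP i j.
  by rewrite ler_wpM2r ?sqr_ge0// (eigenvalue_sorted MQ).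
by rewrite crd_lead_cols// expr0n !mulr0.
Qed.

Lemma quad_tail_le j x : (forall i : 'I_d, (i < j)%N -> crd Q x i = 0) ->
  quad M x <= nu j * dotv x x.
Proof.
move=> h; rewrite (quad_crd MQ) (dotvv_crd MQ) mulr_sumr ler_sum// => i _.
have [ij|ji] := ltnP i j; first by rewrite h// expr0n !mulr0.
by rewrite ler_wpM2r ?sqr_ge0// (eigenvalue_sorted MQ).
Qed.

Lemma top_eigenvalue_le x0 mu : (0 < d)%N -> x0 <= nu 0%N ->
  (forall x, quad M x <= mu * dotv x x) -> x0 <= mu.
Proof.
move=> d0 xn h; have := quad_lead_ge d0 (const_mx 1).
set x := _ *m _ => nx; have := le_trans nx (h x).
have x1 : 0 < dotv x x.
  rewrite dotvv_gt0; apply/eqP => /lead_cols_eq0/matrixP/(_ 0 0).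
  by rewrite !mxE => /eqP; rewrite oner_eq0.
by rewrite ler_pM2r//; exact: le_trans.
Qed.

End LeadingEigenvectors.

Lemma singular_left_kernel (R : realType) m n (B : 'M[R]_(m, n)) (c : 'cV[R]_n) :
  (n <= m)%N -> c != 0 -> B *m c = 0 -> exists2 y : 'rV[R]_m, y != 0 & y *m B = 0.
Proof.
move=> nm c0 Bc.
have cK : (c^T <= kermx B^T)%MS.
  by apply/sub_kermxP; rewrite -trmx_mul Bc trmx0.
have : kermx B != 0.
  rewrite -mxrank_eq0 mxrank_ker -lt0n subn_gt0 (leq_trans _ nm)//.
  rewrite -mxrank_tr -subn_gt0 -mxrank_ker lt0n mxrank_eq0.
  apply: contraNneq c0 => k0; move: cK; rewrite k0 submx0 => /eqP.
  by move/(congr1 trmx); rewrite trmxK trmx0 => ->.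
case/rowV0Pn => y /sub_kermxP yB y0; by exists y.
Qed.

Section Deflation.
Variables (R : realType) (d : nat).
Implicit Types (M N : 'M[R]_d) (v x y : 'cV[R]_d).

Definition reject v : 'M[R]_d := 1%:M - v *m v^T.

Definition deflate v M : 'M[R]_d := reject v *m M *m reject v.

Lemma rejectT v : (reject v)^T = reject v.
Proof. by rewrite /reject linearB/= trmx1 trmx_mul trmxK. Qed.

Lemma rejectE v x : reject v *m x = x - dotv v x *: v.
Proof.
rewrite mulmxBl mul1mx -mulmxA; congr (_ - _).
by apply/matrixP => i j; rewrite ord1 !mxE big_ord1 mulrC.
Qed.

Lemma quad_deflate v M x : quad (deflate v M) x = quad M (reject v *m x).
Proof. by rewrite !quadE /deflate -!mulmxA dotvMr rejectT. Qed.

Lemma dotv_reject v x : norm2 v = 1 -> dotv v (reject v *m x) = 0.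
Proof. by move=> v1; rewrite rejectE dotvBr dotvZr dotv_eq1// mulr1 subrr. Qed.

Lemma dotvv_reject v x : norm2 v = 1 ->
  dotv (reject v *m x) (reject v *m x) <= dotv x x.
Proof.
move=> v1; rewrite {1}rejectE dotvBl dotvZl dotv_reject// mulr0 subr0.
rewrite rejectE dotvBr dotvZr (dotvC x) -expr2.
by have := sqr_ge0 (dotv v x); lra.
Qed.

Lemma deflate_psd v M : psd M -> psd (deflate v M).
Proof.
move=> [MT M0]; split=> [|x]; last by rewrite quad_deflate.
by rewrite /deflate !trmx_mul rejectT MT mulmxA.
Qed.

Section Step.
Variables (M Q N QN : 'M[R]_d) (nu mu : nat -> R) (v : 'cV[R]_d) (theta e : R).
Hypotheses (MQ : eigenbasis M Q nu) (NQ : eigenbasis N QN mu).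
Hypotheses (NE : N = deflate v M) (v1 : norm2 v = 1).

Lemma deflate_top_le : (0 < d)%N -> mu 0%N <= nu 0%N.
Proof.
move=> d0; apply: (top_eigenvalue_le NQ) => // x.
rewrite NE quad_deflate; apply: le_trans (quad_le_top MQ _) _.
by rewrite ler_wpM2l ?dotvv_reject ?(eigenvalue_ge0 MQ).
Qed.

Hypothesis v_bad :
  norm2 (cut Q (fun i => nu i <= (1 - theta) * nu 0%N) v) ^+ 2 <= e.
Hypothesis e_small : e <= 1 / 2.

Lemma deflated_quad_ge : theta <= 1 ->
  (1 - theta) * (1 - e) * nu 0%N <= quad M v.
Proof.
move=> t1; have vb := v_bad; have := cut_split MQ (fun i => nu i <= (1 - theta) * nu 0%N) v.
rewrite dotv_eq1// => split1.
set P := (fun i : 'I_d => _) in split1 vb *.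
rewrite (quad_crd MQ).
apply: (@le_trans _ _ (\sum_(i < d | predC P i) ((1 - theta) * nu 0%N) * crd Q v i ^+ 2)).
  rewrite -mulr_sumr -sqr_norm2_cut mulrAC ler_wpM2l//.
    by rewrite mulr_ge0 ?(eigenvalue_ge0 MQ)// subr_ge0.
  by move: split1 vb; lra.
rewrite [leLHS]big_mkcond ler_sum// => i _; rewrite /P /= -ltNge.
case: ifPn => [/ltW h|_]; first by rewrite ler_wpM2r ?sqr_ge0.
by rewrite mulr_ge0 ?sqr_ge0 ?(eigenvalue_ge0 MQ).
Qed.

(* Removing an approximate top eigenvector shifts the spectrum by one
   position.  If the claim failed, the span of j.+1 leading eigenvectors of N
   would contain some s != 0 whose projection z = reject v *m s is parallel to
   v in the j.+1 leading coordinates of M; as z is orthogonal to v and v lies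
   almost entirely in these coordinates, z lies almost entirely in the
   remaining ones, where the quadratic form of M is too small. *)
Lemma deflate_eigenvalue_shift j (x : R) : 0 <= e ->
  x <= mu j -> x <= (1 - theta) * nu 0%N ->
  x - 2 * e * nu 0%N <= nu j.+1.
Proof.
move=> e0 xmu xnu; rewrite leNgt; apply/negP => nux.
have n0 := eigenvalue_ge0 MQ.
have en0 : 0 <= e * nu 0%N by rewrite mulr_ge0.
have x0 : 0 < x by have := n0 j.+1; move: nux en0; lra.
have jd : (j < d)%N.
  by rewrite ltnNge; apply/negP => /(eigenvalue_big NQ) mj; move: xmu; lra.
pose S := lead_cols jd QN; pose T := lead_cols jd Q.
pose low (i : 'I_d) := (j < i)%N.
have low_bad i : low i -> nu i <= (1 - theta) * nu 0%N.
  by move=> ji; have := eigenvalue_sorted MQ ji; move: nux xnu en0; lra.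
pose b := norm2 (cut Q low v); pose A := norm2 (cut Q (predC low) v).
have b2 : b ^+ 2 <= e.
  apply: le_trans v_bad; rewrite !sqr_norm2_cut [leLHS]big_mkcond [leRHS]big_mkcond.
  rewrite ler_sum// => i _; case: ifPn => [/low_bad ->//|_].
  by case: ifP; rewrite // sqr_ge0.
have AbE : A ^+ 2 + b ^+ 2 = 1 by rewrite addrC -(cut_split MQ) dotv_eq1.
have A2 : 1 / 2 <= A ^+ 2 by move: AbE b2 (e_small); lra.
have jj : (j.+1 < j.+1 + 1)%N by rewrite addn1.
(* The j + 2 unknowns are the coefficients [y] of [s] and the multiplier [al]; the j + 1 equations
   say that the leading coordinates of z - al v vanish. *)
have [w w0] := wide_kernel (col_mx (S^T *m reject v *m T) (- (v^T *m T))) jj.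
rewrite -[w in X in X -> _]hsubmxK mul_row_col; set y := lsubmx w; set al := rsubmx w.
rewrite mulmxN => /eqP; rewrite subr_eq0 => /eqP yal.
set s := S *m y^T; set z := reject v *m s.
have zlow (i : 'I_d) : (i <= j)%N -> crd Q z i = al 0 0 * crd Q v i.
  move=> ij; have ij' : (i < j.+1)%N by [].
  have -> : i = widen_ord jd (Ordinal ij') by apply: val_inj.
  rewrite -!crd_lead -/T; move/(congr1 trmx)/matrixP/(_ (Ordinal ij') 0): yal.
  rewrite !trmx_mul !trmxK rejectT -!mulmxA -/s -/z => ->.
  by rewrite [al]mx11_scalar tr_scalar_mx mulmxA mul_mx_scalar mxE !mxE eqxx mulr1n.
have s0 : s != 0.
  apply: contraNneq w0 => sE; have y0 : y = 0.
    by apply/trmx_inj; rewrite trmx0; exact: lead_cols_eq0 NQ _ _ _ sE.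
  have z0 : z = 0 by rewrite /z sE mulmx0.
  have : al 0 0 ^+ 2 * A ^+ 2 = 0.
    rewrite sqr_norm2_cut mulr_sumr big1// => i /=; rewrite -leqNgt => ij.
    by rewrite -exprMn -zlow// z0 /crd mulmx0 mxE expr0n.
  move/eqP; rewrite mulf_eq0 (gt_eqF (_ : 0 < A ^+ 2)) ?orbF; last by move: A2; lra.
  rewrite sqrf_eq0 => /eqP al0; rewrite -[w]hsubmxK -/y -/al y0 [al]mx11_scalar al0.
  by rewrite scalar_mx_is_semi_additive ?row_mx0// raddf0 row_mx0.
pose t2 := norm2 (cut Q low z) ^+ 2.
have t20 : 0 <= t2 by exact: sqr_ge0.
have vz : al 0 0 * A ^+ 2 + dotv (cut Q low v) (cut Q low z) = 0.
  rewrite -[RHS](dotv_reject s v1) -/z (dotv_crd MQ v z) [RHS](bigID low)/=.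
  rewrite [RHS]addrC dotvE; congr (_ + _).
    rewrite sqr_norm2_cut mulr_sumr; apply: eq_bigr => i /=.
    by rewrite -leqNgt => ij; rewrite zlow//; ring.
  rewrite [RHS]big_mkcond; apply: eq_bigr => i _.
  by rewrite !mxE; case: ifP; rewrite ?mulr0.
(* Orthogonality to [v] ties the head of [z] to its tail: al A^2 is minus the inner product of the
   tails of [v] and [z]. Cauchy-Schwarz with b^2 <= e and A^2 >= 1/2 bounds the weight of the head
   by 2 e times that of the tail. *)
have alA : al 0 0 ^+ 2 * A ^+ 2 <= 2 * e * t2.
  have := Cauchy_Schwarz (cut Q low v) (cut Q low z).
  rewrite -!sqr_norm2 -/b -/t2 (_ : dotv _ _ = - (al 0 0 * A ^+ 2)); last by move: vz; lra.
  rewrite sqrrN exprMn => h.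
  have h1 : b ^+ 2 * t2 <= e * t2 by rewrite ler_wpM2r.
  have h2 : al 0 0 ^+ 2 * A ^+ 2 * (1 / 2) <= al 0 0 ^+ 2 * A ^+ 2 * A ^+ 2.
    by rewrite ler_wpM2l// mulr_ge0 ?sqr_ge0.
  by move: h h1 h2; rewrite (expr2 (A ^+ 2)) mulrA; lra.
have quad_hi : quad M z <= (2 * e * nu 0%N + nu j.+1) * t2.
  rewrite (quad_crd MQ) (bigID low)/= addrC mulrDl; apply: lerD.
    apply: (@le_trans _ _ (nu 0%N * (al 0 0 ^+ 2 * A ^+ 2))).
      rewrite sqr_norm2_cut !mulr_sumr ler_sum// => i /=; rewrite -leqNgt => ij.
      rewrite zlow// exprMn; apply: ler_wpM2r (eigenvalue_le0 MQ i).
      exact: mulr_ge0 (sqr_ge0 _) (sqr_ge0 _).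
    have := ler_wpM2l (n0 0%N) alA; lra.
  rewrite /t2 sqr_norm2_cut mulr_sumr ler_sum// => i ij.
  by rewrite ler_wpM2r ?sqr_ge0 ?(eigenvalue_sorted MQ).
have quad_lo : x * dotv s s <= quad M z.
  rewrite -quad_deflate -NE; apply: le_trans (quad_lead_ge NQ jd _).
  by rewrite ler_wpM2r ?dotvv_ge0.
have ts : t2 <= dotv s s.
  apply: le_trans (dotvv_reject s v1); rewrite -/z -sqr_norm2 /t2.
  by rewrite lerXn2r ?nnegrE ?norm2_ge0 ?(norm2_cut_le MQ).
have ss : 0 < x * dotv s s by rewrite mulr_gt0 ?dotvv_gt0.
have := le_trans quad_lo quad_hi; have := ler_wpM2l (ltW x0) ts.
have [t20'|t2_gt0] := eqVneq t2 0; first by rewrite t20' !mulr0; move: ss; lra.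
have : 0 < (x - 2 * e * nu 0%N - nu j.+1) * t2.
  by rewrite mulr_gt0 ?subr_gt0// lt_neqAle eq_sym t2_gt0.
by move: ss; lra.
Qed.

End Step.

(* Courant-Fischer: the s.+1 leading eigenvectors of M meet the kernel of V^T. *)
Lemma compression_eigenvalue_ge M Q nu N QN mu s (V : 'M[R]_(d, s)) :
  eigenbasis M Q nu -> eigenbasis N QN mu -> (s < d)%N ->
  (forall y, V^T *m y = 0 -> quad N y = quad M y) -> nu s <= mu 0%N.
Proof.
move=> MQ NQ sd NE; pose T := lead_cols sd Q.
have [y y0 yV] := wide_kernel (T^T *m V) (ltnSn s).
have Vx : V^T *m (T *m y^T) = 0.
  by apply/trmx_inj; rewrite trmx0 !trmx_mul !trmxK -mulmxA.
set x := T *m y^T in Vx.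
have xx : 0 < dotv x x.
  rewrite dotvv_gt0; apply: contraNneq y0 => xE.
  by apply/eqP/trmx_inj; rewrite trmx0; exact: lead_cols_eq0 MQ _ _ _ xE.
have := quad_lead_ge MQ sd y^T; rewrite -/T -/x -(NE x)// => h.
by have := le_trans h (quad_le_top NQ x); rewrite ler_pM2r.
Qed.

(* A kernel vector of M in the span of V costs no dimension, because it is
   orthogonal to the eigenvectors with positive eigenvalues. *)
Lemma compression_kernel_eigenvalue M Q nu N QN mu k (V : 'M[R]_(d, k))
    (c : 'cV[R]_k) j :
  eigenbasis M Q nu -> eigenbasis N QN mu ->
  (forall y, V^T *m y = 0 -> quad N y = quad M y) ->
  (0 < k)%N -> c != 0 -> M *m (V *m c) = 0 ->
  0 < nu (j + k).-1 -> nu (j + k).-1 <= mu j.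
Proof.
move=> MQ NQ NE k0 c0 Mc nujk.
have jk : (j + k).-1.+1 = (j + k)%N by rewrite prednK// addn_gt0 k0 orbT.
have jkd : ((j + k).-1.+1 <= d)%N.
  by rewrite leqNgt ltnS; apply/negP => /(eigenvalue_big MQ) h; move: nujk; rewrite h ltxx.
have jd : (j <= d)%N by apply: leq_trans jkd; rewrite jk leq_addr.
pose T := lead_cols jkd Q; pose TN := lead_cols jd QN.
(* This vector lies in the right kernel of the square matrix below, which therefore has a left
   kernel too: some combination of eigenvectors of [M] is orthogonal to the columns of [V] and to
   [j] leading eigenvectors of [N], although there are as many conditions as unknowns. *)
pose c' : 'cV[R]_(k + j) := col_mx c 0.
have c'0 : c' != 0.
  apply: contraNneq c0 => h.
  by rewrite -(col_mxKu c (0 : 'cV[R]_j)) -/c' h linear0.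
have Tc : row_mx (T^T *m V) (T^T *m TN) *m c' = 0.
  rewrite mul_row_col mulmx0 addr0 -mulmxA; apply/matrixP => i a; rewrite ord1 crd_lead mxE.
  have := crdM MQ (V *m c) (widen_ord jkd i); rewrite Mc {1}/crd mulmx0 mxE => /esym/eqP.
  rewrite mulf_eq0 => /orP[|/eqP//]; rewrite gt_eqF//.
  apply: lt_le_trans nujk (eigenvalue_sorted MQ _).
  by rewrite /= -ltnS ltn_ord.
have kjm : (k + j <= (j + k).-1.+1)%N by rewrite jk addnC.
have [y y0] := singular_left_kernel kjm c'0 Tc.
rewrite mul_mx_row => /(congr1 (fun B => (lsubmx B, rsubmx B))).
rewrite row_mxKl row_mxKr !linear0 => -[yV yN].
set x := T *m y^T.
have Vx : V^T *m x = 0 by apply/trmx_inj; rewrite trmx0 !trmx_mul !trmxK -mulmxA.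
have Nx : TN^T *m x = 0 by apply/trmx_inj; rewrite trmx0 !trmx_mul !trmxK -mulmxA.
have xx : 0 < dotv x x.
  rewrite dotvv_gt0; apply: contraNneq y0 => xE.
  by apply/eqP/trmx_inj; rewrite trmx0; exact: lead_cols_eq0 MQ _ _ _ xE.
have := quad_lead_ge MQ jkd y^T; rewrite -/T -/x -(NE x)// => h.
have /(le_trans h) : quad N x <= mu j * dotv x x.
  apply: (quad_tail_le NQ) => i ij.
  have -> : i = widen_ord jd (Ordinal ij) by apply: val_inj.
  by rewrite -crd_lead -/TN Nx mxE.
by rewrite ler_pM2r.
Qed.

End Deflation.

Section ProjectedVector.
Variables (R : realType) (d : nat) (N Q P : 'M[R]_d) (nu : nat -> R).
Hypotheses (NQ : eigenbasis N Q nu) (PT : P^T = P) (PP : P *m P = P).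
Hypothesis NP : N *m P = N.

Lemma dotvv_proj x : dotv (P *m x) (P *m x) <= dotv x x.
Proof.
have h : dotv (P *m x) (x - P *m x) = 0.
  by rewrite dotvMl PT mulmxBr mulmxA PP subrr dotv0r.
have := dotvv_ge0 (x - P *m x); move: h.
rewrite !(dotvBl, dotvBr) (dotvC x (P *m x)).
by move: (dotv x x) (dotv _ _) (dotv _ _) => a b c; lra.
Qed.

Lemma crd_proj x (i : 'I_d) : 0 < nu i -> crd Q (P *m x) i = crd Q x i.
Proof.
move=> n0; apply: (mulfI (lt0r_neq0 n0)).
by rewrite -!(crdM NQ) mulmxA NP.
Qed.

(** Since N P = N, the projection leaves the coordinates with positive eigenvalue untouched, in
    particular all good ones. The projected vector thus keeps squared norm at least 1/2, and
    normalizing at most doubles the bad weight. *)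
Lemma normalize_proj_spec (theta e : R) v : theta < 1 -> 0 < nu 0%N -> e <= 1 ->
  norm2 v = 1 ->
  norm2 (cut Q (fun i => nu i <= (1 - theta) * nu 0%N) v) ^+ 2 <= e / 2 ->
  let w := normalize (P *m v) in
  [/\ norm2 w = 1, P *m w = w &
      norm2 (cut Q (fun i => nu i <= (1 - theta) * nu 0%N) w) ^+ 2 <= e].
Proof.
move=> t1 n0 e1 v1 vb w; set B := (fun i : 'I_d => _) in vb *.
have good : norm2 (cut Q (predC B) (P *m v)) ^+ 2 =
    norm2 (cut Q (predC B) v) ^+ 2.
  rewrite !sqr_norm2_cut; apply: eq_bigr => i; rewrite /B /= -ltNge => h.
  by rewrite crd_proj// (lt_trans _ h)// mulr_gt0// subr_gt0.
have := cut_split NQ B v; rewrite dotv_eq1// => sv.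
have := cut_split NQ B (P *m v); rewrite good => sPv.
have := dotvv_proj v; rewrite (dotv_eq1 v1) => Pv1.
have b0 := sqr_ge0 (norm2 (cut Q B (P *m v))).
have Pv : 1 / 2 <= dotv (P *m v) (P *m v) by lra.
have Pv0 : P *m v != 0 by rewrite -dotvv_gt0; lra.
split; first exact: normalize_norm2.
  by rewrite /w /normalize -scalemxAr mulmxA PP.
rewrite cutZ norm2Z exprMn real_normK ?num_real// exprVn sqr_norm2 mulrC.
rewrite ler_pdivrMr; last by lra.
apply: (@le_trans _ _ (e / 2)); first by lra.
have : e * (1 / 2) <= e * dotv (P *m v) (P *m v); last by lra.
by rewrite ler_wpM2l//; have := sqr_ge0 (norm2 (cut Q B v)); lra.
Qed.

End ProjectedVector.

Section DeflationSequence.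
Variables (R : realType) (d k : nat) (M : 'M[R]_d) (v : nat -> 'cV[R]_d).
Variables (N P Q : nat -> 'M[R]_d) (nu : nat -> nat -> R).
Hypotheses (N0 : N 0%N = M) (P0 : P 0%N = 1%:M).
Hypothesis NS : forall s, N s.+1 = deflate (v s) (N s).
Hypothesis PS : forall s, P s.+1 = P s - v s *m (v s)^T.

Definition basis_mx s : 'M[R]_(d, s) := \matrix_(i, j) v j i 0.
Local Notation V := basis_mx.

Lemma basis_mx_gram s : V s *m (V s)^T = \sum_(i < s) v i *m (v i)^T.
Proof.
apply/matrixP => a b; rewrite !mxE summxE; apply: eq_bigr => i _.
by rewrite !mxE big_ord1 !mxE.
Qed.

Lemma proj_basis s : P s = 1%:M - V s *m (V s)^T.
Proof.
rewrite basis_mx_gram; elim: s => [|s IH]; first by rewrite big_ord0 subr0.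
by rewrite PS IH big_ord_recr/= opprD addrA.
Qed.

Lemma proj_sym s : (P s)^T = P s.
Proof. by rewrite proj_basis linearB/= trmx1 trmx_mul trmxK. Qed.

Variable m : nat.
Hypothesis v1 : forall s, (s < m)%N -> norm2 (v s) = 1.
Hypothesis Pv : forall s, (s < m)%N -> P s *m v s = v s.

Lemma proj_reject s : (s < m)%N -> P s.+1 = P s *m reject (v s).
Proof.
by move=> sm; rewrite PS /reject mulmxBr mulmx1 mulmxA Pv.
Qed.

Lemma reject_proj s : (s < m)%N -> P s.+1 = reject (v s) *m P s.
Proof.
move=> sm; rewrite -[LHS]proj_sym proj_reject// trmx_mul rejectT.
by rewrite proj_sym.
Qed.

Lemma proj_idem s : (s <= m)%N -> P s *m P s = P s.
Proof.
elim: s => [|s IH] sm; first by rewrite P0 mulmx1.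
rewrite {1}reject_proj// proj_reject// -!mulmxA (mulmxA (P s)) IH 1?ltnW//.
rewrite mulmxA -reject_proj// proj_reject// -mulmxA; congr (_ *m _).
rewrite /reject mulmxBr mulmx1 mulmxBl mul1mx mulmxA -(mulmxA (v s) _ (v s)).
have -> : (v s)^T *m v s = 1%:M.
  by rewrite [LHS]mx11_scalar; congr _%:M; exact: dotv_eq1 (v1 sm).
by rewrite mulmx1 subrr subr0.
Qed.

Lemma deflation_proj s : (s <= m)%N -> N s = P s *m M *m P s.
Proof.
elim: s => [|s IH] sm; first by rewrite N0 P0 mul1mx mulmx1.
rewrite NS /deflate IH 1?ltnW// {1}reject_proj// proj_reject//.
by rewrite !mulmxA.
Qed.

Lemma deflation_mulP s : (s <= m)%N -> N s *m P s = N s.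
Proof. by move=> sm; rewrite deflation_proj// -mulmxA proj_idem. Qed.

Lemma proj_killed i s : (i < s <= m)%N -> P s *m v i = 0.
Proof.
elim: s => // s IH /andP[]; rewrite ltnS leq_eqVlt => /predU1P[->|is_] sm.
  rewrite proj_reject// -mulmxA rejectE dotv_eq1 ?v1// scale1r subrr.
  by rewrite mulmx0.
by rewrite reject_proj// -mulmxA IH ?is_ 1?ltnW// mulmx0.
Qed.

Lemma dotv_basis i j : (i < m)%N -> (j < m)%N -> dotv (v i) (v j) = (i == j)%:R.
Proof.
have lt a b : (a < b)%N -> (b < m)%N -> dotv (v a) (v b) = 0.
  move=> ab bm; rewrite -(Pv bm) dotvMr proj_sym proj_killed ?ab 1?ltnW//.
  by rewrite dotv0l.
move=> im jm; case: ltngtP => [ij|ji|<-]; last by rewrite dotv_eq1 ?v1.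
- exact: lt.
- by rewrite dotvC lt.
Qed.

Lemma basis_mxTK s : (s <= m)%N -> (V s)^T *m V s = 1%:M.
Proof.
move=> sm; apply/matrixP => i j; rewrite !mxE.
rewrite -(val_eqE i j) -dotv_basis ?(leq_trans (ltn_ord _))// dotvE.
by apply: eq_bigr => a _; rewrite !mxE.
Qed.

Lemma deflation_quad s y : (s <= m)%N -> (V s)^T *m y = 0 ->
  quad (N s) y = quad M y.
Proof.
move=> sm Vy; have Py : P s *m y = y.
  by rewrite proj_basis mulmxBl mul1mx -mulmxA Vy mulmx0 subr0.
by rewrite !quadE deflation_proj// -!mulmxA dotvMr proj_sym Py.
Qed.

Lemma deflation_quad_basis s : (s < m)%N -> quad M (v s) = quad (N s) (v s).
Proof.
move=> sm; rewrite !quadE (deflation_proj (ltnW sm)) -!mulmxA.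
by rewrite [RHS]dotvMr proj_sym !Pv.
Qed.

End DeflationSequence.

(** * Spectrum after several approximate deflations *)

Section ApproximateDeflation.
Variables (R : realType) (d k : nat) (M : 'M[R]_d) (v : nat -> 'cV[R]_d).
Variables (N P Q : nat -> 'M[R]_d) (nu : nat -> nat -> R) (eps e : R).
Hypotheses (N0 : N 0%N = M) (P0 : P 0%N = 1%:M).
Hypothesis NS : forall s, N s.+1 = deflate (v s) (N s).
Hypothesis PS : forall s, P s.+1 = P s - v s *m (v s)^T.
Hypothesis v1 : forall s, (s < k)%N -> norm2 (v s) = 1.
Hypothesis Pv : forall s, (s < k)%N -> P s *m v s = v s.
Hypothesis NQ : forall s, eigenbasis (N s) (Q s) (nu s).
Local Notation theta := (eps / 6).
Hypothesis v_bad : forall s, (s < k)%N ->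
  norm2 (cut (Q s) (fun i => nu s i <= (1 - theta) * nu s 0%N) (v s)) ^+ 2 <= e.
Hypotheses (k_gt0 : (0 < k)%N) (kd : (k < d)%N).
Hypotheses (eps03 : 0 < eps < 3) (e_ge0 : 0 <= e) (e_small : e <= eps / 100).
Local Notation lam := (nu 0%N).
Local Notation eta := (2 * e * lam 0%N).
Hypothesis lamk_gt0 : 0 < lam k.
Hypothesis eta_small : d%:R * (k%:R * eta) <= eps / 100 * lam k.

Let eta_ge0 : 0 <= eta.
Proof. by rewrite !mulr_ge0// (eigenvalue_ge0 (NQ 0)). Qed.

Let e_half : e <= 1 / 2.
Proof. by have := e_small; have := eps03; lra. Qed.

Let theta01 : 0 <= 1 - theta <= 1.
Proof. by have := eps03; lra. Qed.

Lemma top_eigenvalue_antitone s t : (s <= t)%N -> (t <= k)%N ->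
  nu t 0%N <= nu s 0%N.
Proof.
elim: t => [|t IH]; first by rewrite leqn0 => /eqP ->.
rewrite leq_eqVlt => /predU1P[->//|]; rewrite ltnS => st tk.
apply: le_trans (IH st (ltnW tk)).
exact: deflate_top_le (NQ t) (NQ t.+1) (NS t) (v1 tk) (leq_ltn_trans (leq0n k) kd).
Qed.

(** Going back one round raises the index by one and costs [eta]. The cap on [x] needs no new loss:
    the top eigenvalue of an earlier round is at least as large. *)
Lemma deflation_shift s i j x : (i <= s <= k)%N ->
  x <= nu s j -> x <= (1 - theta) * nu s 0%N ->
  x - i%:R * eta <= nu (s - i)%N (j + i)%N.
Proof.
elim: i => [|i IH] /andP[is_ sk] xs xt.
  by rewrite mul0r subr0 subn0 addn0.
have {}IH : x - i%:R * eta <= nu (s - i.+1).+1 (j + i).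
  by rewrite subnSK//; apply: IH; rewrite // (ltnW is_).
have sik : (s - i.+1 < k)%N by rewrite (leq_trans _ sk)// subnSK// leq_subr.
have i0 : 0 <= i%:R * eta by rewrite mulr_ge0.
have top : nu s 0%N <= nu (s - i.+1)%N 0%N.
  exact: top_eigenvalue_antitone (leq_subr _ _) sk.
have xt' : x - i%:R * eta <= (1 - theta) * nu (s - i.+1)%N 0%N.
  have /andP[t0 _] := theta01.
  by have := ler_wpM2l t0 top; move: i0 xt; lra.
have := deflate_eigenvalue_shift (NQ _) (NQ _) (NS _) (v1 sik) (v_bad sik) e_half
  e_ge0 IH xt'.
have : 2 * e * nu (s - i.+1)%N 0%N <= eta.
  by rewrite ler_wpM2l ?mulr_ge0// top_eigenvalue_antitone// ltnW.
by rewrite addnS -natr1; lra.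
Qed.

Lemma deflation_eigenvalue_le s j : (s <= k)%N ->
  (1 - theta) * nu s j - s%:R * eta <= lam (j + s)%N.
Proof.
move=> sk; have /andP[t0 t1] := theta01; rewrite -[X in nu X (j + s)%N](subnn s).
apply: deflation_shift; rewrite ?leqnn//.
  by rewrite -[leRHS]mul1r ler_wpM2r// (eigenvalue_ge0 (NQ s)).
by rewrite ler_wpM2l// (eigenvalue_le0 (NQ s)).
Qed.

Lemma top_eigenvalue_ge s : (s <= k)%N -> lam s <= nu s 0%N.
Proof.
move=> sk; have NQ0 := NQ 0; rewrite N0 in NQ0.
apply: (compression_eigenvalue_ge (V := basis_mx v s) NQ0 (NQ s)).
  exact: leq_ltn_trans sk kd.
by move=> y; exact: (deflation_quad N0 P0 NS PS Pv sk).
Qed.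

Let keta : k%:R * eta <= eps / 100 * lam k.
Proof.
apply: le_trans eta_small; rewrite -[leLHS]mul1r.
apply: ler_wpM2r; first exact: mulr_ge0.
by rewrite ler1n (leq_ltn_trans _ kd).
Qed.

Lemma residual_top : nu k 0%N <= (1 + eps) ^+ 2 * lam k.
Proof.
have := deflation_eigenvalue_le 0 (leqnn k); rewrite add0n.
have := keta; have := eps03; have := lamk_gt0 => l0 ep ke h.
have : (1 - eps / 6) * nu k 0%N <= (1 - eps / 6) * ((1 + eps) ^+ 2 * lam k).
  apply: (@le_trans _ _ ((1 + eps / 100) * lam k)); first by lra.
  rewrite mulrA ler_wpM2r ?(ltW l0)//.
  (* Nonnegative products from which 1 + eps / 100 <= (1 - eps / 6) (1 + eps)^2 follows linearly on
     (0, 3). *)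
  have : 0 <= eps * (3 - eps) by rewrite mulr_ge0; lra.
  have : 0 <= eps * eps by rewrite mulr_ge0; lra.
  have : 0 <= eps * eps * (3 - eps) by rewrite !mulr_ge0; lra.
  by rewrite expr2; lra.
by rewrite ler_pM2l//; lra.
Qed.

(** The Frobenius bound brings [d] into the accuracy: each of the [d] eigenvalues of the residual
    has additive error k eta, and their total must be small against [lam k], a term of the optimal
    tail. *)
Lemma residual_trace :
  \sum_(j < d) nu k j <= (1 + eps) ^+ 2 * \sum_(k <= i < d) lam i.
Proof.
have lam0 i := eigenvalue_ge0 (NQ 0) i.
set T := \sum_(k <= i < d) _.
have TE : \sum_(j < d) lam (j + k)%N = T.
  rewrite -(big_mkord xpredT (fun j => lam (j + k)%N)).
  rewrite (big_cat_nat _ (n := (d - k)%N)) ?leq_subr//= [X in _ + X]big1_seq ?addr0.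
    by rewrite -(big_addn 0 d k xpredT (fun i => lam i)) add0n.
  move=> i /andP[_]; rewrite mem_index_iota => /andP[ki _].
  by rewrite (eigenvalue_big (NQ 0))// addnC -leq_subLR.
have lamT : lam k <= T.
  by rewrite /T big_ltn// lerDl sumr_ge0.
have h : \sum_(j < d) ((1 - theta) * nu k j - k%:R * eta) <= T.
  by rewrite -TE ler_sum// => j _; exact: deflation_eigenvalue_le.
rewrite sumrB -mulr_sumr sumr_const card_ord -mulr_natl in h.
have := eta_small; have := eps03; have l0 := lamk_gt0 => ep ke.
have : (1 - eps / 6) * \sum_(j < d) nu k j <= (1 - eps / 6) * ((1 + eps) ^+ 2 * T).
  apply: (@le_trans _ _ ((1 + eps / 100) * T)).
    have : eps / 100 * lam k <= eps / 100 * T by rewrite ler_wpM2l//; lra.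
    by lra.
  rewrite mulrA ler_wpM2r//; first by lra.
  have : 0 <= eps * (3 - eps) by rewrite mulr_ge0; lra.
  have : 0 <= eps * eps by rewrite mulr_ge0; lra.
  have : 0 <= eps * eps * (3 - eps) by rewrite !mulr_ge0; lra.
  by rewrite expr2; lra.
by rewrite ler_pM2l//; lra.
Qed.

(** From below, [v s] nearly attains the top eigenvalue of its round, which is at least [lam s] by
    Courant-Fischer. From above, that top eigenvalue is bounded by the spectral shift. *)
Lemma rayleigh_quotient s : (s < k)%N ->
  `|quad M (v s) - lam s| <= eps * lam s.
Proof.
move=> sk; rewrite (deflation_quad_basis N0 P0 NS PS Pv sk).
have lo := deflated_quad_ge (NQ s) (v1 sk) (v_bad sk).
have hi := quad_le_top (NQ s) (v s); rewrite (dotv_eq1 (v1 sk)) mulr1 in hi.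
have top_lo := top_eigenvalue_ge (ltnW sk).
have top_hi := deflation_eigenvalue_le 0 (ltnW sk); rewrite add0n in top_hi.
have ls : lam k <= lam s by rewrite (eigenvalue_sorted (NQ 0))// ltnW.
have se : s%:R * eta <= eps / 100 * lam s.
  apply: le_trans (le_trans keta _); first by rewrite ler_wpM2r// ler_nat ltnW.
  by rewrite ler_wpM2l//; have := eps03; lra.
have l0 : 0 < lam s by apply: lt_le_trans ls.
have ep := eps03; have es := e_small; have e0 := e_ge0.
have {}lo : (1 - eps) * lam s <= quad (N s) (v s).
  apply: le_trans (lo _); last by lra.
  have : 0 <= (1 - eps / 6) * (1 - e) by rewrite mulr_ge0//; lra.
  move=> /ler_wpM2l/(_ _ _ top_lo); apply: le_trans.
  rewrite ler_wpM2r ?(ltW l0)//.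
  have : 0 <= eps / 6 * e by rewrite mulr_ge0//; lra.
  by lra.
have {}hi : quad (N s) (v s) <= (1 + eps) * lam s.
  apply: le_trans hi _.
  have : (1 - eps / 6) * nu s 0%N <= (1 - eps / 6) * ((1 + eps) * lam s).
    apply: (@le_trans _ _ ((1 + eps / 100) * lam s)); first by lra.
    rewrite mulrA ler_wpM2r ?(ltW l0)//.
    have : 0 <= eps * (3 - eps) by rewrite mulr_ge0; lra.
    by lra.
  by rewrite ler_pM2l//; lra.
by rewrite ler_norml; lra.
Qed.

(* If M were singular on the span of v, the eigenvalues of M from position k on
   could only decrease by k * eta at each step, and would not reach 0. *)
Lemma basis_nonsingular (c : 'cV[R]_k) : M *m (basis_mx v k *m c) = 0 -> c = 0.
Proof.
move=> Mc; apply/eqP/negPn/negP => c0.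
have NQ0 := NQ 0; rewrite N0 in NQ0.
have ep := eps03; have l0 := lamk_gt0; have es := eta_small.
have ke0 : 0 <= k%:R * eta by rewrite mulr_ge0.
(* Starting at lam k / 2 keeps the level under the cap, since eps / 6 < 1/2 and the top eigenvalue
   of round [k] is at least [lam k]; [d] steps of size k eta then cannot exhaust it. *)
pose low i := lam k / 2 - i%:R * (k%:R * eta).
have low_gt0 i : (i <= d)%N -> 0 < low i.
  move=> id; have : i%:R * (k%:R * eta) <= d%:R * (k%:R * eta).
    by rewrite ler_wpM2r// ler_nat.
  have : eps / 100 * lam k < 1 / 2 * lam k by rewrite ltr_pM2r//; lra.
  by rewrite /low; lra.
have low_le i : low i <= lam k / 2.
  by rewrite /low lerBlDr lerDl mulr_ge0.
have step i : (i <= d)%N -> low i <= lam (i + k).-1.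
  elim: i => [_|i IH id].
    rewrite add0n /low mul0r subr0; apply: (@le_trans _ _ (lam k)); first by lra.
    by rewrite (eigenvalue_sorted (NQ 0))// leq_pred.
  have {}IH := IH (ltnW id).
  have pos := lt_le_trans (low_gt0 i (ltnW id)) IH.
  have := compression_kernel_eigenvalue NQ0 (NQ k)
    (fun y => deflation_quad N0 P0 NS PS Pv (y := y) (leqnn k)) k_gt0 c0 Mc pos.
  move=> /(le_trans IH) lowk.
  have lowt : low i <= (1 - theta) * nu k 0%N.
    have := top_eigenvalue_ge (leqnn k); have := low_le i.
    have : (1 / 2) * nu k 0%N <= (1 - theta) * nu k 0%N.
      by rewrite ler_wpM2r ?(eigenvalue_ge0 (NQ k))//; lra.
    by lra.
  have kk : (k <= k <= k)%N by rewrite leqnn.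
  have := deflation_shift kk lowk lowt.
  by rewrite subnn addSn /=; apply: le_trans; rewrite /low -natr1; lra.
(* Because k >= 1, the index (d + k) - 1 is at least [d], where the eigenvalue is 0. *)
have := step d (leqnn d); have := low_gt0 d (leqnn d).
rewrite (eigenvalue_big (NQ 0)); first by lra.
by rewrite -ltnS prednK ?addn_gt0 ?k_gt0 ?orbT// -addn1 leq_add2l.
Qed.

End ApproximateDeflation.

(** * Residual norms *)

Section MatrixNorms.
Variable R : realType.

Lemma sqr_frobenius m n (B : 'M[R]_(m, n)) : frobenius B ^+ 2 = \tr (B *m B^T).
Proof.
rewrite sqr_sqrtr => [|]; last first.
  by rewrite sumr_ge0// => i _; rewrite sumr_ge0// => j _; rewrite sqr_ge0.
apply: eq_bigr => i _; rewrite mxE; apply: eq_bigr => j _.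
by rewrite mxE.
Qed.

Lemma norm2_mulmx_le m n (B : 'M[R]_(m, n)) x :
  norm2 (B *m x) <= frobenius B * norm2 x.
Proof.
rewrite -(ler_pXn2r (n := 2))//= ?nnegrE ?mulr_ge0 ?norm2_ge0 ?sqrtr_ge0//.
rewrite exprMn !sqr_norm2 dotvvE /frobenius sqr_sqrtr; last first.
  by rewrite sumr_ge0// => i _; rewrite sumr_ge0// => j _; rewrite sqr_ge0.
rewrite mulr_suml ler_sum// => i _.
have -> : (B *m x) i 0 = dotv (row i B)^T x.
  by rewrite dotvE mxE; apply: eq_bigr => j _; rewrite !mxE.
apply: le_trans (Cauchy_Schwarz _ _) _; rewrite ler_wpM2r ?dotvv_ge0//.
by rewrite dotvvE le_eqVlt; apply/orP; left; apply/eqP/eq_bigr => j _; rewrite !mxE.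
Qed.

Lemma spectral_norm_ge m n (B : 'M[R]_(m, n)) x : norm2 x <= 1 ->
  norm2 (B *m x) <= spectral_norm B.
Proof.
move=> x1; apply: ub_le_sup; last by exists x.
exists (frobenius B) => _ [y y1 <-]; apply: le_trans (norm2_mulmx_le _ _) _.
by rewrite -[leRHS]mulr1 ler_wpM2l// sqrtr_ge0.
Qed.

(** Stated through B B^T because for the residual A - A_k this product is the deflated matrix. With
    y = B x one has |y|^2 <= |B^T y| |x| <= c |y|. *)
Lemma spectral_norm_gram m n (B : 'M[R]_(m, n)) c : 0 <= c ->
  (forall y, quad (B *m B^T) y <= c ^+ 2 * dotv y y) -> spectral_norm B <= c.
Proof.
move=> c0 h; apply: ge_sup.
  by exists (norm2 (B *m 0)); exists 0 => //=; rewrite norm2E dotv0l sqrtr0.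
move=> _ [x x1 <-]; set y := B *m x.
have yE : norm2 y ^+ 2 <= norm2 (B^T *m y) * norm2 x.
  rewrite sqr_norm2 {1}/y dotvMl dotvC; exact: le_trans (ler_norm _) (dotv_le _ _).
have By : norm2 (B^T *m y) <= c * norm2 y.
  rewrite -(ler_pXn2r (n := 2))//= ?nnegrE ?mulr_ge0 ?norm2_ge0//.
  by rewrite exprMn !sqr_norm2 -quad_gram h.
have [y0|y0] := eqVneq (norm2 y) 0; first by rewrite y0.
have yp : 0 < norm2 y by rewrite lt_neqAle eq_sym y0 norm2_ge0.
rewrite -(ler_pM2r yp) -expr2; apply: le_trans yE _.
by rewrite -[leRHS]mulr1; apply: ler_pM; rewrite ?norm2_ge0.
Qed.

Lemma norm2_orthogonal n (Q : 'M[R]_n) x : orthogonal_mx Q -> norm2 (Q *m x) = norm2 x.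
Proof.
by move=> /orthogonal_mxC QQ; rewrite !norm2E dotvMl mulmxA QQ mul1mx.
Qed.

Section TruncatedSVD.
Variables (d n k : nat) (A : 'M[R]_(d, n)) (U : 'M[R]_d) (sigma : nat -> R).
Variable W : 'M[R]_n.
Hypotheses (svdA : is_svd A U sigma W) (kd : (k < d)%N) (kn : (k < n)%N).

Lemma svd_tail : A - truncated_svd U sigma W k =
  U *m rect_diag d n (fun i => if (i < k)%N then 0 else sigma i) *m W^T.
Proof.
case: svdA => _ _ _ _ ->; rewrite /truncated_svd -mulmxBl -mulmxBr.
congr (_ *m _ *m _); apply/matrixP => i j; rewrite !mxE.
by have [//|_] := eqVneq (nat_of_ord i) j; rewrite ?subrr//; case: ltnP; rewrite ?subrr ?subr0.
Qed.

Lemma svd_tail_spectral : sigma k <= spectral_norm (A - truncated_svd U sigma W k).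
Proof.
have [UU WW sorted _ _] := svdA; rewrite svd_tail.
pose x : 'cV[R]_n := W *m delta_mx (Ordinal kn) 0.
have x1 : norm2 x <= 1.
  rewrite norm2_orthogonal// norm2E dotvvE (bigD1 (Ordinal kn))//= mxE !eqxx.
  rewrite big1 ?addr0 ?expr1n ?sqrtr1// => i ik.
  by rewrite mxE (negbTE ik) expr0n.
apply: le_trans (spectral_norm_ge _ x1).
rewrite -mulmxA /x (mulmxA W^T) (orthogonal_mxC WW) mul1mx -mulmxA.
rewrite norm2_orthogonal// norm2E.
rewrite -[leLHS]ger0_norm; last by have /andP[] := sorted _ _ (leqnn k).
rewrite -sqrtr_sqr dotvvE.
rewrite ler_sqrt; last by rewrite sumr_ge0// => i _; rewrite sqr_ge0.
rewrite (bigD1 (Ordinal kd))//= -colE !mxE eqxx ltnn lerDl.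
by rewrite sumr_ge0// => i _; rewrite sqr_ge0.
Qed.

Lemma svd_tail_frobenius :
  frobenius (A - truncated_svd U sigma W k) ^+ 2 = \sum_(k <= i < d) sigma i ^+ 2.
Proof.
have [UU WW sorted big _] := svdA; rewrite sqr_frobenius svd_tail svd_gram//.
  rewrite mxtrace_mulC mulmxA (orthogonal_mxC UU) mul1mx mxtrace_diag.
  rewrite (eq_bigr (fun i : 'I_d => (if (i < k)%N then 0 else sigma i) ^+ 2)).
    rewrite -(big_mkord xpredT (fun i => (if (i < k)%N then 0 else sigma i) ^+ 2)).
    rewrite (big_cat_nat (leq0n k) (ltnW kd))/= [X in X + _]big_nat big1.
      rewrite add0r !big_nat; apply: eq_bigr => i /andP[ki _].
      by rewrite ltnNge ki.
    by move=> i /andP[_ ->]; rewrite expr0n.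
  by move=> i _; rewrite mxE.
by move=> i ni; case: ifP => // _; rewrite big// geq_min ni orbT.
Qed.

Variables (V : 'M[R]_(d, k)) (N QN : 'M[R]_d) (mu : nat -> R) (eps : R).
Hypothesis NE : N = (1%:M - V *m V^T) *m (A *m A^T) *m (1%:M - V *m V^T).
Hypotheses (NQ : eigenbasis N QN mu) (eps0 : 0 <= eps).

Let residual_gram : (A - V *m V^T *m A) *m (A - V *m V^T *m A)^T = N.
Proof.
rewrite NE; have -> : A - V *m V^T *m A = (1%:M - V *m V^T) *m A.
  by rewrite mulmxBl mul1mx.
by rewrite trmx_mul linearB/= trmx1 trmx_mul trmxK !mulmxA.
Qed.

Lemma residual_spectral : mu 0%N <= (1 + eps) ^+ 2 * sigma k ^+ 2 ->
  spectral_norm (A - V *m V^T *m A) <=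
  (1 + eps) * spectral_norm (A - truncated_svd U sigma W k).
Proof.
move=> mu0; have e1 : 0 <= 1 + eps by rewrite addr_ge0.
have [_ _ sorted _ _] := svdA; have /andP[s0 _] := sorted _ _ (leqnn k).
apply: (@le_trans _ _ ((1 + eps) * sigma k)); last first.
  by rewrite ler_wpM2l// svd_tail_spectral.
apply: spectral_norm_gram => [|y]; first exact: mulr_ge0.
rewrite residual_gram exprMn; apply: le_trans (quad_le_top NQ _) _.
by rewrite ler_wpM2r ?dotvv_ge0.
Qed.

Lemma residual_frobenius :
  \sum_(j < d) mu j <= (1 + eps) ^+ 2 * \sum_(k <= i < d) sigma i ^+ 2 ->
  frobenius (A - V *m V^T *m A) <=
  (1 + eps) * frobenius (A - truncated_svd U sigma W k).
Proof.
move=> h; have e1 : 0 <= 1 + eps by rewrite addr_ge0.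
rewrite -(ler_pXn2r (n := 2))//= ?nnegrE ?mulr_ge0 ?sqrtr_ge0//.
by rewrite exprMn svd_tail_frobenius sqr_frobenius residual_gram (mxtrace_eigenbasis NQ).
Qed.

(** A vanishing combination of the rows of V^T A is a vector in the span of [V] killed by A A^T; and
    V^T V = 1 recovers V^T A from V V^T A. *)
Lemma rank_projected : V^T *m V = 1%:M ->
  (forall c : 'cV[R]_k, (A *m A^T) *m (V *m c) = 0 -> c = 0) ->
  \rank (V *m V^T *m A) = k.
Proof.
move=> VV h; apply/eqP; rewrite eqn_leq; apply/andP; split.
  rewrite -mulmxA; apply: leq_trans (mxrankM_maxl _ _) _; exact: rank_leq_col.
apply: (@leq_trans (\rank (V^T *m A))).
  rewrite leqNgt; apply/negP => rk.
  have : kermx (V^T *m A) != 0 by rewrite -mxrank_eq0 mxrank_ker -lt0n subn_gt0.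
  case/rowV0Pn => y /sub_kermxP yVA /eqP; apply; apply/trmx_inj; rewrite trmx0.
  apply: h; apply/trmx_inj; rewrite trmx0 !trmx_mul !trmxK mulmxA -(mulmxA y).
  by rewrite yVA mul0mx.
have -> : V^T *m A = V^T *m (V *m V^T *m A) by rewrite !mulmxA VV mul1mx.
exact: mxrankM_maxr.
Qed.

End TruncatedSVD.
End MatrixNorms.

(** * LazySVD with good start vectors *)

Section TopOverlap.
Variables (R : realType) (d : nat).
Implicit Types (M Q : 'M[R]_d) (w x : 'cV[R]_d).

(* For positive semidefinite M and unit w this says that the squared length of
   the projection of w on the top eigenspace of M is at least tau; unlike the
   latter condition it is visibly closed in (M, w). *)
Definition top_overlap (tau : R) M w :=
  forall n x, tau * quad (M ^+ n) x <= quad (M ^+ n) w * dotv x x.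

Variables (M Q : 'M[R]_d) (nu : nat -> R).
Hypothesis MQ : eigenbasis M Q nu.

Lemma crd_expr n x (i : 'I_d) : crd Q (M ^+ n *m x) i = nu i ^+ n * crd Q x i.
Proof.
elim: n => [|n IH]; first by rewrite mul1mx mul1r.
by rewrite exprS (_ : M * M ^+ n = M *m M ^+ n)// -mulmxA (crdM MQ) IH mulrA -exprS.
Qed.

Lemma quad_expr n x : quad (M ^+ n) x = \sum_(i < d) nu i ^+ n * crd Q x i ^+ 2.
Proof.
rewrite quadE (dotv_crd MQ); apply: eq_bigr => i _.
by rewrite crd_expr; ring.
Qed.

(** Test with a top eigenvector and divide by the n-th power of the top eigenvalue: the coordinates
    of [w] are then weighted by (nu_i / nu_0)^n, which tends to the indicator of the top
    eigenspace. *)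
Lemma top_overlap_cut tau w : 0 < nu 0%N -> top_overlap tau M w ->
  tau <= norm2 (cut Q (fun i => nu i == nu 0%N) w) ^+ 2.
Proof.
move=> n0 h; have d0 : (0 < d)%N.
  by case: (posnP d) => // d0; move: n0; rewrite (eigenvalue_big MQ) ?d0// ltxx.
pose q := lead_cols d0 Q *m (const_mx 1 : 'cV_1).
have q_other (i : 'I_d) : (0 < i)%N -> crd Q q i = 0.
  by move=> i0; apply: (crd_lead_cols MQ).
have qq : 0 < dotv q q.
  rewrite dotvv_gt0; apply/eqP => /(lead_cols_eq0 MQ)/matrixP/(_ 0 0).
  by rewrite !mxE => /eqP; rewrite oner_eq0.
have {}h n : tau <= \sum_(i < d) (nu i / nu 0%N) ^+ n * crd Q w i ^+ 2.
  have := h n q; rewrite [quad _ q]quad_expr.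
  rewrite (eq_bigr (fun i : 'I_d => nu 0%N ^+ n * crd Q q i ^+ 2)); last first.
    move=> i _; have [->//|i0] := posnP i.
    by rewrite q_other// expr0n !mulr0.
  rewrite -mulr_sumr -(dotvv_crd MQ) mulrA ler_pM2r// -ler_pdivlMr ?exprn_gt0//.
  move=> /le_trans; apply; rewrite quad_expr mulr_suml ler_sum// => i _.
  by rewrite mulrAC -expr_div_n.
have lim : (fun n => \sum_(i < d) (nu i / nu 0%N) ^+ n * crd Q w i ^+ 2) @ \oo -->
    \sum_(i < d) (nu i == nu 0%N)%:R * crd Q w i ^+ 2.
  apply: cvg_big => [|i _]; first exact: add_continuous.
  apply: cvgMr_tmp; have [->|ni] := eqVneq (nu i) (nu 0%N).
    by apply: cvg_near_cst; apply: nearW => m; rewrite divff ?gt_eqF// expr1n.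
  apply: cvg_expr; rewrite ger0_norm ?divr_ge0 ?(eigenvalue_ge0 MQ)//.
  by rewrite ltr_pdivrMr// mul1r lt_neqAle ni (eigenvalue_le0 MQ).
rewrite sqr_norm2_cut [leRHS]big_mkcond.
rewrite (eq_bigr (fun i : 'I_d => (nu i == nu 0%N)%:R * crd Q w i ^+ 2)); last first.
  by move=> i _; case: eqP; rewrite (mul1r, mul0r).
rewrite -(cvg_lim _ lim)//; apply: limr_ge; first by apply/cvg_ex; eexists; exact: lim.
by apply: nearW.
Qed.

(** One unit top eigenvector suffices: M^n is nonnegative at [w] minus its component along [q], so
    quad (M^n) w >= nu_0^n (q . w)^2, and nu_0^n bounds M^n on the other side. *)
Lemma top_overlapP tau w q : norm2 q = 1 -> M *m q = nu 0%N *: q ->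
  0 <= tau <= dotv q w ^+ 2 -> top_overlap tau M w.
Proof.
move=> q1 Mq /andP[t0 tq] n x.
have n0 := eigenvalue_ge0 MQ 0.
have nn : 0 <= nu 0%N ^+ n by rewrite exprn_ge0.
apply: (@le_trans _ _ (tau * (nu 0%N ^+ n * dotv x x))).
  rewrite ler_wpM2l// quad_expr (dotvv_crd MQ) mulr_sumr ler_sum// => i _.
  by rewrite ler_wpM2r ?sqr_ge0// lerXn2r ?nnegrE ?(eigenvalue_ge0 MQ) ?(eigenvalue_le0 MQ).
rewrite mulrA ler_wpM2r ?dotvv_ge0// mulrC.
apply: (@le_trans _ _ (nu 0%N ^+ n * dotv q w ^+ 2)); first by rewrite ler_wpM2l.
have Mqn : M ^+ n *m q = nu 0%N ^+ n *: q.
  elim: n {nn} => [|n IH]; first by rewrite mul1mx scale1r.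
  by rewrite exprS (_ : M * M ^+ n = M *m M ^+ n)// -mulmxA IH -scalemxAr Mq scalerA -exprSr.
have MnT : (M ^+ n)^T = M ^+ n.
  elim: n {nn Mqn} => [|n IH]; first exact: trmx1.
  rewrite {1}exprSr (_ : M ^+ n * M = M ^+ n *m M)// trmx_mul IH (eigenbasis_sym MQ).
  exact: esym (exprS M n).
set a := dotv q w; have : 0 <= quad (M ^+ n) (w - a *: q).
  rewrite quad_expr sumr_ge0// => i _.
  by apply: mulr_ge0; rewrite ?sqr_ge0 ?exprn_ge0 ?(eigenvalue_ge0 MQ).
rewrite -scaleNr quadDv// quadZ dotvZl.
rewrite dotvMr MnT Mqn dotvZl -/a (quadE _ q) Mqn dotvZr dotv_eq1//.
by rewrite mulr1 sqrrN expr2; lra.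
Qed.

End TopOverlap.

Section LazySVD.
Variables (R : realType) (d n k : nat).
Variable inv : nat -> nat -> nat -> R -> 'M[R]_d -> 'cV[R]_d -> R -> 'cV[R]_d.
Variables (delta eps p : R) (w0 : nat -> 'cV[R]_d) (M : 'M[R]_d).
Local Notation state := (lazy_state inv M k delta eps p w0).

Definition lazy_mx s : 'M[R]_d := (state s).2.

Definition lazy_proj s : 'M[R]_d :=
  1%:M - cols_mx s (state s).1 *m (cols_mx s (state s).1)^T.

Definition lazy_vec s : 'cV[R]_d :=
  normalize (lazy_proj s *m
    appx_pca (inv s) (lazy_mx s) (delta / 2) eps (p / k%:R) (w0 s)).

Lemma lazy_stateS s : state s.+1 =
  (rcons (state s).1 (lazy_vec s), deflate (lazy_vec s) (lazy_mx s)).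
Proof. by rewrite /lazy_vec /lazy_proj /lazy_mx /=; case: (state s). Qed.

Lemma lazy_state_basis s : (state s).1 = mkseq lazy_vec s.
Proof. by elim: s => // s IH; rewrite lazy_stateS IH mkseqS. Qed.

Lemma lazy_cols s t : (s <= t)%N -> cols_mx s (state t).1 = basis_mx lazy_vec s.
Proof.
move=> st; apply/matrixP => i j; rewrite [LHS]mxE [RHS]mxE lazy_state_basis nth_mkseq//.
exact: leq_trans (ltn_ord j) st.
Qed.

Lemma lazy_proj0 : lazy_proj 0 = 1%:M.
Proof. by rewrite /lazy_proj lazy_cols// basis_mx_gram big_ord0 subr0. Qed.

Lemma lazy_projS s : lazy_proj s.+1 = lazy_proj s - lazy_vec s *m (lazy_vec s)^T.
Proof.
rewrite /lazy_proj !lazy_cols// !basis_mx_gram big_ord_recr/=.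
by rewrite opprD addrA.
Qed.

Lemma lazy_mxS s : lazy_mx s.+1 = deflate (lazy_vec s) (lazy_mx s).
Proof. by rewrite {1}/lazy_mx lazy_stateS. Qed.

Lemma lazy_mx_psd s : psd M -> psd (lazy_mx s).
Proof. by move=> M0; elim: s => // s IH; rewrite lazy_mxS; exact: deflate_psd. Qed.

Lemma lazy_svdE : lazy_svd inv M k delta eps p w0 = basis_mx lazy_vec k.
Proof. exact: lazy_cols. Qed.

End LazySVD.

Section LazySVDCorrectness.
Variables (R : realType) (d n k : nat) (A : 'M[R]_(d, n)) (U : 'M[R]_d).
Variables (sigma : nat -> R) (W : 'M[R]_n) (eps e p : R).
Variable inv : nat -> nat -> nat -> R -> 'M[R]_d -> 'cV[R]_d -> R -> 'cV[R]_d.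
Variable w0 : nat -> 'cV[R]_d.
Hypothesis svdA : is_svd A U sigma W.
Hypotheses (sigma1 : sigma 0%N <= 1) (sigmak : 0 < sigma k).
Hypotheses (k_gt0 : (0 < k)%N) (eps03 : 0 < eps < 3) (p01 : 0 < p < 1).
Hypotheses (e0 : 0 < e) (e_small : e <= eps / 100).
Hypothesis eta_small :
  d%:R * (k%:R * (2 * e * sigma 0%N ^+ 2)) <= eps / 100 * sigma k ^+ 2.
Hypothesis inv_acc : forall r i t lam B b eta, pd (lam%:M - B) -> 0 < eta ->
  norm2 (inv r i t lam B b eta - invmx (lam%:M - B) *m b) <= eta.
Hypothesis w01 : forall s, (s < k)%N -> norm2 (w0 s) = 1.

Local Notation M := (A *m A^T).
Local Notation N := (lazy_mx k inv (eps / 3) e p w0 M).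
Local Notation P := (lazy_proj k inv (eps / 3) e p w0 M).
Local Notation v := (lazy_vec k inv (eps / 3) e p w0 M).
Local Notation r := (pca_overlap d (p / k%:R)).

Hypothesis w0_top : forall s, (s < k)%N -> top_overlap (r ^+ 2) (N s) (w0 s).

Lemma sigma_ge0 i : 0 <= sigma i.
Proof. by case: svdA => _ _ /(_ _ _ (leqnn i))/andP[]. Qed.

Lemma rank_lt : (k < minn d n)%N.
Proof.
rewrite ltnNge; apply/negP; case: svdA => _ _ _ big _ /big s0.
by move: sigmak; rewrite s0 ltxx.
Qed.

Let kd : (k < d)%N. Proof. by have := rank_lt; rewrite ltn_min => /andP[]. Qed.
Let kn : (k < n)%N. Proof. by have := rank_lt; rewrite ltn_min => /andP[]. Qed.

(* One eigenbasis per round; the first one is given by the SVD, so that its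
   eigenvalues are the squared singular values. *)
Definition lazy_eigen (Qnu : nat -> 'M[R]_d * (nat -> R)) :=
  Qnu 0%N = (U, fun i => sigma i ^+ 2) /\
  forall s, eigenbasis (N s) (Qnu s).1 (Qnu s).2.

Lemma lazy_eigen_ex : exists Qnu, lazy_eigen Qnu.
Proof.
have /choice[f fP] : forall s, exists Qnu : 'M[R]_d * (nat -> R),
    eigenbasis (N s) Qnu.1 Qnu.2.
  move=> s; have [Q [nu h]] := spectral_theorem (lazy_mx_psd k inv (eps / 3) e p w0 s (psd_gram A)).
  by exists (Q, nu).
exists (fun s => if s is 0 then (U, fun i => sigma i ^+ 2) else f s).
by split=> // -[|s]; [exact: svd_eigenbasis svdA|exact: fP].
Qed.

Variable Qnu : nat -> 'M[R]_d * (nat -> R).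
Hypothesis QnuP : lazy_eigen Qnu.
Local Notation Q s := (Qnu s).1.
Local Notation nu s := (Qnu s).2.

Let NQ s : eigenbasis (N s) (Q s) (nu s). Proof. by case: QnuP. Qed.
Let nu0E i : nu 0%N i = sigma i ^+ 2. Proof. by case: QnuP => ->. Qed.
Let N0 : N 0 = M. Proof. by []. Qed.

Let delta01 : 0 < eps / 3 / 2 <= 1 / 2.
Proof. by have := eps03; lra. Qed.

Let pk01 : 0 < p / k%:R < 1.
Proof.
have k0 : 0 < k%:R :> R by rewrite ltr0n.
rewrite divr_gt0//=; last by have := p01; lra.
rewrite ltr_pdivrMr// mul1r; apply: (@lt_le_trans _ _ 1).
  by have := p01; lra.
by rewrite ler1n.
Qed.

Let e1 : 0 < e < 1.
Proof. by have := e0; have := e_small; have := eps03; lra. Qed.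

(** The lower bound by the k-th squared singular value serves the running time: it controls the
    number of stages and the cost of SVRG. *)
Definition round_ok s := [/\ 0 < nu s 0%N, nu s 0%N <= 1, sigma k.-1 ^+ 2 <= nu s 0%N &
  r <= norm2 (cut (Q s) (fun i => nu s i == nu s 0%N) (w0 s))].

Definition vector_ok s := [/\ norm2 (v s) = 1, P s *m v s = v s &
  norm2 (cut (Q s) (fun i => nu s i <= (1 - eps / 6) * nu s 0%N) (v s)) ^+ 2 <= e].

(** The facts on deflation are used only up to round [s], where the vectors are already known to be
    good. By Courant-Fischer the top eigenvalue of M_s is then at least [sigma s ^+ 2] > 0, so
    AppxPCA applies. *)
Lemma round_step s : (s < k)%N -> (forall i, (i < s)%N -> vector_ok i) ->
  round_ok s /\ vector_ok s.
Proof.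
move=> sk IH.
have v1 i : (i < s)%N -> norm2 (v i) = 1 by case/IH.
have Pv i : (i < s)%N -> P i *m v i = v i by case/IH.
have PS := lazy_projS k inv (eps / 3) e p w0 M.
have NS := lazy_mxS k inv (eps / 3) e p w0 M.
have P0 := lazy_proj0 k inv (eps / 3) e p w0 M.
have MQ := svd_eigenbasis svdA.
have lo : sigma s ^+ 2 <= nu s 0%N.
  apply: (compression_eigenvalue_ge (V := basis_mx v s) MQ (NQ s)).
    exact: ltn_trans sk kd.
  by move=> y; exact: (deflation_quad N0 P0 NS PS Pv (leqnn s)).
have sp : sigma k <= sigma k.-1.
  by case: svdA => _ _ /(_ _ _ (leq_pred k))/andP[].
have ss : sigma k.-1 <= sigma s.
  have : (s <= k.-1)%N by rewrite -ltnS prednK.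
  by case: svdA => _ _ h _ _ /h/andP[].
have k1 : 0 < sigma k.-1 by apply: lt_le_trans sp.
have lo' : sigma k.-1 ^+ 2 <= nu s 0%N.
  by apply: le_trans lo; rewrite lerXn2r ?nnegrE ?sigma_ge0.
have n0 : 0 < nu s 0%N by apply: lt_le_trans lo'; rewrite exprn_gt0.
have n1 : nu s 0%N <= 1.
  have anti t : (t <= s)%N -> nu t 0%N <= nu 0%N 0%N.
    elim: t => // t IHt ts; apply: le_trans (IHt (ltnW ts)).
    exact: deflate_top_le (NQ t) (NQ t.+1) (NS t) (v1 t ts) (leq_ltn_trans (leq0n k) kd).
  by apply: le_trans (anti s (leqnn s)) _; rewrite nu0E exprn_ile1 ?sigma_ge0.
have r0 : 0 < r.
  apply: divr_gt0; first by case/andP: pk01.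
  by rewrite mulr_gt0 ?sqrtr_gt0 ?ltr0n ?(leq_ltn_trans _ kd).
have w_top : r <= norm2 (cut (Q s) (fun i => nu s i == nu s 0%N) (w0 s)).
  rewrite -(ler_pXn2r (n := 2))//= ?nnegrE ?norm2_ge0 ?(ltW r0)//.
  exact: (top_overlap_cut (NQ s)) (w0_top sk).
split=> //.
have acc i t lam b eta := @inv_acc s i t lam (N s) b eta.
have [v'1 v'bad] := appx_pca_spec (NQ s) n0 n1 acc delta01 e1
  pk01 (w01 sk) w_top.
have PT := proj_sym P0 PS s.
have PP := proj_idem P0 PS v1 Pv (leqnn s).
have NP := deflation_mulP N0 P0 NS PS v1 Pv (leqnn s).
have e6 : eps / 6 = eps / 3 / 2 by lra.
rewrite /vector_ok e6.
have t1 : eps / 3 / 2 < 1 by have := eps03; lra.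
have e1' : e <= 1 by case/andP: e1 => _ /ltW.
exact: (normalize_proj_spec (NQ s) PT PP NP t1 n0 e1' v'1 v'bad).
Qed.

Lemma all_vectors_ok s : (s <= k)%N -> forall i, (i < s)%N -> vector_ok i.
Proof.
elim: s => // s IH sk i; rewrite ltnS leq_eqVlt => /predU1P[->|].
  by case: (round_step sk (IH (ltnW sk))).
exact: IH (ltnW sk) i.
Qed.

Lemma all_rounds_ok s : (s < k)%N -> round_ok s.
Proof.
by move=> sk; case: (round_step sk (all_vectors_ok (ltnW sk))).
Qed.

Theorem lazy_svd_spec :
  let V := lazy_svd inv M k (eps / 3) e p w0 in
  let Ak := V *m V^T *m A in
  let Akstar := truncated_svd U sigma W k in
  [/\ \rank Ak = k,
      spectral_norm (A - Ak) <= (1 + eps) * spectral_norm (A - Akstar),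
      frobenius (A - Ak) <= (1 + eps) * frobenius (A - Akstar) &
      forall i : 'I_k, `|quad M (col i V) - sigma i ^+ 2| <= eps * sigma i ^+ 2].
Proof.
move=> V Ak Akstar; have VE : V = basis_mx v k := lazy_svdE _ _ _ _ _ _ _.
have ok := all_vectors_ok (leqnn k).
have v1 i : (i < k)%N -> norm2 (v i) = 1 by case/ok.
have Pv i : (i < k)%N -> P i *m v i = v i by case/ok.
have v_bad i : (i < k)%N ->
    norm2 (cut (Q i) (fun j => nu i j <= (1 - eps / 6) * nu i 0%N) (v i)) ^+ 2 <= e.
  by case/ok.
have PS := lazy_projS k inv (eps / 3) e p w0 M.
have NS := lazy_mxS k inv (eps / 3) e p w0 M.
have P0 := lazy_proj0 k inv (eps / 3) e p w0 M.
have nuk : 0 < nu 0%N k by rewrite nu0E exprn_gt0.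
have eta : d%:R * (k%:R * (2 * e * nu 0%N 0%N)) <= eps / 100 * nu 0%N k.
  by rewrite !nu0E.
have NE : N k = (1%:M - V *m V^T) *m M *m (1%:M - V *m V^T).
  by rewrite (deflation_proj N0 P0 NS PS Pv (leqnn k)) (proj_basis P0 PS) VE.
have nuE : nu 0%N = fun i => sigma i ^+ 2 by apply/funext => i; exact: nu0E.
have eps0 : 0 <= eps by have := eps03; lra.
split.
- apply: rank_projected => [|c].
    by rewrite VE (basis_mxTK P0 PS v1 Pv (leqnn k)).
  rewrite VE; exact: (basis_nonsingular N0 P0 NS PS v1 Pv NQ v_bad k_gt0 kd eps03 (ltW e0) e_small nuk eta).
- apply: (residual_spectral svdA kd kn NE (NQ k) eps0).
  rewrite -nu0E.
  exact: (residual_top NS v1 NQ v_bad kd eps03 (ltW e0) e_small nuk eta).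
- apply: (residual_frobenius svdA kd NE (NQ k) eps0).
  have := residual_trace NS v1 NQ v_bad kd eps03 (ltW e0) e_small nuk eta.
  by rewrite nuE.
- move=> i; have -> : col i V = v i.
    by apply/matrixP => a b; rewrite VE !mxE (ord1 b).
  rewrite -nu0E.
  by apply: (rayleigh_quotient N0 P0 NS PS v1 Pv NQ v_bad) => //; exact: ltW.
Qed.

Theorem lazy_halts_spec : lazy_halts inv M k (eps / 3) e p w0.
Proof.
move=> s sk; have [n0 n1 _ top] := all_rounds_ok sk.
apply: (pca_halting (NQ s) n0 n1 _ delta01 e1 pk01 (w01 sk) top) => *.
exact: inv_acc.
Qed.

End LazySVDCorrectness.

Lemma size_flatten_const (T I : Type) (r : seq I) (F : I -> seq T) c :
  (forall i, size (F i) = c) -> size (flatten [seq F i | i <- r]) = (size r * c)%N.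
Proof.
by move=> Fc; elim: r => //= i r IH; rewrite size_cat IH Fc mulSn.
Qed.

(** * Running time *)

Section PcaCalls.
Variables (R : realType) (d : nat).
Variable inv : nat -> nat -> R -> 'M[R]_d -> 'cV[R]_d -> R -> 'cV[R]_d.
Variables (M : 'M[R]_d) (delta eps p : R) (w0 : 'cV[R]_d).
Local Notation calls := (pca_calls inv M delta eps p w0).
Local Notation f := (pca_f inv M delta p w0).

Lemma size_pca_calls : size calls = (f * (pca_m1 d p).+1 + pca_m2 d eps p)%N.
Proof.
rewrite size_cat size_map size_iota; congr (_ + _)%N.
rewrite (@size_flatten_const _ _ _ _ (pca_m1 d p).+1) ?size_iota// => s.
by rewrite size_rcons size_map size_iota.
Qed.

Lemma pca_callsP q : q \in calls ->
  exists2 s, (s <= f)%N & q.1.1.2 = pca_lambda inv M delta p w0 s /\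
    (q.2 = pca_eps1 d delta p \/ q.2 = pca_eps2 d delta eps p).
Proof.
rewrite mem_cat => /orP[/flatten_mapP[s]|/mapP[t _ ->]]; last by exists f => //; split=> //; right.
rewrite mem_iota add1n ltnS => /andP[s0 sf] qs.
exists s.-1; first exact: leq_trans (leq_pred s) sf.
by move: qs; rewrite mem_rcons inE => /predU1P[->|/mapP[t _ ->]]; split=> //; left.
Qed.

End PcaCalls.

Section PcaCost.
Variables (R : realType) (d : nat) (M Q : 'M[R]_d) (nu : nat -> R).
Variable inv : nat -> nat -> R -> 'M[R]_d -> 'cV[R]_d -> R -> 'cV[R]_d.
Variables (delta eps p : R) (w0 : 'cV[R]_d).
Hypothesis MQ : eigenbasis M Q nu.
Hypotheses (nu_gt0 : 0 < nu 0%N) (nu_le1 : nu 0%N <= 1).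
Hypothesis inv_acc : forall i t lam b eta, pd (lam%:M - M) -> 0 < eta ->
  norm2 (inv i t lam M b eta - invmx (lam%:M - M) *m b) <= eta.
Hypotheses (delta01 : 0 < delta <= 1 / 2) (eps01 : 0 < eps < 1)
  (p01 : 0 < p < 1) (w01 : norm2 w0 = 1).
Hypothesis w0_top :
  pca_overlap d p <= norm2 (cut Q (fun i => nu i == nu 0%N) w0).
Local Notation calls := (pca_calls inv M delta eps p w0).

Variable H : R.
Hypotheses (H1 : 1 <= H) (H_m1 : (pca_m1 d p)%:R <= H)
  (H_m2 : (pca_m2 d eps p)%:R <= H)
  (H_f : 4 * ln (6 / (delta * nu 0%N)) + 1 <= H)
  (H_delta : ln (12 / delta) <= H) (H_eps : ln eps^-1 <= H).

Lemma pca_calls_le : (size calls)%:R <= 3 * H ^+ 2.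
Proof.
rewrite size_pca_calls natrD natrM -natr1.
have := pca_f_le MQ nu_gt0 nu_le1 inv_acc delta01 eps01 p01 w01 w0_top => hf.
have h1 := H1; have h2 := H_m1; have h3 := H_m2; have h4 := H_f.
have HH : H <= H ^+ 2 by rewrite expr2 ler_peMl//; lra.
apply: (@le_trans _ _ (H * (H + 1) + H)); last by rewrite expr2 in HH *; lra.
apply: lerD => //; apply: ler_pM => //; first exact: le_trans hf h4.
by rewrite lerD2r.
Qed.

Let ln_pos_le (x y : R) : 0 < x -> x <= y -> ln x <= ln y.
Proof. by move=> x0 xy; rewrite ler_ln ?posrE// (lt_le_trans x0). Qed.

Let ln_nat_le (x : R) : 0 < x -> ln x <= x.
Proof.
move=> x0; have h : ln (1 + (x - 1)) <= x - 1 by apply: le_ln1Dx; lra.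
by move: h; rewrite addrCA subrr addr0; lra.
Qed.

Let ln_pow_le m : m%:R <= H -> ln ((delta / 6) ^- m) <= H ^+ 2.
Proof.
have := delta01 => dl mH; rewrite -exprVn invf_div lnXn ?divr_gt0//; last lra.
rewrite -[leLHS]mulr_natl expr2.
have d6 : ln (6 / delta) <= H.
  apply: le_trans H_delta; apply: ln_pos_le; first by rewrite divr_gt0//; lra.
  by rewrite ler_pM2r ?invr_gt0//; lra.
apply: ler_pM => //; apply: ln_ge0; rewrite ler_pdivlMr; lra.
Qed.

(** The accuracy contains an m1-th power with m1 <= H, so its logarithm is a product of two
    logarithms; the rest is ln (64 m1) <= 64 m1. *)
Lemma ln_pca_eps1 : ln (pca_eps1 d delta p)^-1 <= 65 * H ^+ 2.
Proof.
have h1 := H1; have h2 := H_m1.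
have m0 : 0 < (pca_m1 d p)%:R :> R.
  by rewrite ltr0n (pca_m1_gt0 MQ nu_gt0 nu_le1 delta01 eps01 p01).
have HH : H <= H ^+ 2 by rewrite expr2 ler_peMl//; lra.
rewrite /pca_eps1 invfM invrK lnM ?posrE ?mulr_gt0//; last first.
  by rewrite invr_gt0 exprn_gt0// divr_gt0//; case/andP: delta01.
have := ln_pow_le h2; have := ln_nat_le (_ : 0 < 64 * (pca_m1 d p)%:R).
rewrite mulr_gt0// => /(_ isT) h3 h4.
apply: le_trans (lerD h3 h4) _; move: m0 h2 HH; move: (_%:R) (H ^+ 2) => m K; lra.
Qed.

Lemma ln_pca_eps2 : ln (pca_eps2 d delta eps p)^-1 <= 65 * H ^+ 2.
Proof.
have h1 := H1; have h2 := H_m2; have h3 := H_eps.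
have m0 : 0 < (pca_m2 d eps p)%:R :> R.
  by rewrite ltr0n (pca_m2_gt0 MQ nu_gt0 nu_le1 delta01 eps01 p01).
have HH : H <= H ^+ 2 by rewrite expr2 ler_peMl//; lra.
have /andP[e0 _] := eps01.
rewrite /pca_eps2 invfM lnM ?posrE; first last.
- by rewrite invr_gt0 exprn_gt0// divr_gt0//; case/andP: delta01.
- by rewrite invr_gt0 divr_gt0// mulr_gt0.
rewrite invf_div lnM ?posrE ?invr_gt0 ?mulr_gt0//.
have := ln_pow_le h2; have := ln_nat_le (_ : 0 < 8 * (pca_m2 d eps p)%:R).
rewrite mulr_gt0// => /(_ isT) h4 h5.
apply: le_trans (lerD (lerD h4 h3) h5) _.
move: m0 h2 HH; move: (_%:R) (H ^+ 2) => m K; lra.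
Qed.

Lemma pca_calls_cost q : q \in calls ->
  let lam := q.1.1.2 in let gap := lam - nu 0%N in
  [/\ nu 0%N < lam, 0 < q.2, delta * lam <= 12 * gap &
      Num.max 1 (ln (lam / (q.2 * gap))) <= 66 * H ^+ 2].
Proof.
move=> /pca_callsP[s sf [-> q2]] lam gap; rewrite /gap.
have /andP[g0 _] := pca_gap MQ nu_gt0 nu_le1 inv_acc delta01 eps01 p01 w01 w0_top s.
have l0 := pca_lambda_gt MQ nu_gt0 nu_le1 inv_acc delta01 eps01 p01 w01 w0_top s.
have ratio := pca_lambda_ratio MQ nu_gt0 nu_le1 inv_acc delta01 eps01 p01 w01 w0_top sf.
have q0 : 0 < q.2.
  case: q2 => ->.
    exact: (pca_eps1_gt0 MQ nu_gt0 nu_le1 delta01 eps01 p01).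
  exact: (pca_eps2_gt0 MQ nu_gt0 nu_le1 delta01 eps01 p01).
have lq : ln q.2^-1 <= 65 * H ^+ 2.
  by case: q2 => ->; [exact: ln_pca_eps1|exact: ln_pca_eps2].
split=> //; rewrite -/lam -/gap; have h1 := H1; have dl := delta01.
have HH : H <= H ^+ 2 by rewrite expr2 ler_peMl//; lra.
rewrite ge_max; apply/andP; split; first by move: HH; move: (H ^+ 2) => K; lra.
have lam0 : 0 < lam by apply: lt_trans l0.
apply: (@le_trans _ _ (ln (12 / delta * q.2^-1))).
  apply: ln_pos_le; first by rewrite divr_gt0// mulr_gt0.
  rewrite invfM mulrA mulrAC ler_pM2r ?invr_gt0//.
  by rewrite ler_pdivrMr// mulrAC ler_pdivlMr ?(mulrC lam)//; lra.
rewrite lnM ?posrE ?divr_gt0 ?invr_gt0//; last lra.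
by apply: le_trans (lerD H_delta lq) _; move: HH; move: (H ^+ 2) => K; lra.
Qed.

End PcaCost.

(** * Logarithms of the parameters in terms of the log factor *)

Lemma ln_monomial (R : realType) (c x a b r : R) :
  0 < c -> 0 < x -> 0 < a -> 0 < b -> 0 < r ->
  ln (c * (x ^+ 6 / (a ^+ 4 * b ^+ 4 * r ^+ 12))) =
  ln c + 6 * ln x - 4 * ln a - 4 * ln b - 12 * ln r.
Proof.
move=> c0 x0 a0 b0 r0; have x6 : 0 < x ^+ 6 by exact: exprn_gt0.
have a4 : 0 < a ^+ 4 by exact: exprn_gt0.
have b4 : 0 < b ^+ 4 by exact: exprn_gt0.
have r12 : 0 < r ^+ 12 by exact: exprn_gt0.
have ab : 0 < a ^+ 4 * b ^+ 4 by exact: mulr_gt0.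
have abr : 0 < a ^+ 4 * b ^+ 4 * r ^+ 12 by exact: mulr_gt0.
have q : 0 < x ^+ 6 / (a ^+ 4 * b ^+ 4 * r ^+ 12) by exact: divr_gt0.
rewrite lnM ?posrE// ln_div ?posrE// lnM ?posrE// lnM ?posrE// !lnXn//.
by move: (ln c) (ln x) (ln a) (ln b) (ln r) => *; lra.
Qed.

Lemma ln_overlap_ratio (R : realType) (a b x y : R) :
  0 < a -> 0 < b -> 0 < x -> 0 < y ->
  ln (a * b / (x / y) ^+ 2) = ln a + ln b - 2 * (ln x - ln y).
Proof.
move=> a0 b0 x0 y0; have ab : 0 < a * b by exact: mulr_gt0.
have xy : 0 < x / y by exact: divr_gt0.
have xy2 : 0 < (x / y) ^+ 2 by exact: exprn_gt0.
rewrite ln_div ?posrE// lnM ?posrE// lnXn// ln_div ?posrE//.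
by rewrite -[_ *+ 2]mulr_natl.
Qed.

Section LogFactor.
Variables (R : realType) (d n k : nat) (sigma : nat -> R) (c eps p : R).
Hypotheses (d_gt0 : (0 < d)%N) (k_gt0 : (0 < k)%N) (c_gt0 : 0 < c).
Hypotheses (eps_gt0 : 0 < eps) (p_gt0 : 0 < p).
Hypotheses (s0 : 0 < sigma 0%N) (sk1 : 0 < sigma k.-1) (sk : 0 < sigma k).
Local Notation L := (log_factor d n k sigma eps p).

Lemma log_factor_bounds :
  [/\ 1 <= L, - ln eps <= L, - ln p <= L, ln d%:R <= L & ln k%:R <= L] /\
  [/\ - ln (sigma 0%N) <= L, ln (sigma 0%N) - ln (sigma k.-1) <= L &
      ln (sigma 0%N) - ln (sigma k) <= L].
Proof.
have ge0 (x : R) : 0 <= x -> 0 <= ln (1 + x) by move=> x0; rewrite ln_ge0// lerDl.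
have le1 (x : R) : 0 < x -> ln x <= ln (1 + x).
  by move=> x0; rewrite ler_ln ?posrE//; lra.
have dR : 0 < d%:R :> R by rewrite ltr0n.
have kR : 0 < k%:R :> R by rewrite ltr0n.
have ie : 0 < eps^-1 by rewrite invr_gt0.
have ip : 0 < p^-1 by rewrite invr_gt0.
have is0 : 0 < (sigma 0%N)^-1 by rewrite invr_gt0.
have ia : 0 < sigma 0%N / sigma k.-1 by rewrite divr_gt0.
have ib : 0 < sigma 0%N / sigma k by rewrite divr_gt0.
have := le1 _ ib; have := le1 _ ia; have := le1 _ is0; have := le1 _ kR.
have := le1 _ dR; have := le1 _ ip; have := le1 _ ie.
rewrite !ln_div ?posrE// !lnV ?posrE//.
have := ge0 _ (ltW ib); have := ge0 _ (ltW ia); have := ge0 _ (ltW is0).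
have := ge0 _ (ltW kR); have := ge0 _ (ltW dR); have := ge0 _ (ltW ip).
have := ge0 _ (ltW ie); have := ge0 n%:R (ler0n _ _).
rewrite /log_factor !big_cons big_nil addr0.
move: (ln (1 + eps^-1)) (ln (1 + p^-1)) (ln (1 + n%:R)) (ln (1 + d%:R)) (ln (1 + k%:R))
  (ln (1 + (sigma 0%N)^-1)) (ln (1 + sigma 0%N / sigma k.-1)) (ln (1 + sigma 0%N / sigma k)).
move: (ln eps) (ln p) (ln _) (ln _) (ln _) (ln _) (ln _) => *.
by split; split; lra.
Qed.

(** Absorbs the logarithms of constants: ln 288 dominates those of the numerals in the counts (36,
    72, 288), and |ln c| comes from the accuracy. *)
Definition cost_base : R := 1 + ln 288 + `|ln c|.
Local Notation H := (100 * cost_base * L).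
Local Notation e := (c * (eps ^+ 6 / (k%:R ^+ 4 * d%:R ^+ 4 * (sigma 0%N / sigma k) ^+ 12))).

Let ln288 : 0 <= ln (288 : R).
Proof. by rewrite ln_ge0// ler1n. Qed.

Lemma cost_base_ge1 : 1 <= cost_base.
Proof. by rewrite /cost_base -addrA lerDl addr_ge0. Qed.

Let absorb (a : R) b : 0 <= a <= cost_base -> (b <= 50)%N -> a * 6 + b%:R * L <= H.
Proof.
move=> a0 b0; have [[L1 _ _ _ _] _] := log_factor_bounds; have K1 := cost_base_ge1.
have aL : a <= cost_base * L.
  by rewrite -[a]mulr1; apply: ler_pM; lra.
have bL : b%:R * L <= 50 * (cost_base * L).
  apply: ler_pM; [exact: ler0n|lra|by rewrite ler_nat|rewrite ler_peMl; lra].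
by lra.
Qed.

Let lnc_abs : - ln c <= `|ln c|. Proof. by rewrite -normrN ler_norm. Qed.

(** 26 = 6 + 4 + 4 + 12, the sum of the exponents in the accuracy. *)
Lemma ln_epca : - ln e <= `|ln c| + 26 * L.
Proof.
have [[L1 Le Lp Ld Lk] [Ls La Lb]] := log_factor_bounds.
have dR : 0 < d%:R :> R by rewrite ltr0n.
have kR : 0 < k%:R :> R by rewrite ltr0n.
have rR : 0 < sigma 0%N / sigma k by rewrite divr_gt0.
rewrite ln_monomial// ln_div ?posrE//; have := lnc_abs.
move: L1 Le Lp Ld Lk Ls La Lb; move: L (ln c) (ln eps) (ln k%:R) (ln d%:R).
by move: (ln (sigma 0%N)) (ln (sigma k)) (ln (sigma k.-1)) => *; lra.
Qed.

Let lnc0 : 0 <= `|ln c|. Proof. exact: normr_ge0. Qed.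

Let ln_small a : (0 < a <= 288)%N -> 0 <= ln (a%:R : R) <= ln (288 : R).
Proof.
move=> /andP[a0 a1]; rewrite ln_ge0 ?ler1n//= ler_ln ?posrE ?ltr0n//.
by rewrite ler_nat.
Qed.

Lemma pca_m1_polylog : 1 <= 288 * d%:R / (p / k%:R) ^+ 2 ->
  (pca_m1 d (p / k%:R))%:R <= H.
Proof.
move=> X1; rewrite /pca_m1; set x := 288 * _ / _ in X1 *.
apply: le_trans (absz_ceil_le _) _; first by rewrite mulr_ge0 ?ln_ge0.
have [[L1 Le Lp Ld Lk] _] := log_factor_bounds.
have dR : 0 < d%:R :> R by rewrite ltr0n.
have kR : 0 < k%:R :> R by rewrite ltr0n.
rewrite /x ln_overlap_ratio ?ltr0n//.
have a0 : 0 <= ln (288 : R) <= cost_base.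
  by rewrite ln288 /cost_base; have := lnc0; lra.
have := @absorb _ 22 a0 isT; have := ln288.
move: L1 Lp Ld Lk; move: L (ln p) (ln k%:R) (ln d%:R) (ln 288) => l *; lra.
Qed.

Lemma pca_m2_polylog : 1 <= 36 * d%:R / ((p / k%:R) ^+ 2 * e) -> 0 < e ->
  (pca_m2 d e (p / k%:R))%:R <= H.
Proof.
move=> X1 e0; rewrite /pca_m2.
have := ln_epca; move: e e0 X1 => ee e0 X1 lne.
apply: le_trans (absz_ceil_le _) _; first by rewrite ln_ge0.
have [[L1 Le Lp Ld Lk] _] := log_factor_bounds.
have dR : 0 < d%:R :> R by rewrite ltr0n.
have kR : 0 < k%:R :> R by rewrite ltr0n.
have pk : 0 < p / k%:R by rewrite divr_gt0.
have pk2 : 0 < (p / k%:R) ^+ 2 by exact: exprn_gt0.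
have x0 : 0 < 36 * d%:R / (p / k%:R) ^+ 2 by rewrite divr_gt0// mulr_gt0.
rewrite invfM mulrA lnM ?posrE ?invr_gt0// ln_overlap_ratio// lnV ?posrE//.
have a0 : 0 <= ln (288 : R) + `|ln c| <= cost_base.
  by rewrite /cost_base; have := lnc0; have := ln288; lra.
have := @absorb _ 32 a0 isT; have := ln288; have := lnc0.
have := @ln_small 36 isT.
move: L1 Lp Ld Lk lne; move: L (ln p) (ln k%:R) (ln d%:R) (ln 288) (ln 36) `|ln c| => *; lra.
Qed.

Lemma epca_polylog : 0 < e -> ln e^-1 <= H.
Proof.
move=> e0; rewrite lnV ?posrE//; apply: le_trans ln_epca _.
have [[L1 _ _ _ _] _] := log_factor_bounds.
have a0 : 0 <= `|ln c| <= cost_base by rewrite /cost_base; have := ln288; have := lnc0; lra.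
by have := @absorb _ 26 a0 isT; have := lnc0; lra.
Qed.

Lemma pca_stages_polylog (nu : R) : sigma k.-1 ^+ 2 <= nu ->
  4 * ln (6 / (eps / 3 / 2 * nu)) + 1 <= H.
Proof.
move=> snu; have s2 : 0 < sigma k.-1 ^+ 2 by exact: exprn_gt0.
have ep := eps_gt0.
have nu0 : 0 < nu by apply: lt_le_trans snu.
have d0 : 0 < eps / 3 / 2 by lra.
have [[L1 Le _ _ _] [Ls La _]] := log_factor_bounds.
have -> : 6 / (eps / 3 / 2 * nu) = 36 / (eps * nu) by field; rewrite !gt_eqF.
have h : ln (36 / (eps * nu)) <= ln (36 / (eps * sigma k.-1 ^+ 2)).
  by rewrite ler_ln ?posrE ?divr_gt0 ?mulr_gt0// ler_pM2l// lef_pV2 ?posrE ?mulr_gt0// ler_pM2l.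
apply: (@le_trans _ _ (4 * ln (36 / (eps * sigma k.-1 ^+ 2)) + 1)); first by lra.
rewrite ln_div ?posrE ?mulr_gt0// lnM ?posrE// lnXn//.
have a0 : 0 <= ln (288 : R) <= cost_base.
  by rewrite ln288 /cost_base; have := lnc0; lra.
have := @absorb _ 22 a0 isT; have := ln288.
have := @ln_small 36 isT.
clear h; move: L1 Le Ls La; move: L (ln eps) (ln (sigma k.-1)) (ln (sigma 0%N)) (ln 288) (ln 36) => *.
lra.
Qed.

Lemma ln_delta_polylog : ln (12 / (eps / 3 / 2)) <= H.
Proof.
have [[L1 Le _ _ _] _] := log_factor_bounds.
have -> : 12 / (eps / 3 / 2) = 72 / eps by field; rewrite gt_eqF// eps_gt0.
rewrite ln_div ?posrE//.
have a0 : 0 <= ln (288 : R) <= cost_base.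
  by rewrite ln288 /cost_base; have := lnc0; lra.
have := @absorb _ 22 a0 isT; have := ln288.
have := @ln_small 72 isT.
by move: L1 Le; move: L (ln eps) (ln 288) (ln 72) => *; lra.
Qed.

Lemma polylog_ge1 : 1 <= H.
Proof.
have [[L1 _ _ _ _] _] := log_factor_bounds.
have := @absorb 1 0; rewrite ler01 cost_base_ge1 => /(_ isT isT); lra.
Qed.

End LogFactor.

Section LazyTime.
Variables (R : realType) (d k : nat).
Variable inv : nat -> nat -> nat -> R -> 'M[R]_d -> 'cV[R]_d -> R -> 'cV[R]_d.
Variable cost : nat -> nat -> nat -> R -> 'M[R]_d -> 'cV[R]_d -> R -> nat.
Variables (M : 'M[R]_d) (delta eps p : R) (w0 : nat -> 'cV[R]_d).
Variables (price update : nat -> nat) (B W : R).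
Local Notation N := (lazy_mx k inv delta eps p w0 M).
Local Notation calls s := (pca_calls (inv s) (N s) (delta / 2) eps (p / k%:R) (w0 s)).

Hypothesis W0 : 0 <= W.
Hypothesis calls_le : forall s, (s < k)%N -> (size (calls s))%:R <= B.
Hypothesis cost_le : forall s q, (s < k)%N -> q \in calls s ->
  (cost s q.1.1.1.1 q.1.1.1.2 q.1.1.2 (N s) q.1.2 q.2)%:R <= W.

Lemma lazy_time_le :
  (lazy_time inv cost M k delta eps p w0 price update)%:R <=
  \sum_(s < k) (B * ((price s)%:R * W + d%:R) + d%:R * s.+1%:R + (update s)%:R).
Proof.
rewrite /lazy_time natr_sum ler_sum// => s _; rewrite !natrD natrM lerD2r lerD2r.
rewrite natr_sum; set r := calls s.
have rW q : q \in r -> (cost s q.1.1.1.1 q.1.1.1.2 q.1.1.2 (N s) q.1.2 q.2)%:R <= W.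
  exact: cost_le.
have rB : (size r)%:R <= B by exact: calls_le.
rewrite -/(lazy_mx _ _ _ _ _ _ _ _) -/r.
apply: (@le_trans _ _ (\sum_(q <- r) ((price s)%:R * W + d%:R))).
  rewrite big_seq [leRHS]big_seq ler_sum// => q qr.
  by rewrite natrD natrM lerD2r ler_wpM2l// rW.
rewrite big_const_seq count_predT iter_addr_0 -[leLHS]mulr_natl.
by apply: ler_wpM2r => //; rewrite addr_ge0// mulr_ge0.
Qed.

End LazyTime.

(** SVRG is priced for averages of this form; the deflated matrices qualify because the projected
    vectors P a_i still have norm at most 1. *)
Lemma average_proj (R : realType) d n (B P : 'M[R]_d) : P^T = P -> P *m P = P ->
  average_of_rank_one n B -> average_of_rank_one n (P *m B *m P).
Proof.
move=> PT PP [a [a1 ->]]; exists (fun i => P *m a i); split=> [i|].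
  apply: le_trans (a1 i); rewrite norm2_le.
  exact: dotvv_proj PT PP _.
rewrite -scalemxAr -scalemxAl mulmx_sumr mulmx_suml; congr (_ *: _).
by apply: eq_bigr => i _; rewrite trmx_mul PT !mulmxA.
Qed.

(** The hypothesis says lam <= (72 / eps) gap, and 72 <= 9^2. *)
Lemma sqrt_ratio_le (R : realType) (eps lam gap : R) : 0 < eps -> 0 < lam -> 0 < gap ->
  eps / 3 / 2 * lam <= 12 * gap ->
  Num.sqrt lam / Num.sqrt gap <= 9 / Num.sqrt eps.
Proof.
move=> e0 l0 g0 h; rewrite ler_pdivrMr ?sqrtr_gt0//.
rewrite mulrAC ler_pdivlMr ?sqrtr_gt0//.
rewrite -(ler_pXn2r (n := 2))//= ?nnegrE ?mulr_ge0 ?sqrtr_ge0//.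
by rewrite !exprMn !sqr_sqrtr ?ltW// -natrX; lra.
Qed.

Lemma powR_quarter (R : realType) (x : R) : 0 <= x -> x `^ (1 / 4) = Num.sqrt (Num.sqrt x).
Proof.
move=> x0; rewrite -(powR12_sqrt (sqrtr_ge0 x)) -(powR12_sqrt x0) -powRrM; congr (_ `^ _).
by field.
Qed.

(** Write lam^(1/4) as sqrt(lam) / lam^(1/4); the denominator is at least sqrt(sg) because sg^2 <=
    lam. This is the origin of sigma_k^(1/2) in the SVRG bound. *)
Lemma quarter_ratio_le (R : realType) (eps lam gap sg : R) : 0 < eps -> 0 < lam ->
  0 < gap -> 0 < sg -> sg ^+ 2 <= lam -> eps / 3 / 2 * lam <= 12 * gap ->
  lam `^ (1 / 4) / Num.sqrt gap <= 9 / (Num.sqrt sg * Num.sqrt eps).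
Proof.
move=> e0 l0 g0 s0 sl h; rewrite (powR_quarter (ltW l0)).
set q := Num.sqrt (Num.sqrt lam).
have q2 : q ^+ 2 = Num.sqrt lam by rewrite sqr_sqrtr ?sqrtr_ge0.
have sq : Num.sqrt sg <= q.
  have sgE : Num.sqrt (sg ^+ 2) = sg by rewrite sqrtr_sqr ger0_norm// ltW.
  by rewrite ler_wsqrtr// -[leLHS]sgE ler_wsqrtr.
have := sqrt_ratio_le e0 l0 g0 h; rewrite -q2.
have sg0 : 0 < Num.sqrt sg by rewrite sqrtr_gt0.
have -> : 9 / (Num.sqrt sg * Num.sqrt eps) = 9 / Num.sqrt eps / Num.sqrt sg.
  by rewrite invfM mulrA mulrAC.
rewrite (ler_pdivlMr _ _ sg0) => h2.
apply: le_trans h2; rewrite mulrAC ler_pM2r ?invr_gt0 ?sqrtr_gt0// expr2.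
by rewrite ler_wpM2l// sqrtr_ge0.
Qed.

Lemma absorb_lower_order (R : realType) (u z h2 h4 : R) : h2 <= h4 -> 1 <= h4 ->
  h4 * 1 <= z -> u + (3 * h2 + 1) <= u + 4 * z.
Proof. by rewrite mulr1; lra. Qed.

Lemma absorb_lower_order2 (R : realType) (z h2 h4 : R) : h2 <= h4 -> 1 <= h4 ->
  0 <= z -> 1782 * z + 3 * h2 + 2 <= 3564 * z + 8 * h4.
Proof. by lra. Qed.

Lemma inv_sqrt_ge (R : realType) (eps : R) : 0 < eps < 3 -> 1 <= 2 / Num.sqrt eps.
Proof.
move=> e; rewrite ler_pdivlMr ?sqrtr_gt0; last by lra.
rewrite mul1r -(ler_pXn2r (n := 2))//= ?nnegrE ?sqrtr_ge0// sqr_sqrtr; last by lra.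
by rewrite -natrX; lra.
Qed.

Section LazySVDCost.
Variables (R : realType) (d n k : nat) (A : 'M[R]_(d, n)) (U : 'M[R]_d).
Variables (sigma : nat -> R) (W : 'M[R]_n) (eps c p : R).
Variable inv : nat -> nat -> nat -> R -> 'M[R]_d -> 'cV[R]_d -> R -> 'cV[R]_d.
Variable cost : nat -> nat -> nat -> R -> 'M[R]_d -> 'cV[R]_d -> R -> nat.
Variable w0 : nat -> 'cV[R]_d.
Local Notation e := (c * (eps ^+ 6 / (k%:R ^+ 4 * d%:R ^+ 4 * (sigma 0%N / sigma k) ^+ 12))).
Hypothesis svdA : is_svd A U sigma W.
Hypotheses (sigma1 : sigma 0%N <= 1) (sigmak : 0 < sigma k).
Hypotheses (k_gt0 : (0 < k)%N) (eps03 : 0 < eps < 3) (p01 : 0 < p < 1).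
Hypotheses (c0 : 0 < c) (e0 : 0 < e) (e_small : e <= eps / 100).
Hypothesis inv_acc : forall r i t lam B b eta, pd (lam%:M - B) -> 0 < eta ->
  norm2 (inv r i t lam B b eta - invmx (lam%:M - B) *m b) <= eta.
Hypothesis w01 : forall s, (s < k)%N -> norm2 (w0 s) = 1.
Local Notation M := (A *m A^T).
Local Notation N := (lazy_mx k inv (eps / 3) e p w0 M).
Local Notation P := (lazy_proj k inv (eps / 3) e p w0 M).
Local Notation calls s := (pca_calls (inv s) (N s) (eps / 3 / 2) e (p / k%:R) (w0 s)).
Local Notation L := (log_factor d n k sigma eps p).
Local Notation H := (100 * cost_base c * L).

Variable Qnu : nat -> 'M[R]_d * (nat -> R).
Local Notation Q s := (Qnu s).1.
Local Notation nu s := (Qnu s).2.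
Hypothesis NQ : forall s, eigenbasis (N s) (Q s) (nu s).
Hypothesis rounds : forall s, (s < k)%N ->
  round_ok k sigma p w0 Qnu s.
Hypothesis projs : forall s, (s < k)%N -> [/\ (P s)^T = P s, P s *m P s = P s & N s = P s *m M *m P s].

Let kd : (k < d)%N. Proof. by have := rank_lt svdA sigmak; rewrite ltn_min => /andP[]. Qed.
Let kn : (k < n)%N. Proof. by have := rank_lt svdA sigmak; rewrite ltn_min => /andP[]. Qed.
Let d0 : (0 < d)%N. Proof. exact: leq_ltn_trans kd. Qed.
Let sk1 : 0 < sigma k.-1.
Proof.
by apply: lt_le_trans sigmak _; case: svdA => _ _ /(_ _ _ (leq_pred k))/andP[].
Qed.
Let s0 : 0 < sigma 0%N.
Proof.
by apply: lt_le_trans sigmak _; case: svdA => _ _ /(_ _ _ (leq0n k))/andP[].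
Qed.
Let eps0 : 0 < eps. Proof. by case/andP: eps03. Qed.
Let p0 : 0 < p. Proof. by case/andP: p01. Qed.

Let delta01 : 0 < eps / 3 / 2 <= 1 / 2.
Proof. by have := eps03; lra. Qed.

Let pk01 : 0 < p / k%:R < 1.
Proof.
have k0 : 0 < k%:R :> R by rewrite ltr0n.
rewrite divr_gt0//= ltr_pdivrMr// mul1r; apply: (@lt_le_trans _ _ 1).
  by have := p01; lra.
by rewrite ler1n.
Qed.

Let e1 : 0 < e < 1.
Proof. by rewrite e0; have := e_small; have := eps03; lra. Qed.

Let dR : 1 <= d%:R :> R. Proof. by rewrite ler1n. Qed.

Let X1 : 1 <= 288 * d%:R / (p / k%:R) ^+ 2.
Proof.
have /andP[pk0 pk1] := pk01.
have pk2 : 0 < (p / k%:R) ^+ 2 by exact: exprn_gt0.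
rewrite ler_pdivlMr// mul1r; apply: (@le_trans _ _ 1).
  by rewrite exprn_ile1// ltW.
by have := dR; lra.
Qed.

Let Y1 : 1 <= 36 * d%:R / ((p / k%:R) ^+ 2 * e).
Proof.
have /andP[pk0 pk1] := pk01; have /andP[e0' e1'] := e1.
have pk2 : 0 < (p / k%:R) ^+ 2 by exact: exprn_gt0.
have pke : 0 < (p / k%:R) ^+ 2 * e by exact: mulr_gt0.
rewrite ler_pdivlMr// mul1r; apply: (@le_trans _ _ (1 * 1)).
  by apply: ler_pM; [exact: ltW|exact: ltW|rewrite exprn_ile1// ltW|exact: ltW].
by have := dR; lra.
Qed.

Let m1_H : (pca_m1 d (p / k%:R))%:R <= H.
Proof. exact: pca_m1_polylog. Qed.

Let m2_H : (pca_m2 d e (p / k%:R))%:R <= H.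
Proof. exact: pca_m2_polylog. Qed.

Let H1 : 1 <= H. Proof. exact: polylog_ge1. Qed.

Let acc s i t lam b eta : pd (lam%:M - N s) -> 0 < eta ->
  norm2 (inv s i t lam (N s) b eta - invmx (lam%:M - N s) *m b) <= eta.
Proof. exact: inv_acc. Qed.

Lemma lazy_calls_le s : (s < k)%N -> (size (calls s))%:R <= 3 * H ^+ 2.
Proof.
move=> sk; have [n0 n1 sn top] := rounds sk.
apply: (pca_calls_le (NQ s) n0 n1 (@acc s) delta01 e1 pk01 (w01 sk) top H1 m1_H m2_H).
exact: pca_stages_polylog.
Qed.

Lemma lazy_calls_cost s q : (s < k)%N -> q \in calls s ->
  let lam := q.1.1.2 in let gap := lam - nu s 0%N in
  [/\ nu s 0%N < lam, 0 < q.2, eps / 3 / 2 * lam <= 12 * gap &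
      Num.max 1 (ln (lam / (q.2 * gap))) <= 66 * H ^+ 2].
Proof.
move=> sk; have [n0 n1 sn top] := rounds sk.
apply: (pca_calls_cost (NQ s) n0 n1 (@acc s) delta01 e1 pk01 (w01 sk) top H1 m1_H m2_H).
- exact: ln_delta_polylog.
- exact: epca_polylog.
Qed.

Let HH : H ^+ 2 <= H ^+ 4 /\ 1 <= H ^+ 4.
Proof.
have h1 : 1 <= H ^+ 2 by rewrite exprn_ege1.
by split; rewrite ?exprn_ege1// -[leLHS]mulr1 (exprD _ 2 2) ler_wpM2l// ltW// (lt_le_trans _ h1).
Qed.

(** At most 3 H^2 calls, each with logarithm at most 66 H^2, give the fourth power of [L]. The
    constant is 3564 = 2 * 3 * 9 * 66, with 2 from the price of an iteration and 9 from
    [sqrt_ratio_le]; terms without [C0] go into the 8, using 1 <= 2 / sqrt(eps). *)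
Lemma agd_time C0 : 0 < C0 ->
  (forall s i t lam b eta del, (s < k)%N -> 0 < lam -> 0 < del -> 0 < eta ->
    psd (lam%:M - N s - del%:M) ->
    (cost s i t lam (N s) b eta)%:R <=
      C0 * (Num.sqrt lam / Num.sqrt del * Num.max 1 (ln (lam / (eta * del))))) ->
  (lazy_time inv cost M k (eps / 3) e p w0 (agd_price A) agd_update)%:R <=
  (3564 * C0 + 8) * (100 * cost_base c) ^+ 4 *
  ((k%:R * (nnz A)%:R + k%:R ^+ 2 * d%:R) / Num.sqrt eps * L ^+ 4).
Proof.
move=> C0_gt0 work_le; have se : 0 < Num.sqrt eps by rewrite sqrtr_gt0.
have H20 : 0 <= H ^+ 2 by rewrite sqr_ge0.
pose Wk := C0 * (9 / Num.sqrt eps * (66 * H ^+ 2)).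
have W0 : 0 <= Wk.
  by apply: mulr_ge0 (ltW C0_gt0) (mulr_ge0 (divr_ge0 _ (ltW se)) (mulr_ge0 _ H20)).
apply: le_trans (lazy_time_le _ _ W0 lazy_calls_le _) _.
  move=> s q sk qs; have [nl q0 rat mx] := lazy_calls_cost sk qs.
  have [n0 _ _ _] := rounds sk.
  have g0 : 0 < q.1.1.2 - nu s 0%N by rewrite subr_gt0.
  have l0 : 0 < q.1.1.2 by apply: lt_trans nl.
  apply: le_trans (work_le _ _ _ _ _ _ _ sk l0 g0 q0 _) _.
    by apply: (shifted_psd (NQ s)).
  rewrite /Wk ler_pM2l//; apply: ler_pM => //.
  - by rewrite le_max ler01.
  - exact: sqrt_ratio_le.
pose X : R := (nnz A)%:R + k%:R * d%:R.
have kR : 1 <= k%:R :> R by rewrite ler1n.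
have kd0 : d%:R <= k%:R * d%:R :> R by rewrite ler_peMl.
have dX : d%:R <= X by rewrite /X -[leLHS]add0r lerD.
have X0 : 0 <= X by apply: le_trans dX.
apply: (@le_trans _ _ (\sum_(s < k) (X * (2 * (3 * H ^+ 2) * Wk + 3 * H ^+ 2 + 1)))).
  apply: ler_sum => s _; rewrite addr0.
  have sk : s.+1%:R <= k%:R :> R by rewrite ler_nat.
  have price_le : (agd_price A s)%:R <= 2 * X.
    rewrite /agd_price /X !natrD natrM.
    have : s.+1%:R * d%:R <= k%:R * d%:R :> R by rewrite ler_wpM2r.
    by have := ler0n R (nnz A); rewrite -natr1 mulrDl mul1r; lra.
  have h1 : 3 * H ^+ 2 * ((agd_price A s)%:R * Wk + d%:R) <= 3 * H ^+ 2 * (2 * X * Wk + X).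
    apply: ler_wpM2l; first by apply: mulr_ge0.
    by apply: lerD => //; apply: ler_wpM2r.
  have h2 : d%:R * s.+1%:R <= X.
    apply: (@le_trans _ _ (k%:R * d%:R)); first by rewrite mulrC ler_wpM2r.
    by rewrite /X -[leLHS]add0r lerD.
  apply: le_trans (lerD h1 h2) _; rewrite le_eqVlt; apply/orP; left; apply/eqP.
  by move: (H ^+ 2) => *; ring.
rewrite sumr_const card_ord -[leLHS]mulr_natl.
have -> : (k%:R * (nnz A)%:R + k%:R ^+ 2 * d%:R) / Num.sqrt eps = k%:R * X / Num.sqrt eps.
  by rewrite /X mulrDr mulrA -expr2.
have [h24 h4] := HH; have ie := inv_sqrt_ge eps03.
have -> : (3564 * C0 + 8) * (100 * cost_base c) ^+ 4 * (k%:R * X / Num.sqrt eps * L ^+ 4) =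
    k%:R * X * ((3564 * C0 + 8) * H ^+ 4 / Num.sqrt eps).
  by rewrite exprMn; ring.
rewrite mulrA ler_wpM2l ?mulr_ge0//.
have HH4 : H ^+ 4 = H ^+ 2 * H ^+ 2 by rewrite -exprD.
rewrite /Wk; set si := (Num.sqrt eps)^-1 in ie *; have si0 : 0 < si by rewrite invr_gt0.
have -> : 2 * (3 * H ^+ 2) * (C0 * (9 * si * (66 * H ^+ 2))) = 3564 * C0 * H ^+ 4 * si.
  by rewrite HH4; move: (H ^+ 2) => *; ring.
move: (H ^+ 2) (H ^+ 4) H20 h24 h4 => h2 h4 h20 h24 h41.
have a1 : h4 * 1 <= h4 * (2 * si) by apply: ler_wpM2l => //; apply: le_trans h41.
have -> : (3564 * C0 + 8) * h4 * si = 3564 * C0 * h4 * si + 4 * (h4 * (2 * si)) by ring.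
rewrite -addrA; move: (h4 * (2 * si)) a1 => z az.
exact: absorb_lower_order h24 h41 az.
Qed.

Lemma svrg_time C0 : 0 < C0 -> average_of_rank_one n M ->
  (forall s i t lam b eta del, (s < k)%N -> average_of_rank_one n (N s) ->
    0 < lam -> 0 < del -> 0 < eta -> psd (lam%:M - N s - del%:M) ->
    (cost s i t lam (N s) b eta)%:R <=
      C0 * (Num.max (n%:R * d%:R) (n%:R `^ (3 / 4) * d%:R * lam `^ (1 / 4) / Num.sqrt del)
        * Num.max 1 (ln (lam / (eta * del))))) ->
  (lazy_time inv cost M k (eps / 3) e p w0 svrg_price (svrg_update n d))%:R <=
  (3564 * C0 + 8) * (100 * cost_base c) ^+ 4 *
  ((k%:R * n%:R * d%:R + k%:R * n%:R `^ (3 / 4) * d%:R /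
      (Num.sqrt (sigma k.-1) * Num.sqrt eps)) * L ^+ 4).
Proof.
move=> C0_gt0 avg work_le; have se : 0 < Num.sqrt eps by rewrite sqrtr_gt0.
have ss : 0 < Num.sqrt (sigma k.-1) by rewrite sqrtr_gt0.
have H20 : 0 <= H ^+ 2 by rewrite sqr_ge0.
pose y : R := n%:R `^ (3 / 4) * d%:R.
have y0 : 0 <= y by rewrite mulr_ge0// powR_ge0.
pose Y := y / (Num.sqrt (sigma k.-1) * Num.sqrt eps).
have Y0 : 0 <= Y by rewrite divr_ge0// mulr_ge0// ltW.
pose Z := n%:R * d%:R + Y.
have Z0 : 0 <= Z by rewrite addr_ge0// mulr_ge0.
pose Wk := C0 * (9 * Z * (66 * H ^+ 2)).
have W0 : 0 <= Wk.
  by apply: mulr_ge0 (ltW C0_gt0) (mulr_ge0 (mulr_ge0 _ Z0) (mulr_ge0 _ H20)).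
apply: le_trans (lazy_time_le _ _ W0 lazy_calls_le _) _.
  move=> s q sk qs; have [nl q0 rat mx] := lazy_calls_cost sk qs.
  have [n0 _ sn _] := rounds sk; have [PT PP NE] := projs sk.
  have g0 : 0 < q.1.1.2 - nu s 0%N by rewrite subr_gt0.
  have l0 : 0 < q.1.1.2 by apply: lt_trans nl.
  apply: le_trans (work_le _ _ _ _ _ _ _ sk _ l0 g0 q0 _) _.
  - by rewrite NE; exact: average_proj.
  - by apply: (shifted_psd (NQ s)).
  rewrite /Wk ler_pM2l//; apply: ler_pM => //.
  - by rewrite le_max ler01.
  rewrite ge_max; apply/andP; split.
    have : 0 <= n%:R * d%:R :> R by rewrite mulr_ge0.
    by rewrite /Z; lra.
  apply: (@le_trans _ _ (9 * Y)); last first.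
    have : 0 <= n%:R * d%:R :> R by rewrite mulr_ge0.
    by rewrite /Z; lra.
  have -> : 9 * Y = y * (9 / (Num.sqrt (sigma k.-1) * Num.sqrt eps)) by rewrite /Y mulrCA.
  rewrite -/y -[leLHS]mulrA; apply: (ler_wpM2l y0).
  apply: quarter_ratio_le => //; exact: le_trans sn (ltW nl).
have ndZ : n%:R * d%:R <= Z by rewrite lerDl.
have d_nd : d%:R <= n%:R * d%:R :> R by rewrite ler_peMl// ler1n (leq_ltn_trans _ kn).
apply: (@le_trans _ _ (\sum_(s < k) (3 * H ^+ 2 * (Wk + Z) + 2 * Z))).
  apply: ler_sum => s _.
  have sn : s.+1%:R <= n%:R :> R by rewrite ler_nat (leq_trans (ltn_ord s))// ltnW.
  have h1 : 3 * H ^+ 2 * ((svrg_price s)%:R * Wk + d%:R) <= 3 * H ^+ 2 * (Wk + Z).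
    apply: ler_wpM2l; first by apply: mulr_ge0.
    by rewrite mul1r lerD2l; apply: le_trans ndZ.
  have h2 : d%:R * s.+1%:R <= Z.
    by apply: le_trans ndZ; rewrite mulrC ler_wpM2r.
  have h3 : (svrg_update n d s)%:R <= Z by rewrite natrM.
  by apply: le_trans (lerD (lerD h1 h2) h3) _; lra.
rewrite sumr_const card_ord -[leLHS]mulr_natl.
have [h24 h4] := HH.
have HH4 : H ^+ 4 = H ^+ 2 * H ^+ 2 by rewrite -exprD.
have -> : (3564 * C0 + 8) * (100 * cost_base c) ^+ 4 *
    ((k%:R * n%:R * d%:R + k%:R * n%:R `^ (3 / 4) * d%:R /
      (Num.sqrt (sigma k.-1) * Num.sqrt eps)) * L ^+ 4) =
    k%:R * ((3564 * C0 + 8) * H ^+ 4 * Z).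
  by rewrite exprMn /Z /Y /y; ring.
rewrite ler_wpM2l// /Wk.
have -> : 3 * H ^+ 2 * (C0 * (9 * Z * (66 * H ^+ 2)) + Z) + 2 * Z =
    (1782 * C0 * H ^+ 4 + 3 * H ^+ 2 + 2) * Z.
  by rewrite HH4; move: (H ^+ 2) => *; ring.
rewrite ler_wpM2r//.
move: (H ^+ 2) (H ^+ 4) H20 h24 h4 => h2 h4 h20 h24 h41.
have : 0 <= C0 * h4 by apply: mulr_ge0 (ltW C0_gt0) _; apply: le_trans h41.
have -> : (3564 * C0 + 8) * h4 = 3564 * (C0 * h4) + 8 * h4 by ring.
have -> : 1782 * C0 * h4 = 1782 * (C0 * h4) by ring.
move: (C0 * h4) => z z0.
exact: absorb_lower_order2 h24 h41 z0.
Qed.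

End LazySVDCost.

Lemma approx_rational_mx (R : realType) m n (x : 'M[R]_(m, n)) (e : R) : 0 < e ->
  exists r : 'M[rat]_(m, n), ball x e (map_mx ratr r).
Proof.
move=> e0.
have h (i : 'I_m) (j : 'I_n) : exists q : rat, `|x i j - ratr q| < e.
  have /rat_in_itvoo[q] : x i j - e < x i j + e by rewrite ltrD2l gt0_cp.
  by rewrite in_itv/= => /andP[q1 q2]; exists q; rewrite ltr_norml; apply/andP; split; lra.
exists (\matrix_(i, j) projT1 (cid (h i j))); split=> // i j.
by rewrite !mxE /ball/=; case: cid.
Qed.

(** * Measurability and independence *)

Section MatrixMeasurability.
Variables (R : realType) (dS : measure_display) (S : measurableType dS).

Lemma measurable_forall (I : countType) (F : I -> set S) :
  (forall i, measurable (F i)) -> measurable [set x | forall i, F i x].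
Proof.
move=> mF; rewrite (_ : [set x | _] = ~` \bigcup_i ~` F i).
  apply: measurableC; apply: countable_bigcupT_measurable => [|i]; first exact: countableP.
  exact: measurableC.
by rewrite setC_bigcup; apply/seteqP; split=> [x h i _|x h i];
  [rewrite setCK|have := h i Logic.I; rewrite setCK].
Qed.

Lemma measurable_prop_and (Q : Prop) (A : set S) : measurable A ->
  measurable [set x | Q /\ A x].
Proof.
have [q|q] := pselect Q => mA.
  by rewrite (_ : [set x | _] = A)//; apply/seteqP; split=> [x []|x].
by rewrite (_ : [set x | _] = set0)//; apply/seteqP; split=> [x []|x].
Qed.

Lemma measurable_prop_imply (Q : Prop) (A : set S) : measurable A ->
  measurable [set x | Q -> A x].
Proof.
have [q|q] := pselect Q => mA.
  by rewrite (_ : [set x | _] = A)//; apply/seteqP; split=> [x /(_ q)|x h _].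
by rewrite (_ : [set x | _] = setT)//; apply/seteqP; split=> x // _ /q.
Qed.

Lemma measurable_le_set (f g : S -> R) : measurable_fun setT f -> measurable_fun setT g ->
  measurable [set x | f x <= g x].
Proof.
move=> mf mg; have := measurable_fun_ler mf mg => /(_ measurableT [set true]).
by rewrite setTI; apply.
Qed.

Lemma measurable_lt_set (f g : S -> R) : measurable_fun setT f -> measurable_fun setT g ->
  measurable [set x | f x < g x].
Proof.
move=> mf mg; have := measurable_fun_ltr mf mg => /(_ measurableT [set true]).
by rewrite setTI; apply.
Qed.

Definition mx_measurable m n (f : S -> 'M[R]_(m, n)) :=
  forall i j, measurable_fun setT (fun x => f x i j).

(** An open set is the union of the countably many balls with rational centre and radius 1 / (q + 1)
    inside it, and a ball of the max norm is a finite intersection of conditions on entries. *)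
Lemma mx_measurableP m n (f : S -> 'M[R]_(m, n)) :
  mx_measurable f <-> measurable_fun setT (f : S -> borel_mx R m n).
Proof.
split=> [mf|mf i j]; last first.
  apply: (measurability _ (RGenOpens.measurableE R)).
  move=> _ [_ [a [b ->]] <-]; rewrite setTI.
  rewrite -[X in measurable X]setTI; apply: (mf _ [set N | `]a, b[%classic (N i j)]) => //.
  apply: sub_sigma_algebra; apply: open_comp (interval_open (a := BRight a) (b := BLeft b) _ _) => //.
  by move=> N _; exact: coord_continuous.
apply: (@measurability _ _ S (borel_mx R m n) setT f (@open 'M[R]_(m, n))) => //.
move=> _ [B oB <-]; rewrite setTI.
pose box (r : 'M[rat]_(m, n)) (q : nat) : set 'M[R]_(m, n) :=
  ball (map_mx ratr r : 'M[R]_(m, n)) q.+1%:R^-1.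
rewrite (_ : f @^-1` B = \bigcup_(rq : 'M[rat]_(m, n) * nat)
    [set x | box rq.1 rq.2 `<=` B /\ box rq.1 rq.2 (f x)]).
  apply: countable_bigcupT_measurable => [|[r q]]; first exact: countableP.
  have [rB|rB] := pselect (box r q `<=` B); last first.
    by rewrite (_ : [set x | _] = set0)//; apply/seteqP; split => x // [].
  rewrite (_ : [set x | _] = [set x | forall ij : 'I_m * 'I_n,
      ball (ratr (r ij.1 ij.2) : R) q.+1%:R^-1 (f x ij.1 ij.2)]).
    apply: measurable_forall => -[i j]; rewrite -[X in measurable X]setTI.
    by apply: mf => //; exact: measurable_ball.
  apply/seteqP; split => x /=.
    by move=> [_ [_ h]] [i j]; have := h i j; rewrite mxE.
  by move=> h; split=> //; split=> // i j; rewrite mxE; exact: (h (i, j)).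
apply/seteqP; split => [x Bfx|x [[r q] _ [h1 h2]]]; last exact: h1.
have /nbhs_ballP[e /= e0 eB] : nbhs (f x) B by apply: open_nbhs_nbhs.
have [q qe] : exists q : nat, 2 * q.+1%:R^-1 < e.
  have := ltr_add_invr (y := 0) (x := e / 2); rewrite divr_gt0// => /(_ isT)[q].
  by rewrite add0r => h; exists q; move: (q.+1%:R^-1) h => z; lra.
have q0 : 0 < q.+1%:R^-1 :> R by rewrite invr_gt0.
have [r xr] := approx_rational_mx (f x) q0.
exists (r, q) => //; split=> [N rN|]; last exact: ball_sym.
apply: eB; apply: le_ball (ltW qe) _ _.
by rewrite mulrC mulr_natr mulr2n; exact: ball_triangle xr rN.
Qed.

End MatrixMeasurability.

Section MeasurableOperations.
Variables (R : realType) (dS : measure_display) (S : measurableType dS).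

Lemma measurable_inv (f : S -> R) : measurable_fun setT f ->
  measurable_fun setT (fun x => (f x)^-1).
Proof.
(* The real power is taken of a square, hence of a nonnegative number; the factor [f x] restores the
   sign, and at a zero of [f] both sides are 0. *)
move=> mf; rewrite (_ : (fun x => _) = fun x => f x * (f x ^+ 2) `^ (-1)).
  apply: measurable_funM => //.
  have := measurableT_comp (measurable_powR (-1)) (measurable_funX 2 mf); exact.
apply: funext => x; rewrite powR_inv1 ?sqr_ge0//.
have [->|f0] := eqVneq (f x) 0; first by rewrite invr0 mul0r.
by rewrite expr2 invfM mulrA divff// mul1r.
Qed.

Lemma measurable_sqrt (f : S -> R) : measurable_fun setT f ->
  measurable_fun setT (fun x => Num.sqrt (f x)).
Proof.
move=> mf; apply: measurableT_comp mf; apply: nondecreasing_measurable => //.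
by move=> x y xy; exact: ler_wsqrtr.
Qed.

Lemma mx_measurable_cst m n (A : 'M[R]_(m, n)) : mx_measurable (fun _ : S => A).
Proof. by move=> i j; exact: measurable_cst. Qed.

Lemma mx_measurableM m n q (f : S -> 'M[R]_(m, n)) (g : S -> 'M[R]_(n, q)) :
  mx_measurable f -> mx_measurable g -> mx_measurable (fun x => f x *m g x).
Proof.
move=> mf mg i j; under eq_fun do rewrite mxE.
by apply: measurable_sum => l; exact: measurable_funM.
Qed.

Lemma mx_measurableB m n (f g : S -> 'M[R]_(m, n)) :
  mx_measurable f -> mx_measurable g -> mx_measurable (fun x => f x - g x).
Proof.
move=> mf mg i j; under eq_fun do rewrite !mxE.
exact: measurable_funB.
Qed.

Lemma mx_measurableT m n (f : S -> 'M[R]_(m, n)) :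
  mx_measurable f -> mx_measurable (fun x => (f x)^T).
Proof. by move=> mf i j; under eq_fun do rewrite mxE; exact: mf. Qed.

Lemma mx_measurable_quad n (f : S -> 'M[R]_n) (w : S -> 'cV[R]_n) :
  mx_measurable f -> mx_measurable w -> measurable_fun setT (fun x => quad (f x) (w x)).
Proof.
move=> mf mw; have := mx_measurableM (mx_measurableM (mx_measurableT mw) mf) mw.
exact.
Qed.

Lemma mx_measurable_expr n (f : S -> 'M[R]_n) t :
  mx_measurable f -> mx_measurable (fun x => f x ^+ t).
Proof.
move=> mf; elim: t => [|t IH]; first exact: mx_measurable_cst.
by move=> i j; under eq_fun do rewrite exprS; exact: (mx_measurableM mf IH).
Qed.

Lemma mx_measurable_normalize n (f : S -> 'cV[R]_n) :
  mx_measurable f -> mx_measurable (fun x => normalize (f x)).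
Proof.
move=> mf i j; under eq_fun do rewrite mxE.
apply: measurable_funM; last exact: mf.
apply/measurable_inv/measurable_sqrt/measurable_sum => l.
exact: measurable_funX.
Qed.

Lemma mx_measurable_glue m n (N : S -> nat) (g : nat -> S -> 'M[R]_(m, n)) :
  (forall t, measurable [set x | N x = t]) -> (forall t, mx_measurable (g t)) ->
  mx_measurable (fun x => g (N x) x).
Proof.
move=> mN mg i j _ B mB; rewrite setTI.
rewrite (_ : _ @^-1` _ = \bigcup_t ([set x | N x = t] `&` (fun x => g t x i j) @^-1` B)).
  apply: bigcupT_measurable => t; apply: measurableI => //.
  by rewrite -[X in measurable X]setTI; exact: mg.
apply/seteqP; split=> [x Bx|x [t _ [/= <-]]//].
by exists (N x).
Qed.

(** Failure of the inequality is an open condition on [x], so it would show at a rational vector.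
    Countably many conditions remain, whence measurability. *)
Lemma top_overlap_rat n tau (M : 'M[R]_n) w : top_overlap tau M w <->
  forall tr : nat * 'rV[rat]_n, let x : 'cV[R]_n := (map_mx ratr tr.2)^T in
    tau * quad (M ^+ tr.1) x <= quad (M ^+ tr.1) w * dotv x x.
Proof.
split=> [h [t r]|h t x]; first exact: h.
pose N := tau *: M ^+ t - (quad (M ^+ t) w)%:M.
have NE y : quad N y = tau * quad (M ^+ t) y - quad (M ^+ t) w * dotv y y.
  by rewrite /N quadD quadN quadZm quad_scalar.
rewrite leNgt -subr_gt0 -NE; apply/negP => bad.
have : open [set y : 'rV[R]_n | 0 < quad N y^T].
  apply: (open_comp (f := fun y : 'rV[R]_n => quad N y^T) (D := [set z | 0 < z])).
    by move=> y _; exact: continuous_quad.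
  exact: open_gt.
rewrite openE => /(_ x^T); rewrite /= trmxK => /(_ bad).
move=> /nbhs_ballP[e /= e0 xe]; have [r xr] := approx_rational_mx x^T e0.
by have := xe _ xr; rewrite /= NE subr_gt0 ltNge; have /= -> := h (t, r).
Qed.

Lemma measurable_top_overlap n tau (M : S -> 'M[R]_n) (w : S -> 'cV[R]_n) :
  mx_measurable M -> mx_measurable w -> measurable [set x | top_overlap tau (M x) (w x)].
Proof.
move=> mM mw.
rewrite (_ : [set x | _] = [set x | forall tr : nat * 'rV[rat]_n,
    let y : 'cV[R]_n := (map_mx ratr tr.2)^T in
    tau * quad (M x ^+ tr.1) y <= quad (M x ^+ tr.1) (w x) * dotv y y]).
  apply: measurable_forall => -[t r] /=; apply: measurable_le_set.
    apply: measurable_funM => //; apply: mx_measurable_quad; last exact: mx_measurable_cst.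
    exact: mx_measurable_expr.
  apply: measurable_funM => //; apply: mx_measurable_quad => //.
  exact: mx_measurable_expr.
by apply/seteqP; split=> x /top_overlap_rat.
Qed.

End MeasurableOperations.

Section MeasurableAppxPCA.
Variables (R : realType) (d : nat) (dT : measure_display) (T : measurableType dT).
Variables (Alg : inverter R d T) (dS : measure_display) (S : measurableType dS).
Hypothesis solve_measurable : forall i j t, measurable_fun setT
  (fun x : (T * (R * borel_mx R d d * borel_mx R d 1 * R))%type =>
    solve Alg x.1 i j t x.2.1.1.1 x.2.1.1.2 x.2.1.2 x.2.2 : borel_mx R d 1).
Variables (tape : S -> T).
Hypothesis tapem : measurable_fun setT tape.

Lemma mx_measurable_solve i j t (lam : S -> R) (M : S -> 'M[R]_d) (b : S -> 'cV[R]_d) eta :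
  measurable_fun setT lam -> mx_measurable M -> mx_measurable b ->
  mx_measurable (fun x => solve Alg (tape x) i j t (lam x) (M x) (b x) eta).
Proof.
move=> ml /mx_measurableP mM /mx_measurableP mb; apply/mx_measurableP.
apply: (measurableT_comp (solve_measurable i j t)
  (g := fun x => (tape x, (lam x, M x : borel_mx R d d, b x : borel_mx R d 1, eta)))).
by do !(apply: measurable_fun_pair => //).
Qed.

Variables (i : nat) (M : S -> 'M[R]_d) (w0 : S -> 'cV[R]_d) (delta eps p : R).
Hypotheses (Mm : mx_measurable M) (w0m : mx_measurable w0).
Local Notation inv x := (solve Alg (tape x) i).

Lemma mx_measurable_power s lam eta t : measurable_fun setT lam ->
  mx_measurable (fun x => pca_power (inv x) (M x) (w0 x) s (lam x) eta t).
Proof. by move=> ml; elim: t => // t IH; exact: mx_measurable_solve. Qed.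

Lemma measurable_Delta s lam : measurable_fun setT lam ->
  measurable_fun setT (fun x => pca_Delta_at (inv x) (M x) delta p (w0 x) s (lam x)).
Proof.
move=> ml; apply: measurable_funM => //; apply: measurable_inv.
apply: measurable_funB => //.
have mw : mx_measurable (fun x => pca_w (inv x) (M x) delta p (w0 x) s (lam x)).
  exact/mx_measurable_normalize/mx_measurable_power.
apply: (mx_measurableM (mx_measurableT mw)).
exact: mx_measurable_solve.
Qed.

Lemma measurable_lambda s :
  measurable_fun setT (fun x => pca_lambda (inv x) (M x) delta p (w0 x) s).
Proof.
elim: s => [|s IH] /=; first exact: measurable_cst.
by apply: measurable_funB => //; apply: measurable_funM => //; exact: measurable_Delta.
Qed.

Lemma measurable_stop s : measurable [set x | pca_stop (inv x) (M x) delta p (w0 x) s].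
Proof.
apply: measurable_le_set; first exact/measurable_Delta/measurable_lambda.
by apply: measurable_funM => //; apply: measurable_funM => //; exact: measurable_lambda.
Qed.

Lemma measurable_final f : measurable [set x | pca_final (inv x) (M x) delta p (w0 x) f].
Proof.
rewrite (_ : [set x | _] = [set x | (0 < f)%N /\
  ([set x | pca_stop (inv x) (M x) delta p (w0 x) f] `&`
   [set x | forall s, (0 < s < f)%N ->
     (~` [set x | pca_stop (inv x) (M x) delta p (w0 x) s]) x]) x]).
  apply/measurable_prop_and/measurableI; first exact: measurable_stop.
  apply: (measurable_forall (F := fun s => [set x | (0 < s < f)%N ->
     (~` [set x | pca_stop (inv x) (M x) delta p (w0 x) s]) x])) => s.
  apply/measurable_prop_imply/measurableC; exact: measurable_stop.
apply/seteqP; split=> x; first by case=> f0 h1 h2; split=> //; split=> // s /h2/negP.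
by case=> f0 [h1 h2]; split=> // s /h2/negP.
Qed.

Lemma measurable_pca_f f : measurable [set x | pca_f (inv x) (M x) delta p (w0 x) = f].
Proof.
have uniq x s t : pca_final (inv x) (M x) delta p (w0 x) s ->
    pca_final (inv x) (M x) delta p (w0 x) t -> s = t.
  move=> [s0 hs ns] [t0 ht nt]; apply/eqP; case: ltngtP => // st.
    by have := nt s; rewrite s0 st hs => /(_ isT).
  by have := ns t; rewrite t0 st ht => /(_ isT).
(* 0 is also the default value of [pca_f] where no stage is final. *)
rewrite (_ : [set x | _] = [set x | pca_final (inv x) (M x) delta p (w0 x) f] `|`
  [set x | f = 0%N /\
    [set x | forall s, (~` [set x | pca_final (inv x) (M x) delta p (w0 x) s]) x] x]).
  apply: measurableU; first exact: measurable_final.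
  apply/measurable_prop_and/(measurable_forall
    (F := fun s => ~` [set x | pca_final (inv x) (M x) delta p (w0 x) s])) => s.
  by apply: measurableC; exact: measurable_final.
apply/seteqP; split=> x.
  rewrite /pca_f/=; case: xgetP => [s -> /= hs <-|h <-]; first by left.
  by right; split=> // s; exact: h.
rewrite /pca_f/=; case=> [hf|[-> h]]; case: xgetP => //.
- by move=> s _ /= hs; exact: uniq hs hf.
- by move=> /(_ f).
- by move=> s _ /h.
Qed.

Lemma measurable_appx_pca :
  mx_measurable (fun x => appx_pca (inv x) (M x) delta eps p (w0 x)).
Proof.
apply: (@mx_measurable_glue _ _ _ _ _
  (fun x => pca_f (inv x) (M x) delta p (w0 x))
  (fun f x => normalize (pca_power (inv x) (M x) (w0 x) f.+1
    (pca_lambda (inv x) (M x) delta p (w0 x) f) (pca_eps2 d delta eps p) (pca_m2 d eps p)))).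
  exact: measurable_pca_f.
by move=> f; apply/mx_measurable_normalize/mx_measurable_power/measurable_lambda.
Qed.

End MeasurableAppxPCA.

Section MeasurableLazySVD.
Variables (R : realType) (d : nat) (dT : measure_display) (T : measurableType dT).
Variables (Alg : inverter R d T) (dS : measure_display) (S : measurableType dS).
Hypothesis solve_measurable : forall i j t, measurable_fun setT
  (fun x : (T * (R * borel_mx R d d * borel_mx R d 1 * R))%type =>
    solve Alg x.1 i j t x.2.1.1.1 x.2.1.1.2 x.2.1.2 x.2.2 : borel_mx R d 1).
Variables (tape : S -> T) (w0 : nat -> S -> 'cV[R]_d) (k : nat) (delta eps p : R).
Variable M : 'M[R]_d.
Hypothesis tapem : measurable_fun setT tape.
Local Notation start x := (fun s => w0 s x).

(** Only start vectors of earlier rounds are assumed measurable, so that this applies to the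
    sigma-algebra of the history before round [s]. *)
Lemma measurable_lazy_mx s : (forall i, (i < s)%N -> mx_measurable (w0 i)) ->
  mx_measurable (fun x => lazy_mx k (solve Alg (tape x)) delta eps p (start x) M s).
Proof.
suff h : (forall i, (i < s)%N -> mx_measurable (w0 i)) ->
    mx_measurable (fun x => lazy_proj k (solve Alg (tape x)) delta eps p (start x) M s) /\
    mx_measurable (fun x => lazy_mx k (solve Alg (tape x)) delta eps p (start x) M s).
  by move=> /h[].
elim: s => [|s IH] w0m.
  split; last exact: mx_measurable_cst.
  by under eq_fun do rewrite lazy_proj0; exact: mx_measurable_cst.
have [Pm Nm] := IH (fun i si => w0m i (ltnW si)).
have vm : mx_measurable (fun x =>
    lazy_vec k (solve Alg (tape x)) delta eps p (start x) M s).
  apply: mx_measurable_normalize; apply: mx_measurableM => //.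
  by apply: measurable_appx_pca => //; exact: w0m.
have vvm := mx_measurableM vm (mx_measurableT vm).
split; first by under eq_fun do rewrite lazy_projS; exact: mx_measurableB.
under eq_fun do rewrite lazy_mxS.
have rm := mx_measurableB (mx_measurable_cst 1%:M) vvm.
exact: mx_measurableM (mx_measurableM rm Nm) rm.
Qed.

End MeasurableLazySVD.

Section IndependentSections.
Local Open Scope ereal_scope.
Variables (R : realType) (dO : measure_display) (Omega : measurableType dO).
Variables (P : probability Omega R) (G : set_system Omega).
Variables (dV : measure_display) (V : measurableType dV) (X : Omega -> V).
Hypotheses (GI : setI_closed G) (GT : G setT) (Gm : G `<=` measurable).
Hypothesis Xm : measurable_fun setT X.
Hypothesis indep : forall A B, G A -> measurable B ->
  P (A `&` X @^-1` B) = P A * P (X @^-1` B).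

Let preimm B : measurable B -> measurable (X @^-1` B).
Proof. by move=> mB; rewrite -[X in measurable X]setTI; exact: Xm. Qed.

(** Both sides are finite measures in [A] that agree on the pi-system [G]. *)
Lemma independent_generated A B : <<s G >> A -> measurable B ->
  P (A `&` X @^-1` B) = P A * P (X @^-1` B).
Proof.
move=> GA mB; have mXB := preimm mB.
have PXB : P (X @^-1` B) = (fine (P (X @^-1` B)))%:E by rewrite fineK// fin_num_measure.
have PXB0 : (0 <= fine (P (X @^-1` B)))%R by rewrite fine_ge0.
rewrite PXB muleC.
pose m1 : {measure set Omega -> \bar R} := mrestr P mXB.
pose m2 : {measure set Omega -> \bar R} := mscale (NngNum PXB0) P.
suff : m1 A = m2 A by [].
apply: (g_sigma_algebra_measure_unique G Gm (fun=> setT) _ _ m1 m2) GA => //.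
- by rewrite bigcup_const.
- by move=> C GC; rewrite /m1 /m2 /= /mrestr /mscale/= -PXB muleC; exact: indep.
- by move=> _; rewrite /m1/= /mrestr setTI (le_lt_trans (probability_le1 P mXB))// ltry.
Qed.

(** The identity, seen as a map to [Omega] with the coarser sigma-algebra, is a random variable
    carrying the whole past. Its joint law with [X] is a product, so the probability of [F] is an
    average of section probabilities. *)
Lemma independent_section_le (F : set (g_sigma_algebraType G * V)) (b : R) :
  measurable F -> (forall x, P [set y | F (x, X y)] <= b%:E) ->
  P [set y | F (y, X y)] <= b%:E.
Proof.
move=> mF Fb.
have sub : <<s G >> `<=` measurable.
  by apply: smallest_sub => //; exact: sigma_algebra_measurable.
have idm : measurable_fun setT (fun y : Omega => y : g_sigma_algebraType G).
  by move=> _ B mB; rewrite setTI; exact: sub.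
have jm : measurable_fun setT (fun y : Omega => (y : g_sigma_algebraType G, X y)).
  exact: measurable_fun_pair.
pose idX : {mfun Omega >-> g_sigma_algebraType G} := mfun_Sub (mem_set idm).
pose XX : {mfun Omega >-> V} := mfun_Sub (mem_set Xm).
pose jX : {mfun Omega >-> (g_sigma_algebraType G * V)%type} := mfun_Sub (mem_set jm).
have jE : (distribution P idX \x distribution P XX) F = distribution P jX F.
  apply: product_measure_unique => // A B mA mB.
  exact: independent_generated.
rewrite (_ : P _ = distribution P jX F)// -jE /product_measure1.
apply: (@le_trans _ _ (\int[distribution P idX]_x (cst b%:E x))).
  apply: ge0_le_integral => //.
  - exact: measurable_fun_xsection.
  - by move=> x _; apply: le_trans (Fb x); rewrite /= xsectionE.
by rewrite integral_cst//= probability_setT mule1.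
Qed.

End IndependentSections.

Section History.
Variables (R : realType) (dO : measure_display) (Omega : measurableType dO).
Variables (P : probability Omega R) (dT : measure_display) (T : measurableType dT).
Variables (tape : Omega -> T) (d k : nat) (w0 : nat -> Omega -> 'cV[R]_d).
Hypothesis tapem : measurable_fun setT tape.
Hypothesis w0m : forall s, (s < k)%N -> measurable_fun setT (w0 s : Omega -> borel_mx R d 1).
Hypothesis ind : mutually_independent P tape k w0.

Definition tape_start_event C (B : nat -> set (borel_mx R d 1)) s : set Omega :=
  [set omega | C (tape omega) /\ forall i, (i < s)%N -> B i (w0 i omega)].

(* A pi-system generating the information revealed before round s. *)
Definition history s : set_system Omega :=
  [set A | exists C B, [/\ measurable C, forall i, measurable (B i) & A = tape_start_event C B s]].

Lemma history_setI s : setI_closed (history s).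
Proof.
move=> _ _ [C [B [mC mB ->]]] [C' [B' [mC' mB' ->]]].
exists (C `&` C'), (fun i => B i `&` B' i); split=> [|i|]; try exact: measurableI.
apply/seteqP; split=> omega /= [].
  by move=> [c b] [c' b']; split=> // i si; split; [exact: b|exact: b'].
by move=> [c c'] bb; split; split=> // i si; have [] := bb i si.
Qed.

Lemma history_setT s : history s setT.
Proof. by exists setT, (fun=> setT); split=> //; apply/seteqP. Qed.

Lemma measurable_history s : (s <= k)%N -> history s `<=` measurable.
Proof.
move=> sk _ [C [B [mC mB ->]]]; apply: measurableI.
  by rewrite -[X in measurable X]setTI; exact: tapem.
apply: (measurable_forall (F := fun i => [set omega | (i < s)%N -> B i (w0 i omega)])) => i.
have [si|si] := ltnP i s; last first.
  by rewrite (_ : [set _ | _] = setT)//; apply/seteqP.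
apply: (measurable_prop_imply true).
by rewrite -[X in measurable X]setTI; apply: w0m; rewrite ?(leq_trans si).
Qed.

Lemma history_tape s : measurable_fun setT (tape : g_sigma_algebraType (history s) -> T).
Proof.
move=> _ C mC; rewrite setTI; apply: sub_sigma_algebra.
by exists C, (fun=> setT); split=> //; apply/seteqP; split=> omega // [].
Qed.

Lemma history_start s i : (i < s)%N ->
  mx_measurable (w0 i : g_sigma_algebraType (history s) -> 'cV[R]_d).
Proof.
move=> si; apply/mx_measurableP => _ B mB; rewrite setTI; apply: sub_sigma_algebra.
exists setT, (fun j => if j == i then B else setT); split=> // [j|]; first by case: eqP.
apply/seteqP; split=> omega.
  by move=> h; split=> // j _; case: eqP => // ->.
by move=> [_ /(_ i si)]; rewrite eqxx.
Qed.

Lemma history_independent s A B : (s < k)%N -> history s A -> measurable B ->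
  P (A `&` (w0 s : Omega -> borel_mx R d 1) @^-1` B) = (P A * P (w0 s @^-1` B))%E.
Proof.
move=> sk GA mB; have mA : measurable A by apply: (measurable_history (ltnW sk)).
have mW : measurable ((w0 s : Omega -> borel_mx R d 1) @^-1` B).
  by rewrite -[X in measurable X]setTI; exact: w0m.
case: GA => [C [B0 [mC mB0 AE]]].
(* Full sets stand after round [s]. The choices D = B and D = setT leave the same product over the
   other rounds, which therefore need not be evaluated. *)
pose Bs (D : set (borel_mx R d 1)) i := if (i < s)%N then B0 i else if i == s then D else setT.
have mBs D i : measurable D -> measurable (Bs D i) by rewrite /Bs; case: ifP => // _; case: ifP.
have BsE D : [set omega | C (tape omega) /\ forall i, (i < k)%N -> Bs D i (w0 i omega)] =
    A `&` w0 s @^-1` D.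
  rewrite AE; apply/seteqP; split=> omega.
    move=> [c h]; split; last by have := h s sk; rewrite /Bs ltnn eqxx.
    by split=> // i si; have := h i (ltn_trans si sk); rewrite /Bs si.
  move=> [[c h] w]; split=> // i ik; rewrite /Bs; case: ifP => [/h//|_].
  by case: eqP => // ->.
have indE (D : set (borel_mx R d 1)) : measurable D ->
    fine (P (A `&` w0 s @^-1` D)) = fine (P [set omega | C (tape omega)]) *
    (fine (P (w0 s @^-1` D)) *
     \prod_(i < k | i != Ordinal sk) fine (P [set omega | Bs setT i (w0 i omega)])).
  move=> mD; rewrite -BsE (ind mC (fun i _ => mBs D i mD)) (bigD1 (Ordinal sk))//=.
  congr (_ * (_ * _)); first by rewrite /Bs ltnn eqxx.
  by apply: eq_bigr => i ni; rewrite /Bs; case: ifP => // _;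
    case: eqP => // si; rewrite -val_eqE /= si eqxx in ni.
have AT : P A = P (A `&` w0 s @^-1` setT) by rewrite preimage_setT setIT.
rewrite -[LHS]fineK ?fin_num_measure//; last exact: measurableI.
rewrite -[P A]fineK ?fin_num_measure// -[P (_ @^-1` B)]fineK ?fin_num_measure// -EFinM.
rewrite AT indE// indE// preimage_setT probability_setT mul1r.
by congr (_%:E); rewrite mulrA mulrAC.
Qed.

End History.

(** * Anti-concentration on the sphere *)

Section Reflection.
Variables (R : realType) (d : nat).
Implicit Types (v x q : 'cV[R]_d) (i j : 'I_d).

(** The Householder reflection; as the inverse of 0 is 0, it is the identity for v = 0. *)
Definition reflection v : 'M[R]_d := 1%:M - (2 / dotv v v) *: (v *m v^T).

Lemma reflectionE v x : reflection v *m x = x - (2 / dotv v v * dotv v x) *: v.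
Proof.
rewrite mulmxBl mul1mx -scalemxAl -mulmxA; congr (_ - _).
rewrite -scalerA; congr (_ *: _); apply/matrixP => i j.
by rewrite !mxE big_ord1 (ord1 j) mulrC.
Qed.

Lemma reflection_orthogonal v : orthogonal_mx (reflection v).
Proof.
have rT : (reflection v)^T = reflection v.
  by rewrite /reflection linearB /= trmx1 linearZ /= trmx_mul trmxK.
rewrite /orthogonal_mx rT; apply/matrixP => i j.
suff h x : reflection v *m (reflection v *m x) = x.
  have := congr1 (fun y : 'cV[R]_d => y i 0) (h (delta_mx j 0)).
  by rewrite mulmxA -colE !mxE eqxx andbT.
rewrite 2!reflectionE; have [->|v0] := eqVneq v 0; first by rewrite !scaler0 !subr0.
have vv : dotv v v != 0 by rewrite dotvv_eq0.
rewrite dotvBr dotvZr -addrA -opprD -scalerDl.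
have -> (u w : R) : u != 0 -> 2 / u * w + 2 / u * (w - 2 / u * w * u) = 0 by move=> ?; field.
  by rewrite scale0r subr0.
by [].
Qed.

(** The reflection in the difference of [q] and the i-th axis vector exchanges these unit vectors;
    being symmetric, it turns the i-th coordinate into the inner product with [q]. *)
Lemma reflection_to_axis q i : norm2 q = 1 ->
  exists2 Q : 'M[R]_d, orthogonal_mx Q & forall x, (Q *m x) i 0 = dotv q x.
Proof.
move=> q1; pose e : 'cV[R]_d := delta_mx i 0; pose v := q - e.
have ex x : dotv e x = x i 0.
  rewrite dotvE (bigD1 i)//= big1 ?mxE ?eqxx ?mul1r ?addr0// => j ji.
  by rewrite mxE (negPf ji) mul0r.
exists (reflection v) => [|x]; first exact: reflection_orthogonal.
rewrite reflectionE -ex dotvBr dotvZr.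
have vv : dotv v v = 2 - 2 * q i 0.
  rewrite dotvBl !dotvBr (dotvC q e) !ex dotv_eq1//.
  by have -> : e i 0 = 1; [rewrite mxE !eqxx|lra].
have ev : dotv e v = q i 0 - 1 by rewrite dotvBr !ex mxE eqxx.
have [v0|v0] := eqVneq (dotv v v) 0.
  move/eqP: v0; rewrite dotvv_eq0 => /eqP v0.
  by rewrite v0 !dotv0r mulr0 subr0; move/eqP: v0; rewrite subr_eq0 => /eqP ->.
have -> : dotv q x = dotv v x + dotv e x by rewrite -dotvDl subrK.
rewrite ev.
have -> : q i 0 - 1 = - (dotv v v / 2) by rewrite vv; lra.
by move: (dotv v v) (dotv v x) (dotv e x) v0 => u b1 b2 u0; field.
Qed.

(** In the (i, j)-plane the rows are (cos, sin) and (sin, -cos), with [a] the tangent of half the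
    angle, so all estimates are algebraic. For a = 0 only the j-th coordinate changes sign;
    comparing [a] with 0 amounts to a rotation. *)
Definition plane_reflection i j (a : R) := reflection (a *: delta_mx i 0 - delta_mx j 0).

Lemma plane_reflectionE i j a x : i != j ->
  (plane_reflection i j a *m x) i 0 =
    (1 - a ^+ 2) / (1 + a ^+ 2) * x i 0 + 2 * a / (1 + a ^+ 2) * x j 0 /\
  (plane_reflection i j a *m x) j 0 =
    2 * a / (1 + a ^+ 2) * x i 0 - (1 - a ^+ 2) / (1 + a ^+ 2) * x j 0.
Proof.
move=> ij; have a1 : 1 + a ^+ 2 != 0.
  by rewrite gt_eqF// ltr_pwDl// sqr_ge0.
have ex (l : 'I_d) (y : 'cV[R]_d) : dotv (delta_mx l 0) y = y l 0.
  rewrite dotvE (bigD1 l)//= big1 ?mxE ?eqxx ?mul1r ?addr0// => l' ll.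
  by rewrite mxE (negPf ll) mul0r.
pose v : 'cV[R]_d := a *: delta_mx i 0 - delta_mx j 0.
have vx : dotv v x = a * x i 0 - x j 0 by rewrite dotvBl dotvZl !ex.
have vv : dotv v v = 1 + a ^+ 2.
  rewrite dotvBl dotvZl !ex !mxE !eqxx (negPf ij) (eq_sym j i) (negPf ij) /=.
  by ring.
rewrite /plane_reflection reflectionE -/v vx vv !mxE !eqxx (negPf ij) (eq_sym j i) (negPf ij) /=.
by split; field.
Qed.

End Reflection.

Section Clamp.
Variables (R : realType) (T : R).
Hypothesis T01 : 0 <= T <= 1.

Definition clamp (y : R) := Num.max (- T) (Num.min y T).

Lemma clamp_norm y : `|clamp y| <= T.
Proof.
rewrite /clamp ler_norml le_max lexx /= ge_max ge_min lexx orbT andbT.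
by have := T01; lra.
Qed.

Lemma clamp_id y : `|y| <= T -> clamp y = y.
Proof. by rewrite ler_norml => /andP[y1 y2]; rewrite /clamp min_l// max_r. Qed.

Lemma clamp_mono y z : y <= z -> 0 <= clamp z - clamp y <= z - y.
Proof.
move=> yz; rewrite /clamp; have := T01.
by case: (leP z T) => h1; case: (leP y T) => h2; case: (leP (- T) z) => h3;
  case: (leP (- T) y) => h4; case: (leP (- T) T) => h5; lra.
Qed.

Lemma clamp_lipschitz y z : `|clamp z - clamp y| <= `|z - y|.
Proof.
wlog yz : y z / y <= z => [h|].
  by case: (leP y z) => [/h//|/ltW/h]; rewrite distrC (distrC y).
by have /andP[h1 h2] := clamp_mono yz; rewrite !ger0_norm// subr_ge0.
Qed.

(* One step of the infinitesimal rotation in the (x, y)-plane applied to the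
   test function y * clamp x. *)
Lemma rotation_drift (x y a t c s : R) : 0 <= a -> t + 2 * a <= T -> `|x| <= 1 -> `|y| <= 1 ->
  c = (1 - a ^+ 2) / (1 + a ^+ 2) -> s = 2 * a / (1 + a ^+ 2) ->
  (s * x - c * y) * clamp (c * x + s * y) + y * clamp x <=
  s * (T * `|x| + 2 * a - y ^+ 2 * (`|x| <= t)%R%:R).
Proof.
move=> a0 tT x1 y1 c_def s_def.
have a1 : 0 < 1 + a ^+ 2 by rewrite ltr_pwDl// sqr_ge0.
have s0 : 0 <= s by rewrite s_def divr_ge0 ?mulr_ge0// ltW.
have s2a : s <= 2 * a by rewrite s_def ler_pdivrMr// ler_peMr ?mulr_ge0// lerDl sqr_ge0.
have cE : c = 1 - a * s by rewrite c_def s_def; field; rewrite gt_eqF.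
set A := clamp (c * x + s * y); set B := clamp x; pose Z := clamp (x + s * y).
have hA : `|A| <= T by exact: clamp_norm.
have as0 : 0 <= a * s by exact: mulr_ge0.
have h1 : s * (x * A) <= s * (T * `|x|).
  rewrite ler_wpM2l// (le_trans (ler_norm _))// normrM mulrC ler_wpM2r//.
have h2 : a * s * (y * A) <= a * s.
  rewrite -[leRHS]mulr1 ler_wpM2l// (le_trans (ler_norm _))// normrM.
  by rewrite -[leRHS]mulr1 ler_pM// (le_trans hA)//; case/andP: T01.
have h3 : y * (Z - A) <= a * s.
  rewrite (le_trans (ler_norm _))// normrM -[leRHS]mul1r ler_pM//.
  rewrite (le_trans (clamp_lipschitz _ _))//.
  have -> : x + s * y - (c * x + s * y) = a * s * x by rewrite cE; ring.
  by rewrite normrM ger0_norm// -[leRHS]mulr1 ler_wpM2l.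
(* Inside the strip both arguments lie in [-T, T] and the increment is exactly s y; outside,
   monotonicity of [clamp] makes the product nonnegative. *)
have h4 : s * (y ^+ 2 * (`|x| <= t)%R%:R) <= y * (Z - B).
  case: (leP `|x| t) => xt; rewrite ?mulr1 ?mulr0.
    have sy : `|s * y| <= 2 * a.
      by rewrite normrM ger0_norm// -[leRHS]mulr1 ler_pM.
    rewrite /Z /B !clamp_id.
    - by rewrite le_eqVlt; apply/orP; left; apply/eqP; ring.
    - by apply: le_trans xt _; move: tT a0; lra.
    - by apply: le_trans (ler_normD _ _) _; apply: le_trans tT; exact: lerD.
  have [y0|y0] := leP 0 y.
    apply: mulr_ge0 => //; have xz : x <= x + s * y by rewrite lerDl mulr_ge0.
    by case/andP: (clamp_mono xz).
  rewrite -mulrNN; apply: mulr_ge0; first by rewrite oppr_ge0 ltW.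
  have xz : x + s * y <= x by rewrite gerDl mulr_ge0_le0// ltW.
  by rewrite opprB; case/andP: (clamp_mono xz).
have -> : (s * x - c * y) * A + y * B = s * (x * A) + a * s * (y * A) + y * (Z - A) - y * (Z - B).
  by rewrite cE; ring.
have -> : s * (T * `|x| + 2 * a - y ^+ 2 * (`|x| <= t)%R%:R) =
    s * (T * `|x|) + a * s + a * s - s * (y ^+ 2 * (`|x| <= t)%R%:R) by ring.
by rewrite lerB// lerD// lerD.
Qed.

End Clamp.

Section SphereExpectation.
Variables (R : realType) (dO : measure_display) (Omega : measurableType dO).
Variables (P : probability Omega R) (d : nat) (X : Omega -> 'cV[R]_d).
Hypothesis XU : uniform_unit_vector P X.

(** Boundedness on the sphere alone suffices for integrability along unit vectors, and coordinates
    satisfy it. *)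
Definition sphere_bounded (f : 'cV[R]_d -> R) :=
  measurable_fun setT (f : borel_mx R d 1 -> R) /\
  exists K, forall x, norm2 x = 1 -> `|f x| <= K.

Definition mean (f : 'cV[R]_d -> R) : R := \int[P]_w f (X w).

Lemma sphere_bounded_integrable (Y : Omega -> 'cV[R]_d) f : sphere_bounded f ->
  measurable_fun setT (Y : Omega -> borel_mx R d 1) -> (forall w, norm2 (Y w) = 1) ->
  P.-integrable setT (EFin \o (fun w => f (Y w))).
Proof.
move=> [mf [K fK]] mY Y1; apply: measurable_bounded_integrable => //.
- by rewrite (le_lt_trans (probability_le1 P measurableT))// ltry.
- exact: measurableT_comp mf mY.
- exists K; split; first exact: num_real.
  by move=> K' KK' w _ /=; apply: le_trans (fK _ (Y1 w)) (ltW KK').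
Qed.

Lemma mean_orthogonal f (Q : 'M[R]_d) : sphere_bounded f -> orthogonal_mx Q ->
  mean (fun x => f (Q *m x)) = mean f.
Proof.
move=> fb Qo; have [mX X1 Xinv] := XU.
have mQX : measurable_fun setT ((fun w => Q *m X w) : Omega -> borel_mx R d 1).
  apply/mx_measurableP/mx_measurableM; first exact: mx_measurable_cst.
  exact/mx_measurableP.
have QX1 w : norm2 (Q *m X w) = 1.
  by rewrite norm2_eq1// dotvMl mulmxA (orthogonal_mxC Qo) mul1mx dotv_eq1.
pose XX : {mfun Omega >-> borel_mx R d 1} := mfun_Sub (mem_set mX).
pose QX : {mfun Omega >-> borel_mx R d 1} := mfun_Sub (mem_set mQX).
have mf : measurable_fun setT (EFin \o (f : borel_mx R d 1 -> R)).
  by apply/measurable_EFinP; case: fb.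
have eX := integral_distribution (P := P) (X := XX) mf (sphere_bounded_integrable fb mX X1).
have eQ := integral_distribution (P := P) (X := QX) mf (sphere_bounded_integrable fb mQX QX1).
congr fine; rewrite -[LHS]eQ -[RHS]eX.
by apply: eq_measure_integral => B mB _; exact: Xinv.
Qed.

Lemma sphere_boundedD f g : sphere_bounded f -> sphere_bounded g ->
  sphere_bounded (fun x => f x + g x).
Proof.
move=> [mf [K fK]] [mg [L gL]]; split; first exact: measurable_funD.
by exists (K + L) => x x1; apply: le_trans (ler_normD _ _) (lerD (fK x x1) (gL x x1)).
Qed.

Lemma sphere_boundedM f g : sphere_bounded f -> sphere_bounded g ->
  sphere_bounded (fun x => f x * g x).
Proof.
move=> [mf [K fK]] [mg [L gL]]; split; first exact: measurable_funM.
by exists (K * L) => x x1; rewrite normrM ler_pM// ?fK ?gL.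
Qed.

Lemma sphere_bounded_cst c : sphere_bounded (fun=> c).
Proof. by split; [exact: measurable_cst|exists `|c|]. Qed.

Lemma sphere_coord_le1 (x : 'cV[R]_d) i : norm2 x = 1 -> `|x i 0| <= 1.
Proof.
move=> x1; rewrite -(ler_pXn2r (n := 2))// ?nnegrE// expr1n -normrX ger0_norm ?sqr_ge0//.
by rewrite -(dotv_eq1 x1) dotvvE (bigD1 i)//= lerDl sumr_ge0// => j _; exact: sqr_ge0.
Qed.

Lemma sphere_bounded_coord i : sphere_bounded (fun x => x i 0).
Proof.
split; last by exists 1 => x; exact: sphere_coord_le1.
by have /mx_measurableP := @measurable_id _ (borel_mx R d 1) setT; apply.
Qed.

Lemma sphere_bounded_comp (g : R -> R) K i : measurable_fun setT g ->
  (forall y, `|g y| <= K) -> sphere_bounded (fun x => g (x i 0)).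
Proof.
move=> mg gK; split; last by exists K.
exact: measurableT_comp mg (sphere_bounded_coord i).1.
Qed.

Lemma sphere_bounded_mulmx f (Q : 'M[R]_d) : orthogonal_mx Q ->
  sphere_bounded f -> sphere_bounded (fun x => f (Q *m x)).
Proof.
move=> Qo [mf [K fK]]; split.
  apply: measurableT_comp mf _; apply/mx_measurableP/mx_measurableM.
    exact: mx_measurable_cst.
  apply/mx_measurableP; exact: measurable_id.
exists K => x x1; apply: fK; rewrite norm2_eq1// dotvMl mulmxA (orthogonal_mxC Qo) mul1mx.
exact: dotv_eq1.
Qed.

Let intX f (fb : sphere_bounded f) : P.-integrable setT (EFin \o (fun w => f (X w))).
Proof. by have [mX X1 _] := XU; exact: sphere_bounded_integrable. Qed.

Lemma meanD f g : sphere_bounded f -> sphere_bounded g ->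
  mean (fun x => f x + g x) = mean f + mean g.
Proof. by move=> fb gb; rewrite /mean RintegralD//; exact: intX. Qed.

Lemma meanZ c f : sphere_bounded f -> mean (fun x => c * f x) = c * mean f.
Proof. by move=> fb; rewrite /mean RintegralZl//; exact: intX. Qed.

Lemma mean_cst c : mean (fun=> c) = c.
Proof.
rewrite /mean Rintegral_cst// -[RHS]mulr1; congr (_ * _).
exact: (congr1 fine (probability_setT P)).
Qed.

Lemma eq_mean f g : (forall x, norm2 x = 1 -> f x = g x) -> mean f = mean g.
Proof. by move=> fg; apply: eq_Rintegral => w _; apply: fg; have [] := XU. Qed.

Lemma mean_le f g : sphere_bounded f -> sphere_bounded g ->
  (forall x, norm2 x = 1 -> f x <= g x) -> mean f <= mean g.
Proof.
move=> fb gb fg; apply: le_Rintegral => //; try exact: intX.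
by move=> w _; apply: fg; have [] := XU.
Qed.

Lemma sphere_bounded_sum (r : seq 'I_d) (Q : pred 'I_d) (f : 'I_d -> 'cV[R]_d -> R) :
  (forall i, sphere_bounded (f i)) -> sphere_bounded (fun x => \sum_(i <- r | Q i) f i x).
Proof.
move=> fb; elim: r => [|i r IH].
  by under eq_fun do rewrite big_nil; exact: sphere_bounded_cst.
under eq_fun do rewrite big_cons.
by case: (Q i) => //; exact: sphere_boundedD.
Qed.

Lemma mean_sum (r : seq 'I_d) (Q : pred 'I_d) (f : 'I_d -> 'cV[R]_d -> R) :
  (forall i, sphere_bounded (f i)) ->
  mean (fun x => \sum_(i <- r | Q i) f i x) = \sum_(i <- r | Q i) mean (f i).
Proof.
move=> fb; elim: r => [|i r IH].
  by rewrite big_nil -[RHS](mean_cst 0); apply: eq_mean => x _; rewrite big_nil.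
rewrite big_cons; case: ifP => Qi; rewrite -IH.
  rewrite -meanD//; last exact: sphere_bounded_sum.
  by apply: eq_mean => x _; rewrite big_cons Qi.
by apply: eq_mean => x _; rewrite big_cons Qi.
Qed.

(** For a = 1 the plane reflection exchanges two coordinates, so all squares have the same mean, and
    they sum to 1. *)
Lemma mean_sqr_coord i : mean (fun x : 'cV[R]_d => x i 0 ^+ 2) = d%:R^-1.
Proof.
have sb (j : 'I_d) : sphere_bounded (fun x : 'cV[R]_d => x j 0 ^+ 2).
  by under eq_fun do rewrite expr2; apply: sphere_boundedM; exact: sphere_bounded_coord.
have same j : mean (fun x : 'cV[R]_d => x j 0 ^+ 2) = mean (fun x : 'cV[R]_d => x i 0 ^+ 2).
  have [->//|ji] := eqVneq j i.
  rewrite -(mean_orthogonal (sb j) (reflection_orthogonal (1 *: delta_mx j 0 - delta_mx i 0))).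
  apply: eq_mean => x _; have [-> _] := plane_reflectionE 1 x ji.
  by congr (_ ^+ 2); field.
have d0 : d%:R != 0 :> R by rewrite pnatr_eq0 -lt0n (leq_ltn_trans _ (ltn_ord i)).
apply: (mulfI d0); rewrite divff//.
transitivity (mean (fun x : 'cV[R]_d => \sum_i x i 0 ^+ 2)).
  by rewrite mean_sum// (eq_bigr _ (fun j _ => same j)) sumr_const card_ord mulr_natl.
rewrite -[RHS](mean_cst 1); apply: eq_mean => x x1.
by rewrite -dotvvE dotv_eq1.
Qed.

Section AntiConcentration.
Variables (i : 'I_d) (a t T : R).
Hypotheses (a0 : 0 < a) (T01 : 0 <= T <= 1) (tT : t + 2 * a <= T).
Let ind (x : 'cV[R]_d) : R := (`|x i 0| <= t)%R%:R.

Let ind_bounded : sphere_bounded ind.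
Proof.
apply: (@sphere_bounded_comp (fun y : R => (`|y| <= t)%R%:R) 1) => [|y];
  last by rewrite normr_nat lern1 leq_b1.
rewrite (_ : (fun y : R => _) = fun y : R => if `|y| <= t then 1 else 0 : R); last first.
  by apply: funext => y; case: (_ <= _).
by apply: measurable_fun_ifT => //; apply: measurable_fun_ler.
Qed.

Let sqr_bounded (j : 'I_d) : sphere_bounded (fun x : 'cV[R]_d => x j 0 ^+ 2).
Proof.
by under eq_fun do rewrite expr2; apply: sphere_boundedM; exact: sphere_bounded_coord.
Qed.

Let clamp_bounded : sphere_bounded (fun x : 'cV[R]_d => clamp T (x i 0)).
Proof.
apply: sphere_bounded_comp (clamp_norm T01).
by apply: measurable_maxr => //; exact: measurable_minr.
Qed.

(** The two reflected test functions have equal means, so the drift bound has nonnegative mean. The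
    mean of |u|, u = x_i, is controlled by |u| <= (sqrt d / 2) u^2 + 1 / (2 sqrt d), which turns the
    second moment 1 / d into 1 / sqrt d. *)
Lemma mean_sqr_strip j : j != i ->
  mean (fun x : 'cV[R]_d => x j 0 ^+ 2 * ind x) <= T / Num.sqrt d%:R + 2 * a.
Proof.
move=> ji; have ij : i != j by rewrite eq_sym.
have d0 : (0 < d)%N by exact: leq_ltn_trans (ltn_ord i).
have sd : 0 < Num.sqrt d%:R :> R by rewrite sqrtr_gt0 ltr0n.
have sd2 : Num.sqrt d%:R ^+ 2 = d%:R :> R by rewrite sqr_sqrtr.
set sq := Num.sqrt d%:R in sd sd2 *.
pose c : R := (1 - a ^+ 2) / (1 + a ^+ 2); pose s : R := 2 * a / (1 + a ^+ 2).
have a1 : 0 < 1 + a ^+ 2 by rewrite ltr_pwDl// sqr_ge0.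
have s0 : 0 < s by rewrite divr_gt0// mulr_gt0.
pose F (x : 'cV[R]_d) := x j 0 * clamp T (x i 0).
have Fb : sphere_bounded F by apply: sphere_boundedM => //; exact: sphere_bounded_coord.
pose rot b := plane_reflection i j b : 'M[R]_d.
have Frb b : sphere_bounded (fun x => F (rot b *m x)).
  by apply: sphere_bounded_mulmx => //; exact: reflection_orthogonal.
have mF b : mean (fun x => F (rot b *m x)) = mean F.
  by apply: mean_orthogonal => //; exact: reflection_orthogonal.
pose g (x : 'cV[R]_d) := T * (sq / 2 * x i 0 ^+ 2 + (2 * sq)^-1) + 2 * a.
have gb : sphere_bounded g.
  apply: sphere_boundedD; last exact: sphere_bounded_cst.
  apply: sphere_boundedM; first exact: sphere_bounded_cst.
  apply: sphere_boundedD; last exact: sphere_bounded_cst.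
  by apply: sphere_boundedM => //; exact: sphere_bounded_cst.
have jb : sphere_bounded (fun x : 'cV[R]_d => x j 0 ^+ 2 * ind x) by exact: sphere_boundedM.
have Nb f : sphere_bounded f -> sphere_bounded (fun x => -1 * f x).
  by move=> fb; apply: sphere_boundedM => //; exact: sphere_bounded_cst.
have key : mean (fun x => F (rot a *m x) + -1 * F (rot 0 *m x)) <=
    mean (fun x : 'cV[R]_d => s * (g x + -1 * (x j 0 ^+ 2 * ind x))).
  apply: mean_le.
  - by apply: sphere_boundedD; last exact: Nb.
  - apply: sphere_boundedM; first exact: sphere_bounded_cst.
    by apply: sphere_boundedD; last exact: Nb.
  move=> x x1; have [ri rj] : (rot a *m x) i 0 = c * x i 0 + s * x j 0 /\
    (rot a *m x) j 0 = s * x i 0 - c * x j 0 := plane_reflectionE a x ij.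
  have [ri0 rj0] := plane_reflectionE 0 x ij.
  have {ri0} ri0 : (rot 0 *m x) i 0 = x i 0.
    by rewrite ri0 expr0n /= subr0 addr0 mulr0 !divr1 mul0r mul1r addr0.
  have {rj0} rj0 : (rot 0 *m x) j 0 = - x j 0.
    by rewrite rj0 expr0n /= subr0 addr0 mulr0 !divr1 mul0r mul1r sub0r.
  have -> : F (rot a *m x) + -1 * F (rot 0 *m x) =
      (s * x i 0 - c * x j 0) * clamp T (c * x i 0 + s * x j 0) + x j 0 * clamp T (x i 0).
    by rewrite /F ri rj ri0 rj0; ring.
  have xi1 := sphere_coord_le1 i x1; have xj1 := sphere_coord_le1 j x1.
  apply: le_trans (rotation_drift T01 (ltW a0) tT xi1 xj1 (erefl c) (erefl s)) _.
  rewrite ler_pM2l// mulN1r lerD2r lerD2r ler_wpM2l//; first by case/andP: T01.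
  have -> : x i 0 ^+ 2 = `|x i 0| ^+ 2 by rewrite -normrX ger0_norm ?sqr_ge0.
  have : 0 <= (sq * `|x i 0| - 1) ^+ 2 / (2 * sq).
    by rewrite divr_ge0 ?sqr_ge0// mulr_ge0// ltW.
  rewrite (_ : _ / _ = sq / 2 * `|x i 0| ^+ 2 + (2 * sq)^-1 - `|x i 0|) ?subr_ge0//.
  by field; rewrite gt_eqF.
have gjb : sphere_bounded (fun x : 'cV[R]_d => g x + -1 * (x j 0 ^+ 2 * ind x)).
  exact: sphere_boundedD gb (Nb _ jb).
move: key; rewrite (meanD (Frb a) (Nb _ (Frb 0))) (meanZ (-1) (Frb 0)) (mF a) (mF 0).
rewrite mulN1r subrr (meanZ s gjb) pmulr_rge0// (meanD gb (Nb _ jb)) (meanZ (-1) jb).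
rewrite mulN1r subr_ge0 => /le_trans; apply.
rewrite /g meanD; last exact: sphere_bounded_cst; last first.
  apply: sphere_boundedM; first exact: sphere_bounded_cst.
  apply: sphere_boundedD; last exact: sphere_bounded_cst.
  by apply: sphere_boundedM => //; exact: sphere_bounded_cst.
rewrite mean_cst lerD2r meanZ; last first.
  apply: sphere_boundedD; last exact: sphere_bounded_cst.
  by apply: sphere_boundedM => //; exact: sphere_bounded_cst.
rewrite meanD; last exact: sphere_bounded_cst; last first.
  by apply: sphere_boundedM => //; exact: sphere_bounded_cst.
rewrite meanZ// mean_cst mean_sqr_coord -sd2.
by rewrite le_eqVlt; apply/orP; left; apply/eqP; field; rewrite gt_eqF.
Qed.

(** Sum the previous bound over j: on the strip the other squares add up to 1 - x_i^2 >= 1 - T^2. *)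
Lemma strip_probability :
  (1 - T ^+ 2) * fine (P [set w | `|X w i 0| <= t]) <=
  (d%:R - 1) * (T / Num.sqrt d%:R + 2 * a).
Proof.
have [mX X1 _] := XU.
have mA : measurable [set w | `|X w i 0| <= t].
  apply: measurable_le_set => //; apply: measurableT_comp => //.
  by move/mx_measurableP: mX; apply.
have -> : fine (P [set w | `|X w i 0| <= t]) = mean ind.
  congr fine; rewrite -[in LHS](setIT [set w | _]) -integral_indic//.
  by apply: eq_integral => w _; rewrite indicE mem_setE.
rewrite -meanZ//; apply: (@le_trans _ _ (mean (fun x : 'cV[R]_d => \sum_(j | j != i) x j 0 ^+ 2 * ind x))).
  apply: mean_le.
  - by apply: sphere_boundedM => //; exact: sphere_bounded_cst.
  - by apply: sphere_bounded_sum => j; exact: sphere_boundedM.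
  move=> x x1; rewrite -mulr_suml /ind; case: (leP `|x i 0| t) => xt; rewrite ?mulr0// !mulr1.
  have := dotv_eq1 x1; rewrite dotvvE (bigD1 i)//= => <-.
  rewrite addrAC gerDr subr_le0 -[leLHS]real_normK ?num_real// ler_sqr ?nnegrE//.
    by move: a0 tT; lra.
  by case/andP: T01.
rewrite mean_sum; last by move=> j; exact: sphere_boundedM.
apply: (@le_trans _ _ (\sum_(j < d | j != i) (T / Num.sqrt d%:R + 2 * a))).
  by apply: ler_sum => j; exact: mean_sqr_strip.
rewrite sumr_const -[leLHS]mulr_natl cardC1 card_ord; apply: ler_wpM2r.
  apply: addr_ge0 (divr_ge0 _ (sqrtr_ge0 _)) (mulr_ge0 _ (ltW a0)) => //.
  by case/andP: T01.
by rewrite -subn1 natrB// (leq_ltn_trans _ (ltn_ord i)).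
Qed.

End AntiConcentration.

Lemma pca_overlap_probability q p : norm2 q = 1 -> 0 < p < 1 ->
  (P [set w | dotv q (X w) ^+ 2 < (p / (3 * Num.sqrt d%:R)) ^+ 2]%R <= p%:E)%E.
Proof.
move=> q1 p01; have [mX X1 Xinv] := XU.
have d0 : (0 < d)%N.
  case: (posnP d) => // d0; move: (dotv_eq1 q1); rewrite dotvvE big1 => [/esym/eqP|[j jd]].
    by rewrite oner_eq0.
  by exfalso; move: jd; rewrite d0.
pose i : 'I_d := Ordinal d0; have [Q Qo Qi] := reflection_to_axis i q1.
have sd : 1 <= Num.sqrt d%:R :> R by rewrite -[leLHS]sqrtr1 ler_wsqrtr// ler1n.
have sd2 : Num.sqrt d%:R ^+ 2 = d%:R :> R by rewrite sqr_sqrtr.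
set sq := Num.sqrt d%:R in sd sd2 *.
(* a <= t / 8 gives t + 2 a <= T. Then 1 - T^2 >= 1/2 and d (T / sqrt d + 2 a) = 5 p / 12 + t / 4 <=
   p / 2, so the strip has probability at most [p]. *)
pose t := p / (3 * sq); pose a := t / (8 * sq ^+ 2); pose T := 5 / 4 * t.
have t0 : 0 < t by rewrite divr_gt0 ?mulr_gt0//; lra.
have a0 : 0 < a by rewrite divr_gt0// mulr_gt0// exprn_gt0//; lra.
have tp : t * (3 * sq) = p by rewrite /t mulfVK// gt_eqF//; lra.
have t1 : t <= 1 / 3.
  have : t * 3 <= t * (3 * sq) by rewrite ler_wpM2l ?(ltW t0)//; lra.
  by rewrite tp; lra.
have sq2 : 1 <= sq ^+ 2 by rewrite exprn_ege1.
have aE : a * (8 * sq ^+ 2) = t by rewrite /a mulfVK// gt_eqF// mulr_gt0//; lra.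
have a8 : 8 * a <= t.
  by rewrite -aE mulrC ler_wpM2l ?(ltW a0)//; lra.
have T01 : 0 <= T <= 1 by rewrite /T; lra.
have tT : t + 2 * a <= T by rewrite /T; lra.
have := strip_probability i a0 T01 tT; rewrite -/sq -sd2 => strip.
have mB : measurable ([set x | x i 0 ^+ 2 < t ^+ 2] : set (borel_mx R d 1)).
  apply: measurable_lt_set => //; exact: measurable_funX 2 (sphere_bounded_coord i).1.
rewrite (_ : [set w | _] = [set w | [set x : 'cV[R]_d | x i 0 ^+ 2 < t ^+ 2] (Q *m X w)]); last first.
  by apply/seteqP; split=> w /=; rewrite Qi.
rewrite (Xinv _ _ Qo mB).
have mS : measurable [set w | `|X w i 0| <= t].
  apply: measurable_le_set => //; apply: measurableT_comp => //.
  by move/mx_measurableP: mX; apply.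
apply: (@le_trans _ _ (P [set w | `|X w i 0| <= t])).
  apply: le_measure; rewrite ?inE//.
    by have := mX measurableT _ mB; rewrite setTI.
  move=> w /=; rewrite -[x in x < _]real_normK ?num_real// => h.
  by rewrite -(ler_pXn2r (n := 2))// ?nnegrE ?(ltW t0)// ltW.
rewrite -[leLHS]fineK ?fin_num_measure// lee_fin.
set pr := fine _ in strip *.
have pr0 : 0 <= pr by rewrite fine_ge0.
have h1 : 1 / 2 * pr <= (1 - T ^+ 2) * pr.
  rewrite ler_wpM2r//; have : T ^+ 2 <= 1 / 2.
    by apply: (@le_trans _ _ ((1 / 2) ^+ 2)); [rewrite ler_sqr ?nnegrE//; rewrite /T; lra|lra].
  by lra.
have h2 : (sq ^+ 2 - 1) * (T / sq + 2 * a) <= sq ^+ 2 * (T / sq + 2 * a).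
  apply: ler_wpM2r; last by rewrite gerBl.
  apply: addr_ge0 (divr_ge0 _ (le_trans ler01 sd)) (mulr_ge0 _ (ltW a0)) => //.
  by case/andP: T01.
have h3 : sq ^+ 2 * (T / sq + 2 * a) = 5 / 12 * p + t / 4.
  have -> : sq ^+ 2 * (T / sq + 2 * a) = 5 / 12 * (t * (3 * sq)) + a * (8 * sq ^+ 2) / 4.
    by rewrite /T; field; rewrite gt_eqF//; lra.
  by rewrite tp aE.
have h4 : t / 4 <= p / 12.
  by rewrite -tp; have : t * 1 <= t * sq; [rewrite ler_wpM2l ?(ltW t0)|lra].
lra.
Qed.

End SphereExpectation.

(** * Probability that all start vectors overlap well *)

Section StartOverlap.
Variables (R : realType) (d k : nat) (dT : measure_display) (T : measurableType dT).
Variables (Alg : inverter R d T) (dO : measure_display) (Omega : measurableType dO).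
Variables (P : probability Omega R) (tape : Omega -> T) (w0 : nat -> Omega -> 'cV[R]_d).
Variables (delta eps p : R) (M : 'M[R]_d).
Hypothesis Algm : forall i j t, measurable_fun setT
  (fun x : (T * (R * borel_mx R d d * borel_mx R d 1 * R))%type =>
    solve Alg x.1 i j t x.2.1.1.1 x.2.1.1.2 x.2.1.2 x.2.2 : borel_mx R d 1).
Hypothesis tapem : measurable_fun setT tape.
Hypothesis w0U : forall s, (s < k)%N -> uniform_unit_vector P (w0 s).
Hypothesis ind : mutually_independent P tape k w0.
Hypotheses (d_gt0 : (0 < d)%N) (M0 : psd M) (p01 : 0 < p < 1).
Local Notation N omega := (lazy_mx k (solve Alg (tape omega)) delta eps p (fun s => w0 s omega) M).

Definition start_overlap s : set Omega := [set omega |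
  top_overlap (pca_overlap d (p / k%:R) ^+ 2) (N omega s) (w0 s omega)].

Let w0m s : (s < k)%N -> measurable_fun setT (w0 s : Omega -> borel_mx R d 1).
Proof. by move=> /w0U[]. Qed.

Lemma measurable_start_overlap s : (s < k)%N -> measurable (start_overlap s).
Proof.
move=> sk; apply: measurable_top_overlap; last by apply/mx_measurableP; exact: w0m.
apply: measurable_lazy_mx => // i si; apply/mx_measurableP; apply: w0m.
exact: ltn_trans si sk.
Qed.

Lemma frozen_start_overlap (N0 : 'M[R]_d) s : (s < k)%N -> psd N0 ->
  (P [set omega | ~ top_overlap (pca_overlap d (p / k%:R) ^+ 2) N0 (w0 s omega)]
   <= (p / k%:R)%:E)%E.
Proof.
move=> sk /spectral_theorem[Q [nu NQ]].
have k0 : 0 < k%:R :> R by rewrite ltr0n (leq_ltn_trans _ sk).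
have pk : 0 < p / k%:R < 1.
  rewrite divr_gt0//=; last by case/andP: p01.
  rewrite ltr_pdivrMr// mul1r (@lt_le_trans _ _ 1)//; first by case/andP: p01.
  by rewrite ler1n (leq_ltn_trans _ sk).
pose i : 'I_d := Ordinal d_gt0; pose q := col i Q.
have [QTQ NQE _ _] := NQ.
have q1 : norm2 q = 1.
  apply: norm2_eq1; have /matrixP/(_ i i) := QTQ; rewrite mxE [RHS]mxE eqxx mulr1n => <-.
  by rewrite dotvE; apply: eq_bigr => j _; rewrite !mxE.
have Nq : N0 *m q = nu 0%N *: q.
  apply/matrixP => j l; have /matrixP/(_ j i) := NQE; rewrite mul_mx_diag [RHS]mxE mulrC => h.
  transitivity ((N0 *m Q) j i); last by rewrite h !mxE.
  by rewrite !mxE; apply: eq_bigr => a _; rewrite !mxE.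
have [wm _ _] := w0U sk; have wm' : mx_measurable (w0 s) by exact/mx_measurableP.
apply: le_trans (pca_overlap_probability (w0U sk) q1 pk).
apply: le_measure; rewrite ?inE.
- by apply: measurableC; apply: measurable_top_overlap => //; exact: mx_measurable_cst.
- apply: measurable_lt_set => //; apply: measurable_funX.
  have := mx_measurableM (mx_measurable_cst q^T) wm' 0 0.
  exact.
- move=> omega /= bad; rewrite ltNge; apply/negP => ok; apply: bad.
  by apply: (top_overlapP NQ q1 Nq); rewrite sqr_ge0.
Qed.

Lemma start_overlap_probability s : (s < k)%N ->
  (P (~` start_overlap s) <= (p / k%:R)%:E)%E.
Proof.
move=> sk.
pose H := g_sigma_algebraType (history tape w0 s).
pose F : set (H * borel_mx R d 1) := [set x |
  ~ top_overlap (pca_overlap d (p / k%:R) ^+ 2) (N x.1 s) (x.2 : 'cV[R]_d)].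
have GI : setI_closed (history tape w0 s) by exact: history_setI.
have GT := history_setT tape w0 s.
have Gm := measurable_history tapem w0m (ltnW sk).
have hind A (B : set (borel_mx R d 1)) : history tape w0 s A -> measurable B ->
    P (A `&` w0 s @^-1` B) = (P A * P (w0 s @^-1` B))%E.
  exact: (history_independent tapem w0m ind sk).
apply: (independent_section_le GI GT Gm (w0m sk) hind (F := F)).
(* The first component carries the sigma-algebra of the history: M_s reads the tape and the start
   vectors before round [s] only. *)
- apply: measurableC; apply: measurable_top_overlap; last first.
    by apply/mx_measurableP; exact: measurable_snd.
  pose H' := g_sigma_algebraType (history tape w0 s).
  have /mx_measurableP h : mx_measurable (fun x : H' => N x s).
    apply: (measurable_lazy_mx (w0 := (w0 : nat -> H' -> 'cV[R]_d)) Algm).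
      exact: history_tape.
    by move=> i; exact: history_start.
  apply/mx_measurableP; apply: measurableT_comp h _.
  exact: measurable_fst.
- move=> omega; have N0 := lazy_mx_psd k (solve Alg (tape omega)) delta eps p (fun i => w0 i omega) s M0.
  exact: frozen_start_overlap sk N0.
Qed.

Lemma all_start_overlap_probability : (0 < k)%N ->
  let E := [set omega | forall s, (s < k)%N -> start_overlap s omega] in
  measurable E /\ ((1 - p)%:E <= P E)%E.
Proof.
move=> k0 E; pose U j := [set omega | exists2 s, (s < j)%N & ~ start_overlap s omega].
have UP j : (j <= k)%N -> measurable (U j) /\ (P (U j) <= (j%:R * (p / k%:R))%:E)%E.
  elim: j => [_|j IH jk].
    rewrite (_ : U 0%N = set0); first by rewrite measure0 mul0r.
    by apply/seteqP; split=> omega // [].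
  have [mU PU] := IH (ltnW jk).
  have mj : measurable (~` start_overlap j) by apply: measurableC; exact: measurable_start_overlap.
  rewrite (_ : U j.+1 = U j `|` ~` start_overlap j); last first.
    apply/seteqP; split=> omega.
      move=> [s]; rewrite ltnS leq_eqVlt => /predU1P[->|sj] h; [by right|left].
      by exists s.
    by move=> [[s sj h]|h]; [exists s => //; exact: ltnW|exists j].
  split; first exact: measurableU.
  apply: (le_trans (measureU2 _ _ _)) => //.
  rewrite -natr1 mulrDl mul1r EFinD; apply: leeD => //.
  exact: start_overlap_probability.
have [mU PU] := UP k (leqnn k).
have -> : E = ~` U k.
  apply/seteqP; split=> omega; first by move=> h [s sk] /(_ (h s sk)).
  by move=> h s sk; apply: contrapT => n; apply: h; exists s.
split; first exact: measurableC.
rewrite probability_setC// EFinB leeB//.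
by move: PU; rewrite mulrC mulfVK// pnatr_eq0 -lt0n.
Qed.

End StartOverlap.

(** Five of the six factors [eps] are bounded by 3^5 = 243, and 2 * 243 * 10^-6 <= 1/100. The
    denominator dominates k d (x / y)^2, the loss to be compensated: [k] rounds, [d] eigenvalues,
    and an error relative to sigma_1^2 measured against sigma_(k+1)^2. *)
Lemma epca_small (R : realType) (k d : nat) (eps x y : R) : (0 < k)%N -> (0 < d)%N ->
  0 < eps < 3 -> 0 < y <= x ->
  let e := (1 / 100) ^+ 3 * (eps ^+ 6 / (k%:R ^+ 4 * d%:R ^+ 4 * (x / y) ^+ 12)) in
  e <= eps / 100 /\ d%:R * (k%:R * (2 * e * x ^+ 2)) <= eps / 100 * y ^+ 2.
Proof.
move=> k0 d0 /andP[e0 e3] /andP[y0 yx] e.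
have kR : 1 <= k%:R :> R by rewrite ler1n.
have dR : 1 <= d%:R :> R by rewrite ler1n.
set z := x / y; have z1 : 1 <= z by rewrite ler_pdivlMr// mul1r.
have xE : x = z * y by rewrite /z mulfVK// gt_eqF.
set D := k%:R ^+ 4 * d%:R ^+ 4 * z ^+ 12 in e *.
have e5 : eps ^+ 5 <= 243.
  apply: (@le_trans _ _ (3 ^+ 5)); last by rewrite -natrX.
  by rewrite lerXn2r ?nnegrE ?(ltW e0) ?(ltW e3).
have e6 : eps ^+ 6 <= 243 * eps by rewrite exprSr ler_wpM2r// ltW.
have D_ge : k%:R * d%:R * z ^+ 2 <= D.
  have pw (a : R) i j : 1 <= a -> (i <= j)%N -> a ^+ i <= a ^+ j by move=> a1 ij; rewrite ler_weXn2l.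
  have k4 := pw _ 1%N 4%N kR isT; have d4 := pw _ 1%N 4%N dR isT; have z12 := pw _ 2%N 12%N z1 isT.
  have z2 : 0 <= z ^+ 2 by exact: sqr_ge0.
  rewrite !expr1 in k4 d4; apply: ler_pM => //.
  exact: ler_pM.
have kdz : 1 <= k%:R * d%:R * z ^+ 2 by apply: mulr_ege1; [exact: mulr_ege1|exact: exprn_ege1].
have D0 : 0 < D by apply: lt_le_trans D_ge; apply: lt_le_trans kdz.
have eD : e * D = (1 / 100) ^+ 3 * eps ^+ 6 by rewrite /e; field; rewrite gt_eqF.
have c_eps : 2 * ((1 / 100) ^+ 3 * eps ^+ 6) <= eps / 100.
  by apply: (@le_trans _ _ (2 * ((1 / 100) ^+ 3 * (243 * eps)))); [rewrite ler_wpM2l// ler_wpM2l|]; lra.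
have e_ge0 : 0 <= e by rewrite mulr_ge0// divr_ge0 ?(ltW D0)// exprn_ge0// ltW.
have eD1 : e <= e * D by rewrite ler_peMr// (le_trans kdz).
split; first by move: eD eD1 c_eps e_ge0; move: (eps ^+ 6) => w; lra.
rewrite xE exprMn.
have -> : d%:R * (k%:R * (2 * e * (z ^+ 2 * y ^+ 2))) = 2 * (e * (k%:R * d%:R * z ^+ 2)) * y ^+ 2 by ring.
rewrite ler_wpM2r ?sqr_ge0//; apply: le_trans c_eps.
by rewrite ler_wpM2l// -eD ler_wpM2l.
Qed.

Theorem corollary4p4 (R : realType) :
  exists2 c : R, 0 < c &
  forall C0 : R, 0 < C0 ->
  exists (C : R) (q : nat),
  forall (d n k : nat) (A : 'M[R]_(d, n))
    (U : 'M[R]_d) (sigma : nat -> R) (W : 'M[R]_n) (eps p : R)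
    (dT : measure_display) (T : measurableType dT) (Alg : inverter R d T)
    (dO : measure_display) (Omega : measurableType dO)
    (P : probability Omega R)
    (tape : Omega -> T) (w0 : nat -> Omega -> 'cV[R]_d),
  let delta := eps / 3 in
  let epca := c * (eps ^+ 6 /
    (k%:R ^+ 4 * d%:R ^+ 4 * (sigma 0%N / sigma k) ^+ 12)) in
  is_svd A U sigma W -> sigma 0%N <= 1 ->
  (1 <= k <= d)%N -> 0 < delta < 1 -> 0 < epca < 1 -> 0 < p < 1 ->
  approximate_inverter Alg ->
  measurable_fun setT tape ->
  (forall s, (s < k)%N -> uniform_unit_vector P (w0 s)) ->
  mutually_independent P tape k w0 ->
  exists E : set Omega,
  [/\ measurable E, ((1 - p)%:E <= P E)%E &
  forall omega, E omega ->
    let M := A *m A^T in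
    let inv := solve Alg (tape omega) in
    let cost := work Alg (tape omega) in
    let start := fun s => w0 s omega in
    let V := lazy_svd inv M k delta epca p start in
    let Ak := V *m V^T *m A in
    let Akstar := truncated_svd U sigma W k in
    let time := lazy_time inv cost M k delta epca p start in
    let L := log_factor d n k sigma eps p in
    [/\ lazy_halts inv M k delta epca p start,
        \rank Ak = k,
        [/\ spectral_norm (A - Ak) <= (1 + eps) * spectral_norm (A - Akstar),
            frobenius (A - Ak) <= (1 + eps) * frobenius (A - Akstar) &
            forall i : 'I_k,
              `|quad M (col i V) - sigma i ^+ 2| <= eps * sigma i ^+ 2],
        agd_work C0 Alg ->
          (time (agd_price A) agd_update)%:R <=
            C * ((k%:R * (nnz A)%:R + k%:R ^+ 2 * d%:R) / Num.sqrt eps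
                 * L ^+ q) &
        average_of_rank_one n M -> svrg_work C0 n Alg ->
          (time svrg_price (svrg_update n d))%:R <=
            C * ((k%:R * n%:R * d%:R +
                  k%:R * n%:R `^ (3 / 4) * d%:R /
                    (Num.sqrt (sigma k.-1) * Num.sqrt eps))
                 * L ^+ q)]].
Proof.
(* [c] is hidden behind an equation so that later arithmetic does not unfold the numeral. *)
have [c c0 cE] : exists2 c : R, 0 < c & c = (1 / 100) ^+ 3.
  by exists ((1 / 100) ^+ 3); rewrite ?exprn_gt0.
exists c => // C0 C0_gt0; exists ((3564 * C0 + 8) * (100 * cost_base c) ^+ 4), 4%N.
move=> d n k A U sigma W eps p dT T Alg dO Omega P tape w0 delta epca.
move=> svdA sigma1 /andP[k0 _] delta01 epca01 p01 [inv_acc Algm] tapem w0U ind.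
have eps03 : 0 < eps < 3 by move: delta01; rewrite /delta; lra.
have /andP[e0 _] := epca01.
(* With the inverse of 0 equal to 0, [sigma k] = 0 would make [epca] itself 0. Its admissibility
   thus forces sigma_(k+1) > 0, and hence k < min(d, n). *)
have sigmak : 0 < sigma k.
  rewrite lt_neqAle (sigma_ge0 svdA) andbT eq_sym; apply/eqP => s0.
  by move: e0; rewrite /epca s0 invr0 mulr0 expr0n /= mulr0 invr0 !mulr0 ltxx.
have kd : (k < d)%N by have := rank_lt svdA sigmak; rewrite ltn_min => /andP[].
have d0 : (0 < d)%N by exact: leq_ltn_trans kd.
have s0k : 0 < sigma k <= sigma 0%N.
  by rewrite sigmak; case: svdA => _ _ /(_ _ _ (leq0n k))/andP[].
have [e_small eta_small] : epca <= eps / 100 /\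
    d%:R * (k%:R * (2 * epca * sigma 0%N ^+ 2)) <= eps / 100 * sigma k ^+ 2.
  by rewrite /epca cE; exact: epca_small.
have M0 := psd_gram A.
exists [set omega | forall s, (s < k)%N ->
  start_overlap k Alg tape w0 delta epca p (A *m A^T) s omega].
have [mE PE] := all_start_overlap_probability delta epca Algm tapem w0U ind d0 M0 p01 k0.
split=> // omega top M inv cost start V Ak Akstar time L.
have w01 s : (s < k)%N -> norm2 (start s) = 1 by move=> /w0U[_ + _]; exact.
have acc := inv_acc (tape omega).
have [Qnu QnuP] := lazy_eigen_ex k eps epca p inv start svdA.
have rounds s (sk : (s < k)%N) :=
  all_rounds_ok svdA sigma1 sigmak k0 eps03 p01 e0 e_small acc w01 top QnuP sk.
have vecs := all_vectors_ok svdA sigma1 sigmak k0 eps03 p01 e0 e_small acc w01 top QnuP (leqnn k).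
have [rk sp fr ray] :=
  lazy_svd_spec svdA sigma1 sigmak k0 eps03 p01 e0 e_small eta_small acc w01 top QnuP.
split=> //.
- exact: (lazy_halts_spec svdA sigma1 sigmak k0 eps03 p01 e0 e_small acc w01 top QnuP).
- move=> agd.
  apply: (agd_time svdA sigmak k0 eps03 p01 c0 e0 e_small acc w01 QnuP.2 rounds C0_gt0).
  move=> s i t lam b eta del sk lam0 del0 eta0 gap; apply: agd => //.
  exact: lazy_mx_psd.
- move=> avg svrg.
  have PS := lazy_projS k inv delta epca p start M.
  have P0 := lazy_proj0 k inv delta epca p start M.
  apply: (svrg_time svdA sigmak k0 eps03 p01 c0 e0 e_small acc w01 QnuP.2 rounds _ C0_gt0 avg).
    move=> s sk; have v1 i : (i < s)%N -> norm2 (lazy_vec k inv delta epca p start M i) = 1.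
      by move=> si; have [] := vecs i (ltn_trans si sk).
    have Pv i : (i < s)%N -> lazy_proj k inv delta epca p start M i *m
        lazy_vec k inv delta epca p start M i = lazy_vec k inv delta epca p start M i.
      by move=> si; have [] := vecs i (ltn_trans si sk).
    split; first exact: (proj_sym P0 PS).
      exact: (proj_idem P0 PS v1 Pv (leqnn s)).
    have NS := lazy_mxS k inv delta epca p start M.
    exact: (deflation_proj (erefl : lazy_mx k inv delta epca p start M 0 = M) P0 NS PS Pv (leqnn s)).
  move=> s i t lam b eta del sk avgs lam0 del0 eta0 gap; exact: svrg.
Qed.
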